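(* Let $n\ge 1$. A map $\Psi:\mathrm{Conv}_{(0)}(\mathbb{R}^n)\to\mathrm{Conv}_{(0)}(\mathbb{R}^n)$ is continuous, additive and $\mathrm{GL}(n)$-equivariant if and only if there exist $\nu\in\mathcal{M}_c^+(\mathbb{R})$ with $\int_{\mathbb{R}^\times}|s|^{-1}\,d\nu(s)<\infty$ and $c\in\mathbb{R}$ such that $$\Psi(f)[x]=c f(0)+\int_{\mathbb{R}^\times}\frac{f(sx)-f(0)}{|s|^2}\,d\nu(s),\qquad x\in\mathbb{R}^n,$$ for every $f\in\mathrm{Conv}_{(0)}(\mathbb{R}^n)$. Moreover, the map $\Psi$ defined by this formula is - monotone if and only if $\int_{\mathbb{R}^\times}|s|^{-2}\,d\nu(s)\le c<\infty$; - dually translation-invariant if and only if $\int_{\mathbb{R}^\times}s^{-1}\,d\nu(s)=0$.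
   Context: $\mathrm{Conv}(\mathbb{R}^n)$ is the set of all lower semi-continuous convex functions $f:\mathbb{R}^n\to(-\infty,+\infty]$ that are not identically $+\infty$, and $\mathrm{Conv}_{(0)}(\mathbb{R}^n)$ is the subset of those $f$ that are finite on a neighborhood of $0$. These spaces carry the topology induced by epi-convergence: $f_j$ epi-converges to $f$ if for every $x$ (i) $f(x)\le\liminf_j f_j(x_j)$ for every sequence $x_j\to x$, and (ii) there is a sequence $x_j\to x$ with $f(x)=\lim_j f_j(x_j)$. Continuity of $\Psi$ refers to this topology. $\Psi(f)[x]$ denotes the value of the function $\Psi(f)$ at $x$. $\Psi$ is additive if $\Psi(g+h)=\Psi(g)+\Psi(h)$ for all $g,h$ in the domain (pointwise addition). $\Psi$ is $\mathrm{GL}(n)$-equivariant if $\Psi(\eta\cdot f)=\eta\cdot\Psi(f)$ for all $\eta\in\mathrm{GL}(n)$, where $(\eta\cdot f)(x)=f(\eta^{-1}x)$. $\Psi$ is monotone if $f\le g$ pointwise implies $\Psi(f)\le\Psi(g)$ pointwise. $\Psi$ is dually translation-invariant if $\Psi(f+\ell)=\Psi(f)$ for every $f$ in the domain and every linear function $\ell:\mathbb{R}^n\to\mathbb{R}$. $\mathcal{M}_c^+(\mathbb{R})$ is the set of non-negative (finite) Borel measures on $\mathbb{R}$ with compact support; $\mathbb{R}^\times=\mathbb{R}\setminus\{0\}$. *)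

(* Defs.v *)
From HB Require Import structures.
From mathcomp Require Import all_boot all_order all_algebra.
From mathcomp Require Import all_classical all_reals all_analysis.
From mathcomp Require Import lra.
Set Implicit Arguments.
Unset Strict Implicit.
Unset Printing Implicit Defensive.
Import Order.TTheory GRing.Theory Num.Theory.
Import numFieldNormedType.Exports.
Local Open Scope classical_set_scope.
Local Open Scope ring_scope.

Definition econvex (R : realType) (n : nat) (f : 'cV[R]_n -> \bar R) :=
  forall (x y : 'cV[R]_n) (t : R), 0 < t < 1 ->
    (f (t *: x + (1 - t) *: y)%R <= t%:E * f x + (1 - t)%:E * f y)%E.

Record Conv (R : realType) (n : nat) := MkConv {
  conv_fun :> 'cV[R]_n -> \bar R ;
  conv_lsc : lower_semicontinuous conv_fun ;
  conv_convex : econvex conv_fun ;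
  conv_gtNy : forall x, (-oo < conv_fun x)%E ;
  conv_proper : exists x, conv_fun x != +oo%E }.

Record Conv0 (R : realType) (n : nat) := MkConv0 {
  conv0_conv :> Conv R n ;
  conv0_fin : \forall x \near (0 : 'cV[R]_n), conv0_conv x \is a fin_num }.

Lemma conv0_ext (R : realType) (n : nat) (f g : Conv0 R n) :
  (f : 'cV[R]_n -> \bar R) = g -> f = g.
Proof.
case: f g => [[f f1 f2 f3 f4] f5] [[g g1 g2 g3 g4] g5] /= E.
move: f1 f2 f3 f4 f5; rewrite E => f1 f2 f3 f4 f5.
rewrite (Prop_irrelevance f1 g1) (Prop_irrelevance f2 g2).
rewrite (Prop_irrelevance f3 g3) (Prop_irrelevance f4 g4) in f5 *.
by rewrite (Prop_irrelevance f5 g5).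
Qed.

Definition epi_cvg (R : realType) (n : nat) (f_ : nat -> 'cV[R]_n -> \bar R)
    (f : 'cV[R]_n -> \bar R) :=
  forall x : 'cV[R]_n,
    (forall x_ : nat -> 'cV[R]_n, x_ @ \oo --> x ->
       (f x <= limn_einf (fun j => f_ j (x_ j)))%E) /\
    (exists2 x_ : nat -> 'cV[R]_n, x_ @ \oo --> x &
       (fun j => f_ j (x_ j)) @ \oo --> f x).

(* The epi-topology: a set is open when every sequence that epi-converges to
   one of its points is eventually inside it.  As epi-convergence is metrizable
   on lower semicontinuous functions, the convergent sequences of this topology
   are the epi-convergent ones, and it is the subspace topology inherited from
   [Conv]. *)
Definition epi_open (R : realType) (n : nat) (U : set (Conv0 R n)) :=
  forall (f_ : nat -> Conv0 R n) (f : Conv0 R n),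
    epi_cvg f_ f -> U f -> \forall j \near \oo, U (f_ j).

Section epi_topology.
Variables (R : realType) (n : nat).

HB.instance Definition _ := gen_eqMixin (Conv0 R n).
HB.instance Definition _ := gen_choiceMixin (Conv0 R n).

Let epi_openT : epi_open [set: Conv0 R n].
Proof. by move=> f_ f _ _; apply: nearW. Qed.

Let epi_openI : setI_closed (@epi_open R n).
Proof.
move=> U V oU oV f_ f ff [Uf Vf].
by apply: filterI; [apply: oU ff Uf|apply: oV ff Vf].
Qed.

Let epi_open_bigcup (I : Type) (U : I -> set (Conv0 R n)) :
  (forall i, epi_open (U i)) -> epi_open (\bigcup_i U i).
Proof.
move=> oU f_ f ff [i _ Uf].
by have := oU i _ _ ff Uf; apply: filterS => j Uj; exists i.
Qed.

HB.instance Definition _ := isOpenTopological.Build (Conv0 R n)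
  epi_openT epi_openI epi_open_bigcup.

End epi_topology.

Lemma sum_coord_continuous (R : realType) (n : nat) (a : 'I_n -> R) (j : 'I_1) :
  continuous (fun x : 'cV[R]_n => \sum_k a k * x k j).
Proof.
apply: continuous_big => [|k _ x]; first exact: add_continuous.
apply: (@continuous_comp _ _ _ (fun x : 'cV[R]_n => x k j) ( *%R (a k))).
  exact: coord_continuous.
exact: mulrl_continuous.
Qed.

Section operations.
Variables (R : realType) (n : nat).
Implicit Types (f g : Conv0 R n) (x y : 'cV[R]_n).

Lemma conv0_fin0 f : f 0 \is a fin_num.
Proof. exact: nbhs_singleton (conv0_fin f). Qed.

Let addf_lsc f g : lower_semicontinuous (fun x => f x + g x)%E.
Proof.
move=> x a afg.
have [r [rf rg]] : exists r : R, (r%:E < f x)%E /\ ((a - r)%:E < g x)%E.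
  move: afg (conv_gtNy f x) (conv_gtNy g x).
  case: (f x) => [u| |] //; case: (g x) => [v| |] // auv _ _.
  - exists (u - (u + v - a) / 2).
    by move: auv; rewrite -EFinD !lte_fin => auv; split; lra.
  - by exists (u - 1); rewrite lte_fin ltry; split => //; lra.
  - by exists (a - v + 1); rewrite lte_fin ltry; split => //; lra.
  - by exists 0; rewrite !ltry.
have [V Vx fV] := conv_lsc rf; have [W Wx gW] := conv_lsc rg.
exists (V `&` W); first exact: filterI.
move=> y [/fV fy /gW gy].
have -> : a%:E = (r%:E + (a - r)%:E)%E by rewrite -EFinD addrC subrK.
exact: lteD.
Qed.

Let addf_convex f g : econvex (fun x => f x + g x)%E.
Proof.
move=> x y t /andP[t0 t1].
have dm s z : (s%:E * (f z + g z) = s%:E * f z + s%:E * g z)%E.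
  rewrite muleDr //; have := conv_gtNy f z; have := conv_gtNy g z.
  by case: (f z) => [u| |] //; case: (g z).
rewrite !dm addeACA; apply: leeD; apply: conv_convex; exact/andP.
Qed.

Let addf_gtNy f g x : (-oo < f x + g x)%E.
Proof.
have := conv_gtNy f x; have := conv_gtNy g x.
by case: (f x) => [u| |] //; case: (g x) => // v _ _; rewrite -EFinD ltNyr.
Qed.

Let addf_proper f g : exists x, (f x + g x != +oo)%E.
Proof.
exists 0; have := conv0_fin0 f; have := conv0_fin0 g.
by case: (f 0) => // u; case: (g 0).
Qed.

Let addf_fin f g : \forall x \near (0 : 'cV[R]_n), (f x + g x)%E \is a fin_num.
Proof.
have := conv0_fin f; have := conv0_fin g.
by apply: filterS2 => x gx fx; rewrite fin_numD fx.
Qed.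

Definition conv0_add f g : Conv0 R n :=
  @MkConv0 R n (MkConv (@addf_lsc f g) (@addf_convex f g) (@addf_gtNy f g)
    (addf_proper f g)) (addf_fin f g).

Let mulmx_continuous (A : 'M[R]_n) : continuous (fun x : 'cV[R]_n => A *m x).
Proof.
move=> x V [P Px PV].
have Pnear i j : \forall y \near x, P i j ((A *m y) i j).
  have : (fun y : 'cV[R]_n => (A *m y) i j) @ x --> (A *m x) i j.
    under eq_fun do rewrite mxE.
    by rewrite mxE; exact: sum_coord_continuous.
  by apply; exact: Px.
have : \forall y \near x, forall i j, P i j ((A *m y) i j).
  have F : Filter (nbhs x) := nbhs_filter x.
  by apply: (filter_forall F) => i; apply: (filter_forall F) => j; exact: Pnear.
by apply: filterS => y; exact: PV.
Qed.

Variable eta : 'M[R]_n.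
Let act f x := f (invmx eta *m x).

Let act_lsc f : lower_semicontinuous (act f).
Proof.
move=> x a /conv_lsc[V Vx fV].
by exists ((fun y => invmx eta *m y) @^-1` V) => [|y /fV //]; exact: mulmx_continuous.
Qed.

Let act_convex f : econvex (act f).
Proof. by move=> x y t t01; rewrite /act mulmxDr -!scalemxAr; exact: conv_convex. Qed.

Let act_gtNy f x : (-oo < act f x)%E.
Proof. exact: conv_gtNy. Qed.

Let act_proper f : exists x, act f x != +oo%E.
Proof. by exists 0; rewrite /act mulmx0; have := conv0_fin0 f; case: (f 0). Qed.

Let act_fin f : \forall x \near (0 : 'cV[R]_n), act f x \is a fin_num.
Proof.
have := @mulmx_continuous (invmx eta) 0.
by rewrite /continuous_at mulmx0 => /(_ _ (conv0_fin f)).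
Qed.

(* [invmx] is total, so the action is defined for every square matrix; equivariance
   only involves invertible ones. *)
Definition conv0_act f : Conv0 R n :=
  @MkConv0 R n (MkConv (@act_lsc f) (@act_convex f) (@act_gtNy f) (act_proper f))
    (act_fin f).

End operations.

Section linear_functions.
Variables (R : realType) (n : nat) (l : {scalar 'cV[R]_n}).
Let lE (x : 'cV[R]_n) : \bar R := (l x)%:E.

Let l_continuous : continuous l.
Proof.
suff -> : (l : 'cV[R]_n -> R) = fun x => \sum_k l (delta_mx k 0) * x k 0.
  exact: sum_coord_continuous.
apply/funext => x; rewrite [in LHS](matrix_sum_delta x) linear_sum.
by apply: eq_bigr => k _; rewrite big_ord1 linearZ/= mulrC.
Qed.

Let l_lsc : lower_semicontinuous lE.
Proof.
move=> x a; rewrite lte_fin => al; exists (l @^-1` [set r | a < r]).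
  by apply: l_continuous; exact: lt_nbhsr.
by move=> y; rewrite lte_fin.
Qed.

Let l_convex : econvex lE.
Proof. by move=> x y t _; rewrite /lE linearD !linearZ/= -!EFinM -EFinD. Qed.

Let l_gtNy x : (-oo < lE x)%E. Proof. exact: ltNyr. Qed.

Let l_proper : exists x, lE x != +oo%E. Proof. by exists 0. Qed.

Let l_fin : \forall x \near (0 : 'cV[R]_n), lE x \is a fin_num.
Proof. by near=> x. Unshelve. all: by end_near. Qed.

Definition conv0_linear : Conv0 R n :=
  @MkConv0 R n (MkConv l_lsc l_convex l_gtNy l_proper) l_fin.

End linear_functions.

Section operators.
Variables (R : realType) (n : nat) (Psi : Conv0 R n -> Conv0 R n).

Definition conv0_additive :=
  forall g h : Conv0 R n, Psi (conv0_add g h) = conv0_add (Psi g) (Psi h).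

Definition GL_equivariant :=
  forall (eta : 'M[R]_n) (f : Conv0 R n), eta \in unitmx ->
    Psi (conv0_act eta f) = conv0_act eta (Psi f).

Definition conv0_monotone :=
  forall f g : Conv0 R n, (forall x, (f x <= g x)%E) ->
    forall x, (Psi f x <= Psi g x)%E.

Definition dually_translation_invariant :=
  forall (f : Conv0 R n) (l : {scalar 'cV[R]_n}),
    Psi (conv0_add f (conv0_linear l)) = Psi f.

End operators.

Section measures.
Variables (R : realType) (nu : {finite_measure set (measurableTypeR R) -> \bar R}).

Definition msupport : set R :=
  [set s | forall U : set R, open_nbhs s U -> (0 < nu U)%E].

Definition Rtimes : set (measurableTypeR R) := [set s : R | s != 0].

Definition admissible_measure :=
  compact msupport /\ (\int[nu]_(s in Rtimes) (`|s : R|^-1)%:E < +oo)%E.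

Definition represented_by (n : nat) (c : R) (Psi : Conv0 R n -> Conv0 R n) :=
  forall (f : Conv0 R n) (x : 'cV[R]_n),
    Psi f x = (c%:E * f 0%R +
      \int[nu]_(s in Rtimes) ((f ((s : R) *: x)%R - f 0%R) * (`|s : R| ^- 2)%:E))%E.

End measures.

(* Main.v *)
From HB Require Import structures.
Require Import Defs.
From mathcomp Require Import all_boot all_order all_algebra.
From mathcomp Require Import all_classical all_reals all_analysis.
From mathcomp Require Import measurable_realfun.
From mathcomp Require Import lra ring.
Import Order.TTheory GRing.Theory Num.Theory.
Import numFieldNormedType.Exports.
Local Open Scope classical_set_scope.
Local Open Scope ring_scope.
Set Implicit Arguments.
Unset Strict Implicit.
Unset Printing Implicit Defensive.


(** Sufficiency.  Let [nu] vanish outside [-A, A].  A function [f] in the domain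
    is bounded below by [f 0 - L * |x|], so the integrand
    [(f (s *: x) - f 0) / s ^ 2], called [diffq] below, is at least
    [- L * |x| / |s|].  Adding [K / |s|] makes it nonnegative at a finite cost, and
    the value of the operator becomes a well-defined element of (-oo, +oo].
    Additivity, equivariance and convexity are then pointwise.  For continuity, let
    [f_j] epi-converge to [f].  Fatou's lemma gives the lower bound
    ([formula_liminf]), and with constant sequences also lower semicontinuity.  For
    a recovery sequence at [x] one approaches [x] along the ray from the origin:
    at [lam *: x] with [lam < 1] almost every point [s *: (lam *: x)] is interior to
    the domain of [f], the convergence is pointwise there, and dominated
    convergence applies ([formula_cvg]); a diagonal choice concludes.

    Continuity is for a topology whose open sets are sequentially open, hence it
    follows from preservation of epi-limits.  Conversely, what continuity of an
    operator yields is extracted through two kinds of sequentially open sets: those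
    which control point evaluations ([continuous_eval]), and complements of
    epi-convergent sequences ([epi_cvg_unique]), which show that an
    epi-convergent sequence has one limit only.

    Necessity.  Let [Psi] be continuous, additive and equivariant, and let [E phi]
    be the value at a basis vector of the image of the ridge function
    [x |-> phi (x_i)].  It is finite ([operator_fin]) and defines an additive,
    homogeneous, continuous functional on convex functions of one real variable
    ([op_fun_functional]).  Such a functional is determined by its values on the
    constant [1] and on the hinges [s |-> (t * s - 1)_+], because convex functions
    are limits of piecewise affine ones ([functional_unique]).  And [E] determines
    [Psi] ([operator_unique]): by equivariance only values at a basis vector matter;
    contracting the other directions replaces a finite function by a ridge function
    without changing the value there; finite functions are dense.  So it remains to
    find [nu] with
<<
      k t := E (hinge t (-1)) = \int (t * s - 1)_+ / s ^ 2 d nu(s)   for all t.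
>>
    The function [k] is convex, being the restriction of one image to a line; it
    vanishes near the origin ([profile_flat]), since arbitrary multiples of
    [hinge t (-1)] tend to [0] with [t]; and its slopes are bounded
    ([profile_slopes]).  Its second derivative [kappa] is therefore a finite measure
    without mass near the origin, and Taylor's formula expresses [k t] as the
    [kappa]-integral of [(t - tau)_+] for [tau > 0] and of [(tau - t)_+] for
    [tau < 0].  The image of [kappa / |tau|] under [s = 1 / tau] is the measure
    [nu]: its support is compact because [kappa] vanishes near [0], and
    [\int |s|^-1 d nu] is the total mass of [kappa] ([representing_measure]).

    Monotonicity.  If [\int s ^- 2 d nu <= c], the formula reads
    [(c - \int s ^- 2 d nu) * f 0 + \int f (s *: x) / s ^ 2 d nu], and both terms
    increase with [f].  Conversely, comparing the images of [k * |x_i| - 1] and of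
    its positive part, for large [k], yields the inequality.  Finally,
    a linear function [l] is mapped to [l] times [\int s^-1 d nu], so dual
    translation invariance means that this factor is [0]. *)

(** * Limits in the extended reals *)

Section ereal_sequences.
Variable R : realType.
Implicit Types (u : nat -> \bar R) (x y l : \bar R) (r : R).

Lemma ereal_dense x y : (x < y)%E -> exists r : R, (x < r%:E)%E /\ (r%:E < y)%E.
Proof.
case: x y => [x| |] [y| |] //.
- by rewrite lte_fin => xy; exists ((x + y) / 2); rewrite !lte_fin; split; lra.
- by move=> _; exists (x + 1); rewrite lte_fin ltry; split => //; lra.
- by move=> _; exists (y - 1); rewrite lte_fin ltNyr; split => //; lra.
- by move=> _; exists 0; rewrite ltry ltNyr.
Qed.

Lemma ereal_le_lt x y : (forall r, (r%:E < x)%E -> (r%:E <= y)%E) -> (x <= y)%E.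
Proof.
move=> H; rewrite leNgt; apply/negP => /ereal_dense[r [yr rx]].
by have := H _ rx; rewrite leNgt yr.
Qed.

Lemma ereal_le_gt x y : (forall r, (y < r%:E)%E -> (x <= r%:E)%E) -> (x <= y)%E.
Proof.
move=> H; rewrite leNgt; apply/negP => /ereal_dense[r [yr rx]].
by have := H _ yr; rewrite leNgt rx.
Qed.

Lemma abse_le x r : ((- r)%:E <= x)%E -> (x <= r%:E)%E -> (`|x| <= r%:E)%E.
Proof. by case: x => [a| |] //=; rewrite !lee_fin ler_norml => -> ->. Qed.

Lemma ecvg_gt u l r : u @ \oo --> l -> (r%:E < l)%E ->
  \forall j \near \oo, (r%:E < u j)%E.
Proof. by move=> ul rl; exact: (ul _ (open_ereal_gt' rl)). Qed.

Lemma ecvg_lt u l r : u @ \oo --> l -> (l < r%:E)%E ->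
  \forall j \near \oo, (u j < r%:E)%E.
Proof. by move=> ul rl; exact: (ul _ (open_ereal_lt' rl)). Qed.

Lemma ecvg_sandwich u l :
  (forall r, (r%:E < l)%E -> \forall j \near \oo, (r%:E < u j)%E) ->
  (forall r, (l < r%:E)%E -> \forall j \near \oo, (u j < r%:E)%E) ->
  u @ \oo --> l.
Proof.
case: l => [l| |] lo hi.
- apply/fine_cvgP; split.
    have l1 : ((l - 1)%:E < l%:E)%E by rewrite lte_fin; lra.
    have l2 : (l%:E < (l + 1)%:E)%E by rewrite lte_fin; lra.
    by have := lo _ l1; have := hi _ l2; apply: filterS2 => j; case: (u j).
  apply/cvgrPdist_lt => e e0 /=.
  have l1 : ((l - e)%:E < l%:E)%E by rewrite lte_fin; lra.
  have l2 : (l%:E < (l + e)%:E)%E by rewrite lte_fin; lra.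
  have := lo _ l1; have := hi _ l2; apply: filterS2 => j.
  case: (u j) => //= x; rewrite !lte_fin ltr_norml => ? ?.
  by apply/andP; split; lra.
- by apply/cvgeyPgt => A; apply: lo; exact: ltry.
- by apply/cvgeNyPlt => A; apply: hi; exact: ltNyr.
Qed.

Lemma einf_gt u r : (r%:E < limn_einf u)%E -> \forall j \near \oo, (r%:E < u j)%E.
Proof.
rewrite limn_einf_lim => rl.
have /ecvg_gt/(_ rl)[N _ /(_ N (leqnn _)) NN] := @is_cvg_einfs _ u.
exists N => // j Nj; apply: lt_le_trans NN _.
by apply: ereal_inf_lbound; exists j.
Qed.

Lemma le_einf u l : (forall r, (r%:E < l)%E -> \forall j \near \oo, (r%:E < u j)%E) ->
  (l <= limn_einf u)%E.
Proof.
move=> H; apply: ereal_le_lt => r /H[N _ Nr].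
rewrite limn_einf_lim; apply: lime_ge; first exact: is_cvg_einfs.
exists N => // n Nn; apply: le_ereal_inf_tmp => _ [k /= nk <-].
by apply/ltW/Nr; exact: leq_trans nk.
Qed.

End ereal_sequences.

Section diagonal.
Variable P : nat -> nat -> Prop.

(** A diagonal choice: if each level [k] is eventually reached, one can let the
    level tend to infinity along the sequence. *)
Lemma eventually_diagonal : (forall k, \forall j \near \oo, P j k) ->
  exists lev : nat -> nat, (lev @ \oo --> \oo) /\ \forall j \near \oo, P j (lev j).
Proof.
move=> H.
have /choice[N HN] : forall k, exists n, forall j, (n <= j)%N -> P j k.
  by move=> k; have [n _ nk] := H k; exists n => j nj; exact: nk.
exists (fun j => \max_(k < j.+1 | (N k <= j)%N) k); split.
  apply/cvgnyPge => K; exists (maxn K (N K)) => // j /=.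
  rewrite geq_max => /andP[Kj NKj].
  have Kj1 : (K < j.+1)%N by [].
  exact: (@leq_bigmax_cond _ (fun k : 'I_j.+1 => (N k <= j)%N) val (Ordinal Kj1)).
exists (N 0%N) => // j /= N0j; apply: HN.
have card : (0 < #|[pred k : 'I_j.+1 | (N k <= j)%N]|)%N.
  by apply/card_gt0P; exists ord0; rewrite inE.
by have [k kN ->] := @eq_bigmax_cond _ [pred k : 'I_j.+1 | (N k <= j)%N] val card.
Qed.

(** Dually, if each level is reached arbitrarily late, then it is reached along
    a strictly increasing sequence of times. *)
Lemma frequently_diagonal : (forall k N, exists2 j, (N <= j)%N & P j k) ->
  exists2 J : nat -> nat, {homo J : k l / (k < l)%N} & forall k, P (J k) k.
Proof.
move=> H.
have /choice[c Hc] : forall kN : nat * nat, exists j, (kN.2 <= j)%N /\ P j kN.1.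
  by move=> [k N]; have [j] := H k N; exists j.
pose J := fix J k := if k is k'.+1 then c (k, (J k').+1) else c (0%N, 0%N).
exists J; last by case => [|k]; [exact: (Hc (_, _)).2|exact: (Hc (k.+1, _)).2].
apply: homo_ltn; first exact: ltn_trans.
by move=> k; exact: (Hc (k.+1, (J k).+1)).1.
Qed.

End diagonal.

(** * Local bounds for convex functions *)

Section matrix_norm.
Variables (R : realType) (n : nat).
Implicit Types (x : 'cV[R]_n) (e : R).

Lemma ler_coord_norm x k : `|x k 0| <= `|x|.
Proof.
rewrite [leRHS]mx_normrE.
exact: (le_bigmax _ (fun ij : 'I_n * 'I_1 => `|x ij.1 ij.2|) (k, 0)).
Qed.

Lemma norm_le_coord x e : 0 <= e -> (forall k, `|x k 0| <= e) -> `|x| <= e.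
Proof.
by move=> e0 xe; rewrite [leLHS]mx_normrE; apply/bigmax_le => // -[i j] _; rewrite ord1.
Qed.

End matrix_norm.

Section convex_functions.
Variables (R : realType) (n : nat).
Implicit Types (g : 'cV[R]_n -> \bar R) (x y z : 'cV[R]_n) (M a b t : R).

Lemma econvex_le g x y t a b : econvex g -> 0 <= t <= 1 ->
  (g x <= a%:E)%E -> (g y <= b%:E)%E ->
  (g (t *: x + (1 - t) *: y)%R <= (t * a + (1 - t) * b)%:E)%E.
Proof.
move=> cg /andP[t0 t1] ga gb.
have [->|tn0] := eqVneq t 0.
  by rewrite scale0r add0r subr0 scale1r mul0r mul1r add0r.
have [->|tn1] := eqVneq t 1.
  by rewrite subrr scale0r addr0 scale1r mul0r mul1r addr0.
have t01 : 0 < t < 1 by rewrite !lt_neqAle eq_sym tn0 tn1 t0 t1.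
apply: le_trans (cg x y t t01) _.
rewrite [leRHS]EFinD !EFinM; apply: leeD; apply: lee_wpmul2l => //; rewrite lee_fin//.
by rewrite subr_ge0.
Qed.

(** A convex sublevel set that meets each of the [2 ^ n] closed orthants with
    apex [y] contains [y]: moving along one coordinate at a time, two points in
    opposite half-spaces are joined by a segment crossing the hyperplane through
    [y], so that the coordinates of [y] can be attained one after the other. *)
Lemma econvex_orthants g y M : econvex g ->
  (forall s : 'I_n -> bool, exists2 w, (g w <= M%:E)%E &
     forall k, if s k then y k 0 <= w k 0 else w k 0 <= y k 0) ->
  (g y <= M%:E)%E.
Proof.
move=> cg H.
suff /(_ n (leqnn n) xpredT)[w gw wy] : forall m, (m <= n)%N ->
    forall s : 'I_n -> bool, exists2 w, (g w <= M%:E)%E &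
    forall k : 'I_n, if (k < m)%N then w k 0 = y k 0
      else if s k then y k 0 <= w k 0 else w k 0 <= y k 0.
  suff <- : w = y by [].
  by apply/matrixP => i j; rewrite ord1; have := wy i; rewrite ltn_ord.
elim=> [_ s|m IH mn s]; first by have [w gw ws] := H s; exists w.
pose o := Ordinal mn.
have [w1 gw1 w1s] := IH (ltnW mn) (fun k => (k == o) || s k).
have [w0 gw0 w0s] := IH (ltnW mn) (fun k => (k != o) && s k).
have := w1s o; rewrite ltnn eqxx /= => w1o.
have := w0s o; rewrite ltnn eqxx /= => w0o.
have [t t01 ty] : exists2 t : R, 0 <= t <= 1 & t * w1 o 0 + (1 - t) * w0 o 0 = y o 0.
  have [w10|w10] := eqVneq (w1 o 0) (w0 o 0).
    exists 1; first by rewrite ler01 lexx.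
    by apply/eqP; rewrite mul1r subrr mul0r addr0 eq_le w1o w10 w0o.
  have d0 : 0 < w1 o 0 - w0 o 0.
    by rewrite subr_gt0 lt_neqAle eq_sym w10 (le_trans w0o w1o).
  exists ((y o 0 - w0 o 0) / (w1 o 0 - w0 o 0)).
    by rewrite divr_ge0 ?(ltW d0) ?subr_ge0//= ler_pdivrMr// mul1r lerD2r.
  by field; rewrite gt_eqF.
have /andP[t0 t1] := t01.
exists (t *: w1 + (1 - t) *: w0).
  have -> : M = t * M + (1 - t) * M by ring.
  exact: econvex_le.
move=> k; rewrite !mxE ltnS leq_eqVlt; have [km|km] /= := eqVneq (k : nat) m.
  by have -> : k = o by exact/val_inj.
have ko : k != o by apply: contraNneq km => ->.
have := w1s k; have := w0s k; rewrite ko (negbTE ko) /=.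
case: ifP => _; first by move=> -> ->; ring.
by case: (s k) => h0 h1; nra.
Qed.

(** A convex function bounded above by [M] on a ball is bounded below by a cone:
    otherwise it would exceed [M] at the opposite side of the center. *)
Lemma econvex_cone_ge g x M (rho v : R) : econvex g -> 0 < rho ->
  (forall y, `|y - x| < rho -> (g y <= M%:E)%E) -> g x = v%:E ->
  forall y, ((v - 2 * (M - v) / rho * `|y - x|)%:E <= g y)%E.
Proof.
move=> cg rho0 gM gx y.
have [->|yx] := eqVneq y x.
  by rewrite subrr normr0 mulr0 subr0 gx.
have d0 : 0 < `|y - x| by rewrite normr_gt0 subr_eq0.
apply: ereal_le_gt => b /ltW gb; rewrite lee_fin.
set d := `|y - x| in d0 *.
pose z := x - (rho / 2 / d) *: (y - x).
have zM : (g z <= M%:E)%E.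
  apply: gM; rewrite /z addrAC subrr add0r normrN normrZ gtr0_norm ?divr_gt0//.
  by rewrite -/d divfK ?gt_eqF//; lra.
pose t := (rho / 2) / (d + rho / 2).
have dr : 0 < d + rho / 2 by apply: addr_gt0 => //; rewrite divr_gt0.
have t0 : 0 < t by rewrite divr_gt0// divr_gt0.
have t1 : t <= 1 by rewrite ler_pdivrMr// mul1r; lra.
have xE : x = t *: y + (1 - t) *: z.
  apply/matrixP => i j; rewrite !mxE /t; field.
  by rewrite gt_eqF// (_ : d * 2 + rho = (d + rho / 2) * 2) ?gt_eqF//; [rewrite mulr_gt0|field].
have : (g x <= (t * b + (1 - t) * M)%:E)%E.
  by rewrite [in X in (X <= _)%E]xE; apply: econvex_le => //; rewrite ltW.
rewrite gx lee_fin /t => vb.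
have {}vb : v * (d + rho / 2) <= rho / 2 * b + d * M.
  have := ler_wpM2r (ltW dr) vb; congr (_ <= _); field.
  by rewrite (_ : d * 2 + rho = (d + rho / 2) * 2) ?gt_eqF//; [rewrite mulr_gt0|field].
have : v * (d + rho / 2) - d * M <= rho / 2 * b by lra.
rewrite -ler_pdivrMl ?divr_gt0// => H; apply: le_trans _ H.
by rewrite le_eqVlt; apply/orP; left; apply/eqP; field; rewrite gt_eqF.
Qed.

(** The companion upper bound, by interpolation towards the boundary of the ball. *)
Lemma econvex_cone_le g x M (rho v : R) : econvex g -> 0 < rho ->
  (forall y, `|y - x| < rho -> (g y <= M%:E)%E) -> (g x <= v%:E)%E ->
  forall y, `|y - x| <= rho / 2 ->
    (g y <= (v + 2 * (M - v) / rho * `|y - x|)%:E)%E.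
Proof.
move=> cg rho0 gM gx y yx.
have [->|yx0] := eqVneq y x.
  by rewrite subrr normr0 mulr0 addr0.
have d0 : 0 < `|y - x| by rewrite normr_gt0 subr_eq0.
set d := `|y - x| in d0 yx *.
pose z := x + (rho / 2 / d) *: (y - x).
have zM : (g z <= M%:E)%E.
  apply: gM; rewrite /z addrAC subrr add0r normrZ gtr0_norm ?divr_gt0//.
  by rewrite -/d divfK ?gt_eqF//; lra.
pose t := d / (rho / 2).
have yE : y = t *: z + (1 - t) *: x.
  apply/matrixP => i j; rewrite !mxE /t; field.
  by rewrite !gt_eqF.
have -> : v + 2 * (M - v) / rho * d = t * M + (1 - t) * v.
  by rewrite /t; field; rewrite gt_eqF.
rewrite [in X in (X <= _)%E]yE; apply: econvex_le => //.
by rewrite divr_ge0 ?(ltW d0)//= ?ler_pdivrMr ?mul1r// ?divr_ge0 ?divr_gt0// ltW.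
Qed.

End convex_functions.

(** * Epi-convergence of convex functions *)

Section epi_convergence.
Variables (R : realType) (n : nat).
Implicit Types (u f : 'cV[R]_n -> \bar R) (us : nat -> 'cV[R]_n -> \bar R)
  (x y : 'cV[R]_n) (xs : nat -> 'cV[R]_n).

(** The second half of epi-convergence, which is what upper bounds rely on. *)
Definition has_recovery us u := forall x,
  exists2 xs : nat -> 'cV[R]_n, xs @ \oo --> x & (fun j => us j (xs j)) @ \oo --> u x.

Lemma epi_has_recovery us u : epi_cvg us u -> has_recovery us u.
Proof. by move=> uu x; have [] := uu x. Qed.

Lemma pointwise_has_recovery us u :
  (forall x, (fun j => us j x) @ \oo --> u x) -> has_recovery us u.
Proof. by move=> uu x; exists (fun=> x); [exact: cvg_cst|exact: uu]. Qed.

Lemma epi_cvg_gt us u x xs (r : R) : epi_cvg us u -> xs @ \oo --> x ->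
  (r%:E < u x)%E -> \forall j \near \oo, (r%:E < us j (xs j))%E.
Proof.
by move=> uu xx rx; have [/(_ _ xx) + _] := uu x; move=> /(lt_le_trans rx)/einf_gt.
Qed.

Lemma epi_cvgI us u :
  (forall x xs (r : R), xs @ \oo --> x -> (r%:E < u x)%E ->
     \forall j \near \oo, (r%:E < us j (xs j))%E) ->
  has_recovery us u -> epi_cvg us u.
Proof. by move=> lo hi x; split=> // xs xx; apply: le_einf => r; exact: lo. Qed.

(** The corners of a small cube around [x] carry recovery sequences, hence the
    [us j] are eventually bounded at points close to these corners, and the
    orthant criterion extends the bound to a smaller cube. *)
Lemma recovery_locally_bounded us u x : (forall j, econvex (us j)) ->
  has_recovery us u -> (\forall y \near x, u y \is a fin_num) ->
  exists M rho : R, 0 < rho /\ \forall j \near \oo,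
    forall y, `|y - x| < rho -> (us j y <= M%:E)%E.
Proof.
move=> cu rec /nbhs_ballP[e /= e0 ufin].
pose v (s : {ffun 'I_n -> bool}) : 'cV[R]_n :=
  x + \col_k (if s k then e / 2 else - (e / 2)).
have vx s : `|v s - x| <= e / 2.
  rewrite /v addrAC subrr add0r; apply: norm_le_coord; first lra.
  by move=> k; rewrite mxE; case: ifP => _; rewrite ?normrN gtr0_norm//; lra.
have vfin s : u (v s) \is a fin_num.
  by apply: ufin; rewrite -ball_normE /ball_/= distrC (le_lt_trans (vx s))//; lra.
have /choice[w Hw] : forall s, exists xs : nat -> 'cV[R]_n,
  xs @ \oo --> v s /\ (fun j => us j (xs j)) @ \oo --> u (v s).
  by move=> s; have [xs] := rec (v s); exists xs.
pose M := \sum_s `|fine (u (v s))| + 1.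
have uM s : (u (v s) < M%:E)%E.
  rewrite -(fineK (vfin s)) lte_fin /M (bigD1 s)//= -addrA ltr_pwDr//.
    by rewrite ltr_wpDl// sumr_ge0.
  exact: ler_norm.
exists M, (e / 4); split; first by rewrite divr_gt0.
have Hj : \forall j \near \oo, forall s, (us j (w s j) < M%:E)%E /\ `|v s - w s j| < e / 4.
  apply: filter_forall => s; have [ws uws] := Hw s.
  have e40 : 0 < e / 4 by rewrite divr_gt0.
  by have := ecvg_lt uws (uM s); move/cvgrPdist_lt : ws => /(_ _ e40); exact: filterS2.
apply: filterS Hj => j Hj y yx; apply: econvex_orthants => // s.
have [uw vw] := Hj (finfun s); exists (w (finfun s) j); first exact: ltW.
move=> k.
have := le_lt_trans (ler_coord_norm _ k) yx.
have := le_lt_trans (ler_coord_norm _ k) vw.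
rewrite /v !mxE ffunE !ltr_norml; case: (s k) => /andP[h1 h2] /andP[h3 h4]; lra.
Qed.

(** Recovery sequences at [x] converge to [x]; joining them to the far side of
    the ball on which the [us j] are bounded gives the upper bound at [x] itself. *)
Lemma recovery_lt us u x (r : R) : (forall j, econvex (us j)) ->
  has_recovery us u -> (\forall y \near x, u y \is a fin_num) ->
  (u x < r%:E)%E -> \forall j \near \oo, (us j x < r%:E)%E.
Proof.
move=> cu rec ufin uxr.
have [M [rho [rho0 uM]]] := recovery_locally_bounded cu rec ufin.
have [xs xx ux] := rec x.
have [v [uxv vr]] := ereal_dense uxr.
rewrite lte_fin in vr.
pose eps := Num.min (1 / 2) ((r - v) / (2 * (`|M - v| + 1))).
have D0 : 0 < 2 * (`|M - v| + 1) by rewrite mulr_gt0// ltr_wpDl.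
have eps0 : 0 < eps by rewrite lt_min !divr_gt0// subr_gt0.
have eps1 : eps <= 1 / 2 by rewrite ge_min lexx.
have epsr : (1 - eps) * v + eps * M < r.
  have : eps * (2 * (`|M - v| + 1)) <= r - v.
    by rewrite -ler_pdivlMr// ge_min lexx orbT.
  have := ler_norm (M - v); have := normr_ge0 (M - v).
  set A := `|M - v| => A0 AM; nra.
pose c := (1 - eps) / eps.
have c0 : 0 < c by rewrite divr_gt0//; lra.
have rc0 : 0 < rho / c by rewrite divr_gt0.
have := ecvg_lt ux uxv; move/cvgrPdist_lt : xx => /(_ _ rc0).
move: uM; apply: filterS3 => j uM xj uj.
pose y := x + c *: (x - xs j).
have uy : (us j y <= M%:E)%E.
  apply: uM; rewrite /y addrAC subrr add0r normrZ gtr0_norm//.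
  by rewrite mulrC -ltr_pdivlMr.
have -> : x = eps *: y + (1 - eps) *: xs j.
  by apply/matrixP => i k; rewrite !mxE /c; field; rewrite gt_eqF.
apply: le_lt_trans (econvex_le (cu j) _ uy (ltW uj)) _.
  by rewrite ltW//=; lra.
by rewrite lte_fin; lra.
Qed.

(** At an interior point of the domain of the limit, the convergence is locally
    uniform; the following is its sequential form. *)
Lemma recovery_continuous_cvg us u x xs : (forall j, econvex (us j)) ->
  has_recovery us u -> (\forall y \near x, u y \is a fin_num) ->
  (fun j => us j x) @ \oo --> u x -> xs @ \oo --> x ->
  (fun j => us j (xs j)) @ \oo --> u x.
Proof.
move=> cu rec ufin ux xx.
have [M [rho [rho0 uM]]] := recovery_locally_bounded cu rec ufin.
have /fineK uxE := nbhs_singleton ufin; set v := fine (u x) in uxE.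
pose K := 2 * (`|M| + `|v| + 1) / rho.
have K0 : 0 < K by rewrite divr_gt0// mulr_gt0// ltr_wpDl// addr_ge0.
(* Both cone estimates have slope at most [K] as soon as [us j x] is within [1]
   of its limit. *)
have near2 (e : R) : 0 < e -> \forall j \near \oo, ((v - e)%:E < us j (xs j))%E /\
    (us j (xs j) < (v + e)%:E)%E.
  move=> e0.
  pose d := Num.min (e / 2) 1.
  have d0 : 0 < d by rewrite lt_min ltr01 divr_gt0.
  have d1 : d <= 1 by rewrite ge_min lexx orbT.
  have de : d <= e / 2 by rewrite ge_min lexx.
  have lo : ((v - d)%:E < u x)%E by rewrite -uxE lte_fin; lra.
  have hi : (u x < (v + d)%:E)%E by rewrite -uxE lte_fin; lra.
  have q0 : 0 < Num.min (rho / 2) (e / 2 / K) by rewrite lt_min !divr_gt0.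
  near=> j.
  have uMj : forall y, `|y - x| < rho -> (us j y <= M%:E)%E by near: j.
  have loj : ((v - d)%:E < us j x)%E by near: j; exact: (ecvg_gt ux lo).
  have hij : (us j x < (v + d)%:E)%E by near: j; exact: (ecvg_lt ux hi).
  have : `|x - xs j| < Num.min (rho / 2) (e / 2 / K).
    by near: j; move/cvgrPdist_lt : xx; exact.
  rewrite distrC lt_min => /andP[xr xK].
  have ujE : us j x = (fine (us j x))%:E by move: loj hij; case: (us j x).
  set w := fine (us j x) in ujE.
  rewrite ujE !lte_fin in loj hij.
  have xK' : K * `|xs j - x| < e / 2 by rewrite mulrC -ltr_pdivlMr.
  have slope : 2 * (M - w) / rho <= K.
    rewrite ler_pM2r ?invr_gt0// ler_pM2l//.
    have := ler_norm M; have := ler_norm (- v); rewrite normrN => h1 h2; lra.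
  have := ler_wpM2r (normr_ge0 (xs j - x)) slope => slope'.
  split.
    apply: lt_le_trans (econvex_cone_ge (cu j) rho0 uMj ujE _).
    by rewrite lte_fin; lra.
  have wv : (us j x <= w%:E)%E by rewrite ujE.
  apply: le_lt_trans (econvex_cone_le (cu j) rho0 uMj wv (ltW xr)) _.
  by rewrite lte_fin; lra.
apply: ecvg_sandwich => r; rewrite -uxE lte_fin => rv.
  have /near2 : 0 < v - r by rewrite subr_gt0.
  by apply: filterS => j [+ _]; rewrite opprB addrC subrK.
have /near2 : 0 < r - v by rewrite subr_gt0.
by apply: filterS => j [_]; rewrite addrC subrK.
Unshelve. all: by end_near. Qed.

Lemma epi_pointwise_cvg us u x : (forall j, econvex (us j)) -> epi_cvg us u ->
  (\forall y \near x, u y \is a fin_num) -> (fun j => us j x) @ \oo --> u x.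
Proof.
move=> cu uu ufin; apply: ecvg_sandwich => r rx.
  by apply: epi_cvg_gt uu _ rx; exact: cvg_cst.
by apply: recovery_lt cu _ ufin rx; exact: epi_has_recovery.
Qed.

Lemma pointwise_epi_cvg us u : (forall j, econvex (us j)) ->
  (forall x, u x \is a fin_num) -> (forall x, (fun j => us j x) @ \oo --> u x) ->
  epi_cvg us u.
Proof.
move=> cu ufin uu; have rec := pointwise_has_recovery uu.
apply: epi_cvgI => // x xs r xx.
move=> rx; apply: ecvg_gt rx.
by apply: recovery_continuous_cvg (uu x) xx => //; apply: filterE => y; exact: ufin.
Qed.

(** Epi-limits may be computed on increasing sequences even where the limit is
    infinite, because each member of the sequence is a lower bound for the tail. *)
Lemma increasing_epi_cvg us u : (forall j, lower_semicontinuous (us j)) ->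
  (forall x j k, (j <= k)%N -> (us j x <= us k x)%E) ->
  (forall x, (fun j => us j x) @ \oo --> u x) -> epi_cvg us u.
Proof.
move=> lu mu uu; apply: epi_cvgI; last exact: pointwise_has_recovery.
move=> x xs r xx rx.
have [N _ /(_ N (leqnn _)) /= rN] := ecvg_gt (uu x) rx.
have [V Vx uV] := lu N x r rN.
near=> j.
apply: (@lt_le_trans _ _ (us N (xs j))).
  by apply: uV; near: j; exact: xx.
by apply: mu; near: j; exists N.
Unshelve. all: by end_near. Qed.

Lemma cst_epi_cvg u : lower_semicontinuous u -> epi_cvg (fun=> u) u.
Proof.
by move=> lu; apply: increasing_epi_cvg => // x; exact: cvg_cst.
Qed.

End epi_convergence.

(** * The epi-topology and its convergent sequences *)

Section epi_topology.
Variables (R : realType) (n : nat).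
Implicit Types (f g h : Conv0 R n) (fs gs : nat -> Conv0 R n).

Lemma conv0_epi_cst f : epi_cvg (fun=> f) f.
Proof. by apply: cst_epi_cvg; exact: conv_lsc. Qed.

(** If [g x < r < f x], then the [fs] exceed [r] on a fixed ball around [x], by
    the lower half of epi-convergence, while recovery sequences of the [gs] enter
    this ball with values below [r].  This uniform form of the uniqueness of
    epi-limits is what the comparison with the epi-topology needs. *)
Lemma epi_cvg_disjoint_lt fs gs f g x : epi_cvg fs f -> epi_cvg gs g ->
  (g x < f x)%E -> exists N, forall i j, (N <= i)%N -> (N <= j)%N -> fs i <> gs j.
Proof.
move=> ff gg /ereal_dense[r [gr rf]].
have [delta [delta0 fsr]] : exists delta : R, 0 < delta /\ \forall i \near \oo,
    forall y, `|x - y| < delta -> (r%:E < fs i y)%E.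
  apply: contrapT => H.
  have H' k N : exists2 i, (N <= i)%N &
      exists2 y, `|x - y| < k.+1%:R^-1 & (fs i y <= r%:E)%E.
    apply: contrapT => K; apply: H; exists k.+1%:R^-1; split; first by rewrite invr_gt0.
    exists N => // i /= Ni y xy; rewrite ltNge; apply/negP => fyr.
    by apply: K; exists i => //; exists y.
  have [J Jmono HJ] := frequently_diagonal H'.
  have /choice[y Hy] : forall k, exists y, `|x - y| < k.+1%:R^-1 /\ (fs (J k) y <= r%:E)%E.
    by move=> k; have [y] := HJ k; exists y.
  have Jinj : injective J.
    move=> k l; have [kl|lk|//] := ltngtP k l.
      by move=> E; have := Jmono _ _ kl; rewrite E ltnn.
    by move=> E; have := Jmono _ _ lk; rewrite E ltnn.
  have leJ : {homo J : k l / (k <= l)%N}.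
    by move=> k l; rewrite leq_eqVlt => /predU1P[->//|/Jmono/ltnW].
  have JgeI k : (k <= J k)%N.
    by elim: k => // k IH; apply: leq_ltn_trans IH _; exact: Jmono.
  pose xs i := if pselect (exists k, J k = i) is left P then y (projT1 (cid P)) else x.
  have xsJ k : xs (J k) = y k.
    rewrite /xs; case: pselect => [P|]; last by case; exists k.
    by case: (cid P) => l /= /Jinj ->.
  have xsx : xs @ \oo --> x.
    apply/cvgrPdist_lt => e e0.
    have [K _ HK] := near_infty_natSinv_lt (PosNum e0).
    exists (J K) => // i /= JKi; rewrite /xs; case: pselect => [P|_]; last first.
      by rewrite subrr normr0.
    case: (cid P) => k /= Jk; have [xy _] := Hy k; apply: lt_trans xy _.
    apply: HK => /=; rewrite leqNgt; apply/negP => kK.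
    by have := Jmono _ _ kK; rewrite Jk ltnNge JKi.
  have [N _ HN] := epi_cvg_gt ff xsx rf.
  have /= := HN (J N) (JgeI N).
  by rewrite xsJ ltNge (Hy N).2.
have [ys yx gy] := epi_has_recovery gg x.
have [N1 _ HN1] := fsr.
have [N2 _ HN2] := ecvg_lt gy gr.
have [N3 _ HN3] : \forall j \near \oo, `|x - ys j| < delta.
  by move/cvgrPdist_lt : yx; exact.
exists (maxn N1 (maxn N2 N3)) => i j; rewrite !geq_max => /and3P[i1 _ _] /and3P[_ j2 j3] fg.
have := HN1 i i1 (ys j) (HN3 j j3).
by rewrite fg ltNge (ltW (HN2 j j2)).
Qed.

Lemma epi_cvg_disjoint fs gs f g : epi_cvg fs f -> epi_cvg gs g -> f <> g ->
  exists N, forall i j, (N <= i)%N -> (N <= j)%N -> fs i <> gs j.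
Proof.
move=> ff gg fg.
have [x xfg] : exists x, f x != g x.
  apply: contrapT => H; apply: fg; apply: conv0_ext; apply/funext => x.
  by apply/eqP; apply: contrapT => /negP K; apply: H; exists x.
have [lt|lt|eq] := ltgtP (f x) (g x); last by rewrite eq eqxx in xfg.
  have [N HN] := epi_cvg_disjoint_lt gg ff lt; exists N => i j Ni Nj.
  by move=> E; exact: (HN j i Nj Ni).
exact: epi_cvg_disjoint_lt ff gg lt.
Qed.

(** A sequence which epi-converges to [g] has no other limit in the epi-topology:
    by disjointness, the limit [g] together with a tail of the sequence is
    sequentially closed. *)
Lemma epi_cvg_unique gs g h : epi_cvg gs g -> gs @ \oo --> h -> g = h.
Proof.
move=> gg gh; apply: contrapT => neq.
have [N HN] := epi_cvg_disjoint gg (conv0_epi_cst h) neq.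
pose U : set (Conv0 R n) := [set u | u <> g /\ forall j, (N <= j)%N -> u <> gs j].
have oU : epi_open U.
  move=> us u uu [ug ugs].
  have [N1 HN1] := epi_cvg_disjoint uu (conv0_epi_cst g) ug.
  have [N2 HN2] := epi_cvg_disjoint uu gg ug.
  have early : \forall i \near \oo, forall j : 'I_N2, (N <= j)%N -> us i <> gs j.
    apply: filter_forall => j; have [Nj|jN] := leqP N j; last by apply: nearW.
    have [N3 HN3] := epi_cvg_disjoint uu (conv0_epi_cst (gs j)) (ugs j Nj).
    by exists N3 => // i /= N3i _; exact: (HN3 i N3).
  have late1 : \forall i \near \oo, (N1 <= i)%N by exists N1.
  have late2 : \forall i \near \oo, (N2 <= i)%N by exists N2.
  apply: filterS3 early late1 late2 => i Hi i1 i2; split; first exact: (HN1 i N1).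
  move=> j Nj; have [N2j|jN2] := leqP N2 j; first exact: (HN2 i j).
  exact: (Hi (Ordinal jN2)).
have hU : U h by split=> [hg|j Nj hj]; [exact: neq|exact: (HN j N)].
have [M _ HM] : \forall j \near \oo, U (gs j) by apply: gh; exists U; split.
have [_ /(_ (maxn M N))] := HM (maxn M N) (leq_maxl _ _).
by apply; [exact: leq_maxr|].
Qed.

Lemma epi_cvg_cvg fs f : epi_cvg fs f -> fs @ \oo --> f.
Proof. by move=> ff A [B [oB Bf BA]]; have := oB _ _ ff Bf; apply: filterS => j /BA. Qed.

Lemma epi_continuous (Psi : Conv0 R n -> Conv0 R n) :
  (forall fs f, epi_cvg fs f -> epi_cvg (fun j => Psi (fs j)) (Psi f)) -> continuous Psi.
Proof.
move=> H f A [B [oB Bf BA]]; exists (Psi @^-1` B); split=> //; last by move=> g /BA.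
by move=> gs g /H/oB; exact.
Qed.

(** The conditions [r < g x], and [g x < r] together with finiteness near [x], are
    both open in the epi-topology; they bound [Psi (fs j) x] from both sides. *)
Lemma continuous_eval (Psi : Conv0 R n -> Conv0 R n) fs f x : continuous Psi ->
  epi_cvg fs f -> (\forall y \near x, Psi f y \is a fin_num) ->
  (fun j => Psi (fs j) x) @ \oo --> Psi f x.
Proof.
move=> cPsi ff fin.
have lim (U : set (Conv0 R n)) : epi_open U -> U (Psi f) -> \forall j \near \oo, U (Psi (fs j)).
  move=> oU Uf; have nU : nbhs (Psi f) U by exists U; split.
  exact: (epi_cvg_cvg ff (cPsi f U nU)).
apply: ecvg_sandwich => r rx.
  apply: (lim [set g | (r%:E < g x)%E]) => // gs g gg /= rg.
  by apply: epi_cvg_gt gg _ rg; exact: cvg_cst.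
have : \forall j \near \oo, [set g : Conv0 R n |
    (\forall y \near x, g y \is a fin_num) /\ (g x < r%:E)%E] (Psi (fs j)).
  apply: lim => // gs g gg /= [gfin gr].
  have cg j : econvex (gs j) by exact: conv_convex.
  have rec := epi_has_recovery gg.
  have [M [rho [rho0 gM]]] := recovery_locally_bounded cg rec gfin.
  have := recovery_lt cg rec gfin gr; apply: filterS2 gM => j gM gjr; split=> //.
  apply/nbhs_ballP; exists rho => //= y; rewrite -ball_normE /ball_/= distrC => /gM.
  by have := conv_gtNy (gs j) y; case: (gs j y).
by apply: filterS => j [].
Qed.

(** ** Bounds for functions that are finite near the origin *)

Lemma conv0_locally_bounded f : exists M rho : R, 0 < rho /\
  forall y, `|y| < rho -> (f y <= M%:E)%E.
Proof.
have cf (j : nat) : econvex f by exact: conv_convex.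
have [M [rho [rho0 [N _ /(_ N (leqnn _)) /= fM]]]] :=
  recovery_locally_bounded cf (epi_has_recovery (conv0_epi_cst f)) (conv0_fin f).
by exists M, rho; split=> // y yr; apply: fM; rewrite subr0.
Qed.

Lemma epi_cvg0 fs f : epi_cvg fs f -> (fun j => fs j 0) @ \oo --> f 0.
Proof.
move=> ff; apply: epi_pointwise_cvg ff (conv0_fin f) => j; exact: conv_convex.
Qed.

(** The upper bound on a ball around the origin is common to a tail of the
    sequence, and so is the slope of the supporting cone that it forces. *)
Lemma epi_cvg_cone fs f : epi_cvg fs f -> exists2 L : R, 0 <= L &
  \forall j \near \oo, forall y, (fs j 0%R - (L * `|y|)%:E <= fs j y)%E.
Proof.
move=> ff; have cf j : econvex (fs j) by exact: conv_convex.
have [M [rho [rho0 fM]]] :=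
  recovery_locally_bounded cf (epi_has_recovery ff) (conv0_fin f).
have f0 := fineK (conv0_fin0 f); set v := fine (f 0) in f0.
exists (2 * (`|M| + `|v| + 1) / rho).
  by rewrite divr_ge0 ?ltW// mulr_gt0// ltr_wpDl// addr_ge0.
have lo : ((v - 1)%:E < f 0%R)%E by rewrite -f0 lte_fin; lra.
have := ecvg_gt (epi_cvg0 ff) lo; apply: filterS2 fM => j fM.
have fj0 := fineK (conv0_fin0 (fs j)); set w := fine (fs j 0) in fj0.
rewrite -fj0 lte_fin => vw y.
have := econvex_cone_ge (cf j) rho0 fM (esym fj0) y; rewrite subr0.
apply: le_trans; rewrite -EFinB lee_fin lerD2l lerN2 ler_wpM2r//.
rewrite ler_pM2r ?invr_gt0// ler_pM2l//.
have := ler_norm M; have := ler_norm (- v); rewrite normrN => h1 h2; lra.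
Qed.

Lemma conv0_cone f : exists2 L : R, 0 <= L &
  forall y, (f 0%R - (L * `|y|)%:E <= f y)%E.
Proof.
have [L L0 [N _ /(_ N (leqnn _)) H]] := epi_cvg_cone (conv0_epi_cst f).
by exists L.
Qed.

(** A neighborhood of [lam *: y] consists of convex combinations of [y] and the
    points of a ball around the origin on which [f] is bounded. *)
Lemma conv0_fin_scale f y (lam : R) : (f y < +oo)%E -> 0 <= lam < 1 ->
  \forall z \near lam *: y, f z \is a fin_num.
Proof.
move=> fy /andP[l0 l1]; have [M [rho [rho0 fM]]] := conv0_locally_bounded f.
have [b fb] : exists b : R, (f y <= b%:E)%E.
  by have := conv_gtNy f y; case: (f y) fy => // b _ _; exists b.
have q0 : 0 < (1 - lam) * rho by rewrite mulr_gt0// subr_gt0.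
apply/nbhs_ballP; exists ((1 - lam) * rho) => //= z.
rewrite -ball_normE /ball_/= distrC => zl.
pose w := (1 - lam)^-1 *: (z - lam *: y).
have fw : (f w <= M%:E)%E.
  apply: fM; rewrite /w normrZ gtr0_norm ?invr_gt0 ?subr_gt0//.
  by rewrite ltr_pdivrMl// subr_gt0.
have zE : z = lam *: y + (1 - lam) *: w.
  by rewrite /w scalerA mulfV ?scale1r ?gt_eqF ?subr_gt0// addrC subrK.
have l01 : 0 <= lam <= 1 by rewrite l0 ltW.
have := econvex_le (@conv_convex _ _ f) l01 fb fw; rewrite -zE.
by have := conv_gtNy f z; case: (f z).
Qed.

End epi_topology.

(** * Finite convex functions *)

Section finite_convex.
Variables (R : realType) (n : nat).
Implicit Types (g : 'cV[R]_n -> \bar R) (f : Conv0 R n).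

Lemma finite_convex_lsc g : econvex g -> (forall x, g x \is a fin_num) ->
  lower_semicontinuous g.
Proof.
move=> cg fg x r rx.
have rec : has_recovery (fun=> g) g by apply: pointwise_has_recovery => y; exact: cvg_cst.
have fx : \forall y \near x, g y \is a fin_num by apply: filterE => y; exact: fg.
have [M [rho [rho0 [N _ /(_ N (leqnn _)) /= gM]]]] :=
  recovery_locally_bounded (fun=> cg) rec fx.
have gx := fineK (fg x); set v := fine (g x) in gx.
have := econvex_cone_ge cg rho0 gM (esym gx); set L := 2 * (M - v) / rho => cone.
rewrite -gx lte_fin in rx.
pose e := (v - r) / (`|L| + 1).
have L1 : 0 < `|L| + 1 by rewrite ltr_wpDl.
exists (ball x e); first by apply: nbhsx_ballx; rewrite divr_gt0// subr_gt0.
move=> y; rewrite -ball_normE /ball_/= distrC ltr_pdivlMr// => xy.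
apply: lt_le_trans (cone y); rewrite lte_fin.
by have := ler_norm L; have := normr_ge0 (y - x); nra.
Qed.

Lemma finite_gtNy g x : (forall x, g x \is a fin_num) -> (-oo < g x)%E.
Proof. by move=> /(_ x); case: (g x) => // r _; exact: ltNyr. Qed.

Lemma finite_proper g : (forall x, g x \is a fin_num) -> exists x, g x != +oo%E.
Proof. by move=> /(_ 0) g0; exists 0; case: (g 0) g0. Qed.

Lemma finite_near0 g : (forall x, g x \is a fin_num) ->
  \forall x \near (0 : 'cV[R]_n), g x \is a fin_num.
Proof. by move=> fg; apply: filterE => x; exact: fg. Qed.

Definition finite_conv0 g (cg : econvex g) (fg : forall x, g x \is a fin_num) : Conv0 R n :=
  @MkConv0 R n (@MkConv R n g (finite_convex_lsc cg fg) cg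
    (fun x => finite_gtNy x fg) (finite_proper fg)) (finite_near0 fg).

(** The Lipschitz regularisation of [f]: its infimal convolution with a
    multiple of the norm. *)
Definition lip_env f (K : R) (x : 'cV[R]_n) : \bar R :=
  ereal_inf [set f y + (K * `|x - y|)%:E | y in setT]%E.

Section envelope.
Variables (f : Conv0 R n) (L : R).
Hypotheses (L0 : 0 <= L) (cone : forall y, (f 0%R - (L * `|y|)%:E <= f y)%E).
Let v := fine (f 0).
Let f0 : f 0 = v%:E. Proof. by rewrite fineK// conv0_fin0. Qed.

Let term_ge (K : R) x y : L <= K ->
  ((v - L * `|x| + (K - L) * `|x - y|)%:E <= f y + (K * `|x - y|)%:E)%E.
Proof.
move=> LK; have := cone y; rewrite f0 -EFinB; move: (conv_gtNy f y).
case: (f y) => [b _|_ _|//]; last by rewrite addye// leey.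
rewrite -!EFinD !lee_fin => H.
have := ler_wpM2l L0 (lerB_dist y x); rewrite distrC; lra.
Qed.

Lemma lip_env_le K x : (lip_env f K x <= f x)%E.
Proof.
by apply: ereal_inf_lbound; exists x => //; rewrite subrr normr0 mulr0 adde0.
Qed.

Lemma lip_env_fin K x : L <= K -> lip_env f K x \is a fin_num.
Proof.
move=> LK; rewrite fin_numElt; apply/andP; split.
  apply: (@lt_le_trans _ _ (v - L * `|x|)%:E); first by rewrite ltNyr.
  apply: le_ereal_inf_tmp => _ [y _ <-]; apply: le_trans (term_ge x y LK).
  by rewrite lee_fin lerDl mulr_ge0// subr_ge0.
apply: (@le_lt_trans _ _ (v + K * `|x|)%:E); last by rewrite ltry.
by apply: ereal_inf_lbound; exists 0 => //; rewrite f0 subr0.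
Qed.

Lemma lip_env_convex K : L <= K -> econvex (lip_env f K).
Proof.
move=> LK x y t t01; have /andP[t0 t1] := t01.
have K0 : 0 <= K by apply: le_trans LK.
have ux := fineK (lip_env_fin x LK); set a := fine _ in ux.
have uy := fineK (lip_env_fin y LK); set b := fine _ in uy.
rewrite -ux -uy -!EFinM -EFinD; apply/lee_addgt0Pr => e e0.
have [_ [x' _ <-] xa] : exists2 z, [set f y + (K * `|x - y|)%:E | y in setT]%E z &
    (z < (a + e)%:E)%E.
  by apply: ereal_inf_lt; rewrite -/(lip_env f K x) -ux lte_fin; lra.
have [_ [y' _ <-] yb] : exists2 z, [set f z + (K * `|y - z|)%:E | z in setT]%E z &
    (z < (b + e)%:E)%E.
  by apply: ereal_inf_lt; rewrite -/(lip_env f K y) -uy lte_fin; lra.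
apply: (@le_trans _ _ (f (t *: x' + (1 - t) *: y')%R +
  (K * `|t *: x + (1 - t) *: y - (t *: x' + (1 - t) *: y')|)%:E)%E).
  by apply: ereal_inf_lbound; exists (t *: x' + (1 - t) *: y').
have fx : (f x' <= (a + e - K * `|x - x'|)%:E)%E.
  rewrite EFinB leeBrDr//; exact: ltW.
have fy : (f y' <= (b + e - K * `|y - y'|)%:E)%E.
  rewrite EFinB leeBrDr//; exact: ltW.
have t01' : 0 <= t <= 1 by rewrite !ltW.
have := econvex_le (@conv_convex _ _ f) t01' fx fy.
move/(leeD2r (K * `|t *: x + (1 - t) *: y - (t *: x' + (1 - t) *: y')|)%:E).
move=> /le_trans; apply; rewrite -!EFinD lee_fin.
have -> : t *: x + (1 - t) *: y - (t *: x' + (1 - t) *: y') =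
    t *: (x - x') + (1 - t) *: (y - y').
  by apply/matrixP => i j; rewrite !mxE; ring.
have := ler_normD (t *: (x - x')) ((1 - t) *: (y - y')).
rewrite !normrZ (gtr0_norm t0) gtr0_norm ?subr_gt0// => /(ler_wpM2l K0); lra.
Qed.

Lemma lip_env_cvg x : (fun j => lip_env f (L + j%:R) x) @ \oo --> f x.
Proof.
apply: ecvg_sandwich => r rx; last first.
  by apply: nearW => j; apply: le_lt_trans rx; exact: lip_env_le.
have [q [rq qx]] := ereal_dense rx.
have [V /nbhs_ballP[d /= d0 dV] fV] := conv_lsc qx.
have [j0 _ Hj0] := nbhs_infty_ger ((q - v + L * `|x|) / d).
exists j0 => // j j0j; apply: lt_le_trans rq _.
apply: le_ereal_inf_tmp => _ [y _ <-].
have Lj : L <= L + j%:R by rewrite lerDl.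
have [xy|xy] := ltP `|x - y| d.
  apply: (@le_trans _ _ (f y)).
    by apply/ltW/fV/dV; rewrite -ball_normE.
  by rewrite leeDl// lee_fin mulr_ge0// addr_ge0.
apply: le_trans (term_ge x y Lj); rewrite lee_fin.
have := Hj0 j j0j; rewrite /= ler_pdivrMr// => H.
have : j%:R * d <= j%:R * `|x - y| by apply: ler_wpM2l.
lra.
Qed.

End envelope.

(** The Lipschitz regularisations of [f] increase to [f], even where it is
    infinite, and increasing limits are epi-limits. *)
Lemma finite_dense f : exists2 fs : nat -> Conv0 R n,
  (forall j x, fs j x \is a fin_num) & epi_cvg fs f.
Proof.
have [L L0 cone] := conv0_cone f.
have Lj (j : nat) : L <= L + j%:R by rewrite lerDl.
pose fs j := finite_conv0 (lip_env_convex L0 cone (Lj j))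
  (fun x => lip_env_fin L0 cone x (Lj j)).
exists fs; first by move=> j x; exact: (lip_env_fin L0 cone x (Lj j)).
apply: increasing_epi_cvg => [j|x j k jk|x].
- exact: conv_lsc.
- apply: le_ereal_inf_tmp => _ [y _ <-].
  apply: (@le_trans _ _ (f y + ((L + j%:R) * `|x - y|)%:E)%E).
    by apply: ereal_inf_lbound; exists y.
  by apply: leeD2l; rewrite lee_fin ler_wpM2r// lerD2l ler_nat.
- exact: (lip_env_cvg L0 cone).
Qed.

End finite_convex.

(** * The measure *)

Section integral_shift.
Context d (T : measurableType d) (R : realType).
Variables (mu : {measure set T -> \bar R}) (D : set T) (mD : measurable D).
Local Open Scope ereal_scope.

(** An integrand bounded below by an integrable function may be integrated as
    a nonnegative one; infinite values on the positive side are allowed. *)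
Lemma integral_shift (g w : T -> \bar R) : measurable_fun D g ->
  measurable_fun D w -> (forall s, D s -> 0 <= w s) ->
  (forall s, D s -> w s \is a fin_num) -> \int[mu]_(s in D) w s < +oo ->
  (forall s, D s -> 0 <= g s + w s) ->
  \int[mu]_(s in D) g s = \int[mu]_(s in D) (g s + w s) - \int[mu]_(s in D) w s.
Proof.
move=> mg mw w0 wfin wI gw.
have mgp := measurable_funepos mg; have mgn := measurable_funeneg mg.
have mgw : measurable_fun D (fun s => g s + w s) by exact: emeasurable_funD.
have gnw s : D s -> g^\- s <= w s.
  move=> Ds; rewrite funenegE ge_max w0// andbT.
  by have := gw s Ds; rewrite -leeBlDr ?wfin// sub0e leeNl.
have w_ge0 : 0 <= \int[mu]_(s in D) w s by exact: integral_ge0.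
have gn_ge0 : 0 <= \int[mu]_(s in D) g^\- s by apply: integral_ge0.
have gnI : \int[mu]_(s in D) g^\- s < +oo.
  by apply: le_lt_trans wI; apply: ge0_le_integral.
have gnfin : \int[mu]_(s in D) g^\- s \is a fin_num by rewrite ge0_fin_numE.
have wfinI : \int[mu]_(s in D) w s \is a fin_num by rewrite ge0_fin_numE.
have H : \int[mu]_(s in D) (g s + w s) + \int[mu]_(s in D) g^\- s =
         \int[mu]_(s in D) g^\+ s + \int[mu]_(s in D) w s.
  rewrite -!ge0_integralD//; apply: eq_integral => s /[!inE] Ds.
  have := wfin s Ds; have := gw s Ds.
  rewrite funeposE funenegE; case: (w s) => [a| |] //; case: (g s) => [b| |] //=.
    move=> _ _; rewrite /Order.max !lte_fin.
    by case: ltP => ?; case: ltP => ?; rewrite -!EFinD; congr EFin; lra.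
  by move=> _ _; rewrite [maxe +oo _]max_l ?leey// max_r ?leNye// adde0.
rewrite integralE.
have -> : \int[mu]_(s in D) g^\+ s = \int[mu]_(s in D) (g s + w s) +
    \int[mu]_(s in D) g^\- s - \int[mu]_(s in D) w s by rewrite H addeK.
by rewrite addeAC addeK.
Qed.

Lemma integral_null (N : set T) (g : T -> \bar R) : measurable N ->
  measurable_fun D g -> mu N = 0 ->
  \int[mu]_(s in D) g s = \int[mu]_(s in D `\` N) g s.
Proof.
move=> mN mg N0; rewrite integralE [RHS]integralE; congr (_ - _).
  by apply: ge0_negligible_integral => //; exact: measurable_funepos.
by apply: ge0_negligible_integral => //; exact: measurable_funeneg.
Qed.

End integral_shift.

Lemma open_norm_gt (R : realType) (a : R) : open [set s : R | a < `|s|].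
Proof.
apply: (@open_comp _ _ (fun s : R => `|s|) [set t | a < t]); last exact: open_gt.
by move=> s _; exact: norm_continuous.
Qed.

Lemma open_norm_lt (R : realType) (a : R) : open [set s : R | `|s| < a].
Proof.
apply: (@open_comp _ _ (fun s : R => `|s|) [set t | t < a]); last exact: open_lt.
by move=> s _; exact: norm_continuous.
Qed.

Section support.
Variables (R : realType) (nu : {finite_measure set (measurableTypeR R) -> \bar R}).

Lemma null_segment (a b : R) : (forall s, s \in `[a, b] -> ~ msupport nu s) ->
  nu.-negligible `[a, b]%classic.
Proof.
move=> H.
have /choice[U HU] : forall s, exists U : set R, s \in `[a, b] -> open_nbhs s U /\ nu U = 0%E.
  move=> s; have [sab|] := boolP (s \in `[a, b]); last by exists set0.
  apply: contrapT => K; apply: (H s sab) => U sU.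
  rewrite lt_neqAle measure_ge0 andbT; apply/eqP => /esym U0.
  by apply: K; exists U.
have := @segment_compact R a b; rewrite compact_cover.
move=> /(_ _ [set s | s \in `[a, b]] U)[].
- by move=> s /= /HU[[]].
- by move=> s /= sab; exists s => //=; have [[]] := HU s sab.
move=> D' DD'; rewrite /cover bigcup_fset => sub.
apply: (@negligibleS _ (measurableTypeR R) _ nu _ _ sub); rewrite big_seq.
elim/big_rec : _ => [|s A sD IH]; first exact: negligible_set0.
apply: negligibleU => //.
have [[oU _] U0] := HU s (set_mem (DD' s sD)).
by exists (U s); split=> //; exact: open_measurable.
Qed.

Lemma compact_support_null : compact (msupport nu) ->
  exists2 A : R, 0 < A & nu [set s : R | A < `|s|] = 0%E.
Proof.
move=> /compact_bounded[M [_ HM]].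
pose A := `|M| + 1.
have MA : M < A by rewrite /A; have := ler_norm M; lra.
have A0 : 0 < A by rewrite /A ltr_wpDl.
have supA s : msupport nu s -> `|s| <= A by exact: HM.
exists A => //.
have mA : measurable ([set s : R | A < `|s|] : set (measurableTypeR R)).
  by apply: open_measurable; exact: open_norm_gt.
apply: measure_negligible => //.
pose F k : set R := (`[A + k.+1%:R^-1, A + k%:R] `|` `[- (A + k%:R), - (A + k.+1%:R^-1)])%classic.
apply: (@negligibleS _ (measurableTypeR R) _ nu (\bigcup_k F k)); last first.
  apply: negligible_bigcup => k; have k0 : 0 < k.+1%:R^-1 :> R by rewrite invr_gt0.
  apply: negligibleU; apply: null_segment => s; rewrite in_itv /= => /andP[s1 s2] /supA.
    by have := ler_norm s => h1 h2; set q := k.+1%:R^-1 in k0 s1; lra.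
  have := ler_norm (- s); rewrite normrN => h1 h2.
  by set q := k.+1%:R^-1 in k0 s2; lra.
move=> s /= As.
have d0 : 0 < `|s| - A by rewrite subr_gt0.
have [k1 _ Hk1] := near_infty_natSinv_lt (PosNum d0).
have [k2 _ Hk2] := nbhs_infty_ger (`|s| - A).
set k := maxn k1 k2; exists k => //.
have h1 : k.+1%:R^-1 < `|s| - A := Hk1 k (leq_maxl _ _).
have h2 : `|s| - A <= k%:R := Hk2 k (leq_maxr _ _).
have [s0|s0] := leP 0 s; [left|right]; rewrite /= in_itv/=.
  rewrite ger0_norm// in h1 h2.
  by set q := k.+1%:R^-1 in h1 *; apply/andP; split; lra.
rewrite ltr0_norm// in h1 h2.
by set q := k.+1%:R^-1 in h1 *; apply/andP; split; lra.
Qed.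

Lemma msupport_closed : closed (msupport nu).
Proof.
rewrite -[msupport nu]setCK; apply: open_closedC; rewrite openE => s /= H.
have [U [sU U0]] : exists U : set R, open_nbhs s U /\ nu U = 0%E.
  apply: contrapT => K; apply: H => U sU.
  rewrite lt_neqAle measure_ge0 andbT; apply/eqP => /esym U0.
  by apply: K; exists U.
have [oU _] := sU; rewrite /interior nbhsE; exists U => // t Ut /(_ U (conj oU Ut)).
by rewrite U0 ltxx.
Qed.

Lemma measurable_Rtimes : measurable (@Rtimes R).
Proof.
rewrite (_ : @Rtimes R = ~` [set 0]); first exact: measurableC.
by apply/seteqP; split => s /= /eqP.
Qed.

Lemma measurable_inv_norm : measurable_fun (@Rtimes R) (fun s : R => `|s|^-1).
Proof.
have oR : open (@Rtimes R : set R).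
  rewrite (_ : @Rtimes R = [set s : R | s != 0])//; exact: open_neq.
apply: (@open_continuous_measurable_fun R _ _ oR) => s; rewrite inE => s0.
apply: (@continuous_comp _ _ _ (fun s : R => `|s|) GRing.inv).
  exact: norm_continuous.
by apply: inv_continuous; rewrite normr_eq0.
Qed.

End support.

(** * The integral formula *)

Definition diffq (R : realType) (n : nat) (f : Conv0 R n) (x : 'cV[R]_n)
    (s : measurableTypeR R) : \bar R :=
  ((f ((s : R) *: x)%R - f 0%R) * (`|s : R| ^- 2)%:E)%E.

Section integrand.
Variables (R : realType) (n : nat).
Implicit Types (f g : Conv0 R n) (x y : 'cV[R]_n) (s t L K : R).

Lemma sqr_norm_gt0 s : s != 0 -> 0 < `|s| ^- 2.
Proof. by move=> s0; rewrite invr_gt0 exprn_gt0// normr_gt0. Qed.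

Lemma diffqP f x s : s != 0 ->
  (f (s *: x) = +oo%E /\ diffq f x s = +oo%E) \/
  (exists2 b, f (s *: x) = b%:E & diffq f x s = ((b - fine (f 0)) * `|s| ^- 2)%:E).
Proof.
move=> s0; rewrite /diffq -[in f 0%R](fineK (conv0_fin0 f)).
have := conv_gtNy f (s *: x); case: (f (s *: x)) => [b| |] // _; last first.
  by left; split=> //; rewrite addye// gt0_mulye// lte_fin sqr_norm_gt0.
by right; exists b => //; rewrite -EFinB -EFinM.
Qed.

Lemma diffq0 f s : diffq f 0 s = 0%E.
Proof. by rewrite /diffq scaler0 subee ?mul0e// conv0_fin0. Qed.

Lemma divr_sqr_norm a s : s != 0 -> a * `|s| * `|s| ^- 2 = a * `|s|^-1.
Proof. by move=> s0; field; rewrite normr_eq0. Qed.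

Lemma diffq_ge f x s L : s != 0 -> (f 0%R - (L * `|s *: x|)%:E <= f (s *: x)%R)%E ->
  ((- (L * `|x|) * `|s|^-1)%:E <= diffq f x s)%E.
Proof.
move=> s0 H; have [[_ ->]|[b fb ->]] := diffqP f x s0; first by rewrite leey.
move: H; rewrite fb -{1}(fineK (conv0_fin0 f)) -EFinB !lee_fin normrZ => H.
rewrite -divr_sqr_norm// ler_pM2r ?sqr_norm_gt0//; lra.
Qed.

Lemma diffq_le f x s K : s != 0 -> (f (s *: x)%R <= f 0%R + (K * `|s|)%:E)%E ->
  (diffq f x s <= (K * `|s|^-1)%:E)%E.
Proof.
move=> s0 H; have [[fy _]|[b fb ->]] := diffqP f x s0.
  by move: H; rewrite fy -(fineK (conv0_fin0 f)) -EFinD.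
move: H; rewrite fb -{1}(fineK (conv0_fin0 f)) -EFinD !lee_fin => H.
rewrite -divr_sqr_norm// ler_pM2r ?sqr_norm_gt0//; lra.
Qed.

Lemma diffq_lt f x s (r : R) : s != 0 -> (r%:E < diffq f x s)%E ->
  ((fine (f 0) + r * `|s| ^+ 2)%:E < f (s *: x)%R)%E.
Proof.
move=> s0; have [[-> _]|[b -> ->]] := diffqP f x s0; first by rewrite ltry.
rewrite !lte_fin ltr_pdivlMr ?exprn_gt0 ?normr_gt0//; lra.
Qed.

Lemma lt_diffq f x s (r : R) : s != 0 ->
  ((fine (f 0) + r * `|s| ^+ 2)%:E < f (s *: x)%R)%E -> (r%:E < diffq f x s)%E.
Proof.
move=> s0; have [[_ ->]|[b -> ->]] := diffqP f x s0; first by rewrite ltry.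
rewrite !lte_fin ltr_pdivlMr ?exprn_gt0 ?normr_gt0//; lra.
Qed.

Lemma conv0_line_lsc f x : lower_semicontinuous (fun s : R => f (s *: x)).
Proof.
move=> s a /conv_lsc[V Vx fV]; exists ((fun s : R => s *: x) @^-1` V) => [|t /fV //].
exact: scalel_continuous.
Qed.

Lemma measurable_diffq f x : measurable_fun (@Rtimes R) (diffq f x).
Proof.
apply: emeasurable_funM.
  apply: emeasurable_funB; last exact: measurable_cst.
  apply: measurable_funTS.
  by apply: lower_semicontinuous_measurable; exact: conv0_line_lsc.
apply/measurable_EFinP.
rewrite (_ : (fun s : R => _) = (fun s : R => `|s|^-1 ^+ 2)).
  apply: measurable_funX; exact: measurable_inv_norm.
by apply/funext => s; rewrite exprVn.
Qed.

Lemma econvex_segment_le (g : 'cV[R]_n -> \bar R) y (b U w s : R) : econvex g -> 0 < b ->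
  (g (b *: y) <= U%:E)%E -> (g 0%R <= w%:E)%E -> 0 <= s <= b ->
  (g (s *: y) <= (w + s / b * (U - w))%:E)%E.
Proof.
move=> cg b0 gb g0 /andP[s0 sb].
have t01 : 0 <= s / b <= 1 by rewrite divr_ge0 ?(ltW b0)//= ler_pdivrMr// mul1r.
have := econvex_le cg t01 gb g0.
rewrite scaler0 addr0 scalerA divfK ?gt_eqF//.
by congr (_ <= _%:E)%E; ring.
Qed.

(** The part of a ray on which [f] is finite, up to distance [A], shrinks into
    the interior of the domain under any contraction. *)
Lemma conv0_ray f y (lam A : R) (S : set R) : 0 < A -> 0 <= lam < 1 ->
  (forall s, S s -> [/\ 0 < s, s <= A & (f (s *: y) < +oo)%E]) ->
  exists2 b : R, 0 < b &
    (forall s, S s -> s <= b) /\ \forall z \near (b * lam) *: y, f z \is a fin_num.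
Proof.
move=> A0 /andP[l0 l1] HS.
pose J := [set s : R | [/\ 0 <= s, s <= A & (f (s *: y) < +oo)%E]].
have [e /andP[e0 eA] Je] : exists2 e, 0 < e <= A & J e.
  have [M [rho [rho0 fM]]] := conv0_locally_bounded f.
  have yr0 : 0 < rho / (`|y| + 1) by rewrite divr_gt0// ltr_wpDl.
  exists (Num.min A (rho / (`|y| + 1))).
    by rewrite lt_min A0 yr0 ge_min lexx.
  set e := Num.min _ _.
  have e0 : 0 < e by rewrite lt_min A0 yr0.
  split; [exact: ltW|by rewrite ge_min lexx|].
  apply: (@le_lt_trans _ _ M%:E); last by rewrite ltry.
  apply: fM; rewrite normrZ gtr0_norm//.
  have : e * (`|y| + 1) <= rho.
    by rewrite -ler_pdivlMr ?ltr_wpDl// ge_min lexx orbT.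
  by lra.
have supJ : has_sup J.
  by split; [exists e|exists A => s []].
have eb : e <= sup J by exact: sup_upper_bound.
have b0 : 0 < sup J by exact: lt_le_trans eb.
exists (sup J) => //; split.
  by move=> s /HS[s0 sA fs]; apply: sup_upper_bound => //; split=> //; exact: ltW.
have db : 0 < (1 - lam) * sup J by rewrite mulr_gt0// subr_gt0.
have [s2 [s20 s2A fs2] s2b] := sup_adherent db supJ.
have {}s2b : sup J * lam < s2 by lra.
have s2p : 0 < s2 by apply: le_lt_trans s2b; rewrite mulr_ge0// ltW.
have -> : (sup J * lam) *: y = (sup J * lam / s2) *: (s2 *: y).
  by rewrite scalerA divfK ?gt_eqF.
apply: conv0_fin_scale => //.
by rewrite divr_ge0 ?mulr_ge0// ?ltW//= ?ltr_pdivrMr// mul1r.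
Qed.

End integrand.

(** * The operator defined by a measure *)

Section formula.
Variables (R : realType) (n : nat).
Variables (nu : {finite_measure set (measurableTypeR R) -> \bar R}) (c A : R).
Hypotheses (A0 : 0 < A) (nuA : nu [set s : R | A < `|s|] = 0%E).
Hypothesis nuI : (\int[nu]_(s in @Rtimes R) (`|s : R|^-1)%:E < +oo)%E.
Implicit Types (f g : Conv0 R n) (x y : 'cV[R]_n) (s t L K r : R).

(** The measure lives on this bounded part of the punctured line. *)
Definition punctured : set (measurableTypeR R) :=
  @Rtimes R `\` [set s : R | A < `|s|].
Local Notation D := punctured.

Lemma puncturedP s : D s <-> s != 0 /\ `|s| <= A.
Proof.
split=> [[s0 sA]|[s0 sA]]; split=> //; first by rewrite leNgt; apply/negP.
by rewrite /= ltNge sA.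
Qed.

Let mN : measurable ([set s : R | A < `|s|] : set (measurableTypeR R)).
Proof.
by apply: open_measurable; exact: open_norm_gt.
Qed.

Lemma measurable_punctured : measurable D.
Proof. by apply: measurableD => //; exact: measurable_Rtimes. Qed.
Let mD := measurable_punctured.

Lemma integral_punctured (h : measurableTypeR R -> \bar R) :
  measurable_fun (@Rtimes R) h ->
  (\int[nu]_(s in @Rtimes R) h s = \int[nu]_(s in D) h s)%E.
Proof. by move=> mh; apply: integral_null => //; exact: measurable_Rtimes. Qed.

Lemma measurable_fun_punctured (h : measurableTypeR R -> \bar R) : measurable_fun (@Rtimes R) h -> measurable_fun D h.
Proof. by apply: measurable_funS; [exact: measurable_Rtimes|move=> s []]. Qed.

Let mw : measurable_fun (@Rtimes R) (fun s : R => (`|s|^-1)%:E).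
Proof. by apply/measurable_EFinP; exact: measurable_inv_norm. Qed.

Let mKw K : measurable_fun (@Rtimes R) (fun s : R => (K * `|s|^-1)%:E).
Proof. by apply/measurable_EFinP; apply: measurable_funM => //; exact: measurable_inv_norm. Qed.

Lemma inv_norm_mass_fin : (\int[nu]_(s in D) (`|s : R|^-1)%:E)%E \is a fin_num.
Proof.
rewrite -integral_punctured// ge0_fin_numE//.
by apply: integral_ge0 => s _; rewrite lee_fin.
Qed.

Definition inv_norm_mass : R := fine (\int[nu]_(s in D) (`|s : R|^-1)%:E)%E.
Local Notation m1 := inv_norm_mass.

Lemma integral_inv_norm K : 0 <= K ->
  (\int[nu]_(s in D) (K * `|s : R|^-1)%:E = (K * m1)%:E)%E.
Proof.
move=> K0; under eq_integral do rewrite EFinM.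
rewrite ge0_integralZl_EFin//.
- by rewrite EFinM fineK// inv_norm_mass_fin.
- exact: measurable_fun_punctured.
Qed.

Lemma integrable_inv_norm K : nu.-integrable D (fun s : R => (K * `|s|^-1)%:E).
Proof.
under eq_fun do rewrite EFinM.
apply: integrableZl => //; apply/integrableP; split; first exact: measurable_fun_punctured.
under eq_integral do rewrite gee0_abs ?lee_fin//.
have := inv_norm_mass_fin; rewrite ge0_fin_numE//.
by apply: integral_ge0 => s _; rewrite lee_fin.
Qed.

Definition formula f x : \bar R :=
  (c%:E * f 0%R + \int[nu]_(s in @Rtimes R) diffq f x s)%E.

(** [K / |s|] compensates the negative part of the integrand. *)
Definition compensates K f x := forall s, D s -> (0 <= diffq f x s + (K * `|s|^-1)%:E)%E.

Definition compensated K f x : \bar R :=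
  (\int[nu]_(s in D) (diffq f x s + (K * `|s : R|^-1)%:E))%E.

Lemma compensates_cone f x L K : (forall y, (f 0%R - (L * `|y|)%:E <= f y)%E) ->
  L * `|x| <= K -> compensates K f x.
Proof.
move=> cone LK s /puncturedP[s0 _]; have := diffq_ge s0 (cone (s *: x)).
move/(leeD2r (K * `|s|^-1)%:E); apply: le_trans.
by rewrite -EFinD lee_fin -mulrDl mulr_ge0//; lra.
Qed.

Lemma compensates_ex f x : exists2 K, 0 <= K & compensates K f x.
Proof.
have [L L0 cone] := conv0_cone f; exists (L * `|x|); first exact: mulr_ge0.
exact: compensates_cone cone (lexx _).
Qed.

Lemma compensates_le K K' f x : K <= K' -> compensates K f x -> compensates K' f x.
Proof.
move=> KK' H s Ds; apply: le_trans (H s Ds) _.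
by apply: leeD2l; rewrite lee_fin ler_wpM2r.
Qed.

Lemma measurable_compensated K f x : measurable_fun D (fun s : R => diffq f x s + (K * `|s|^-1)%:E)%E.
Proof.
by apply: emeasurable_funD; apply: measurable_fun_punctured; [exact: measurable_diffq|exact: mKw].
Qed.

Let mc := measurable_compensated.

Lemma formulaE K f x : 0 <= K -> compensates K f x ->
  formula f x = ((c * fine (f 0))%:E + (compensated K f x - (K * m1)%:E))%E.
Proof.
move=> K0 H; rewrite /formula EFinM fineK ?conv0_fin0//; congr (_ + _)%E.
rewrite integral_punctured; last exact: measurable_diffq.
rewrite (@integral_shift _ _ _ _ _ mD _ (fun s : R => (K * `|s|^-1)%:E)) ?integral_inv_norm//.
- by apply: measurable_fun_punctured; exact: measurable_diffq.
- by apply: measurable_fun_punctured; exact: mKw.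
- by move=> s _; rewrite lee_fin mulr_ge0.
- by rewrite ltry.
Qed.

Lemma compensated_ge0 K f x : compensates K f x -> (0 <= compensated K f x)%E.
Proof. by move=> H; apply: integral_ge0 => s Ds; exact: H. Qed.

Lemma formula_gtNy f x : (-oo < formula f x)%E.
Proof.
have [K K0 H] := compensates_ex f x; rewrite (formulaE K0 H).
have := compensated_ge0 H; case: (compensated K f x) => [p| |] //.
by rewrite -EFinB -EFinD ltNyr.
Qed.

Lemma formula0 f : formula f 0 = (c * fine (f 0))%:E.
Proof.
rewrite /formula; under eq_integral do rewrite diffq0.
by rewrite integral0 adde0 EFinM fineK// conv0_fin0.
Qed.

Let combD (a b : \bar R) (u v w z : R) : (0 <= a)%E -> (0 <= b)%E ->
  ((u%:E + (a - w%:E)) + (v%:E + (b - z%:E)) = (u + v)%:E + ((a + b) - (w + z)%:E))%E.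
Proof.
case: a => [a| |] // _; case: b => [b| |] // _; rewrite -?EFinB -?EFinD -?EFinB -?EFinD//.
by congr EFin; ring.
Qed.

Lemma formula_add f g x : formula (conv0_add f g) x = (formula f x + formula g x)%E.
Proof.
have [K1 K10 H1] := compensates_ex f x; have [K2 K20 H2] := compensates_ex g x.
have E s : D s -> (diffq (conv0_add f g) x s + ((K1 + K2) * `|s|^-1)%:E =
    (diffq f x s + (K1 * `|s|^-1)%:E) + (diffq g x s + (K2 * `|s|^-1)%:E))%E.
  move=> /puncturedP[s0 _]; rewrite mulrDl EFinD addeACA; congr (_ + _)%E.
  rewrite /diffq /= -(fineK (conv0_fin0 f)) -(fineK (conv0_fin0 g)).
  have q0 := sqr_norm_gt0 s0; set q := `|s| ^- 2 in q0 *.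
  have := conv_gtNy f (s *: x); have := conv_gtNy g (s *: x).
  case: (f (s *: x)) => [a| |] //; case: (g (s *: x)) => [b| |] // _ _.
  - by rewrite -!EFinD -!EFinM; congr EFin; ring.
  - by rewrite -!EFinD addey// !addye// !gt0_mulye ?lte_fin// -EFinM addey.
  - by rewrite -!EFinD !addye// !gt0_mulye ?lte_fin// -EFinM addye.
  - by rewrite -!EFinD !addye// !gt0_mulye ?lte_fin// addye.
have H12 : compensates (K1 + K2) (conv0_add f g) x.
  by move=> s Ds; rewrite E//; apply: adde_ge0; [exact: H1|exact: H2].
rewrite (formulaE (addr_ge0 K10 K20) H12) (formulaE K10 H1) (formulaE K20 H2).
rewrite combD ?compensated_ge0//.
have -> : compensated (K1 + K2) (conv0_add f g) x =
    (compensated K1 f x + compensated K2 g x)%E.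
  rewrite /compensated -ge0_integralD//.
  by apply: eq_integral => s /[!inE] Ds; exact: E.
by rewrite /= fineD ?conv0_fin0// mulrDr mulrDl.
Qed.

Lemma formula_act (eta : 'M[R]_n) f x : formula (conv0_act eta f) x = formula f (invmx eta *m x).
Proof.
rewrite /formula /= mulmx0; congr (_ + _)%E; apply: eq_integral => s _.
by rewrite /diffq /= mulmx0 scalemxAr.
Qed.

Lemma formula_convex f : econvex (formula f).
Proof.
move=> x y t t01; have /andP[t0 t1] := t01.
have t1' : 0 < 1 - t by rewrite subr_gt0.
have [L L0 cone] := conv0_cone f.
pose K := L * (`|x| + `|y|).
have K0 : 0 <= K by rewrite mulr_ge0// addr_ge0.
have Hx : compensates K f x.
  by apply: compensates_cone cone _; rewrite ler_wpM2l// lerDl.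
have Hy : compensates K f y.
  by apply: compensates_cone cone _; rewrite ler_wpM2l// lerDr.
have Hz : compensates K f (t *: x + (1 - t) *: y).
  apply: compensates_cone cone _; rewrite ler_wpM2l//.
  have := ler_normD (t *: x) ((1 - t) *: y); rewrite !normrZ !gtr0_norm//.
  by have := normr_ge0 x; have := normr_ge0 y; nra.
have le : (compensated K f (t *: x + (1 - t) *: y)%R <=
    t%:E * compensated K f x + (1 - t)%:E * compensated K f y)%E.
  pose q z s := (diffq f z s + (K * `|s|^-1)%:E)%E.
  have mq z : measurable_fun D (q z) by exact: measurable_compensated.
  have mZ a z : measurable_fun D (fun s => a%:E * q z s)%E.
    by apply: emeasurable_funM => //; exact: measurable_cst.
  have q0Z a z : 0 < a -> compensates K f z -> forall s, D s -> (0 <= a%:E * q z s)%E.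
    by move=> a0 Hz' s Ds; apply: mule_ge0; [rewrite lee_fin ltW|exact: Hz'].
  have t0' := ltW t0; have t1'' := ltW t1'.
  rewrite /compensated -!ge0_integralZl_EFin//.
  rewrite -ge0_integralD//; [|exact: (q0Z t x)|exact: (mZ t x)
    |exact: (q0Z (1 - t) y)|exact: (mZ (1 - t) y)].
  apply: ge0_le_integral => //.
    exact: (emeasurable_funD (mZ t x) (mZ (1 - t) y)).
  move=> s Ds; have /puncturedP[s0 _] := Ds.
  have := @conv_convex _ _ f (s *: x) (s *: y) t t01.
  have -> : t *: (s *: x) + (1 - t) *: (s *: y) = s *: (t *: x + (1 - t) *: y).
    by rewrite scalerDr !scalerA; congr (_ *: _ + _ *: _); rewrite mulrC.
  have [[_ ->] _|[a fx ->]] := diffqP f x s0.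
    have := Hy s Ds; case: (diffq f y s) => [b| |] // _.
      by rewrite addye// gt0_muley ?lte_fin// addye// leey.
    by rewrite !addye// !gt0_muley ?lte_fin// leey.
  have [[_ ->] _|[b fy ->]] := diffqP f y s0.
    by rewrite addye// -EFinD -EFinM gt0_muley ?lte_fin// addey// leey.
  have [[-> _]|[d fz ->]] := diffqP f (t *: x + (1 - t) *: y) s0.
    by rewrite fx fy -!EFinM -EFinD.
  rewrite fx fy fz -?EFinM -?EFinD -?EFinM -?EFinD !lee_fin => H.
  have q0 := sqr_norm_gt0 s0.
  have H' : d - fine (f 0) <= t * (a - fine (f 0)) + (1 - t) * (b - fine (f 0)) by lra.
  have := ler_wpM2r (ltW q0) H'; lra.
rewrite (formulaE K0 Hx) (formulaE K0 Hy) (formulaE K0 Hz).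
move: le (compensated_ge0 Hx) (compensated_ge0 Hy) (compensated_ge0 Hz).
have pinf u : (0 < u)%R -> (u%:E * +oo = +oo :> \bar R)%E by move=> u0; rewrite gt0_muley ?lte_fin.
case: (compensated K f x) => [p| |] //.
  case: (compensated K f y) => [q| |] //.
    case: (compensated K f (t *: x + (1 - t) *: y)) => [r| |] //.
    rewrite -?EFinM -?EFinD -?EFinM -?EFinD !lee_fin => H _ _ _; lra.
  by move=> _ _ _ _; rewrite -?EFinD addye// addey// pinf// -EFinM addey// leey.
case: (compensated K f y) => [q| |] // _ _ _ _.
  by rewrite -?EFinD addye// addey// pinf// -EFinM addye// leey.
by rewrite addye// addey// !pinf// addye// leey.
Qed.

End formula.

Section formula_limits.
Variables (R : realType) (n : nat).
Variables (nu : {finite_measure set (measurableTypeR R) -> \bar R}) (c A : R).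
Hypotheses (A0 : 0 < A) (nuA : nu [set s : R | A < `|s|] = 0%E).
Hypothesis nuI : (\int[nu]_(s in @Rtimes R) (`|s : R|^-1)%:E < +oo)%E.
Implicit Types (f g : Conv0 R n) (fs : nat -> Conv0 R n) (x y : 'cV[R]_n) (s t L K r : R).
Local Notation D := (punctured A).
Local Notation m1 := (inv_norm_mass nu A).
Local Notation F := (formula nu c).

Lemma epi_cvg_fine0 fs f : epi_cvg fs f -> (fun j => fine (fs j 0)) @ \oo --> fine (f 0).
Proof. by move=> /epi_cvg0 H; apply: fine_cvg; rewrite fineK ?conv0_fin0. Qed.

(** Fatou: the integrands, made nonnegative by one common compensation, are
    lower semicontinuous along the sequence for every fixed [s]. *)
Lemma formula_liminf fs f (xs : nat -> 'cV[R]_n) x r : epi_cvg fs f -> xs @ \oo --> x ->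
  (r%:E < F f x)%E -> \forall j \near \oo, (r%:E < F (fs j) (xs j))%E.
Proof.
move=> ff xx rF.
have [L L0 cone] := epi_cvg_cone ff.
have [L' L'0 cone'] := conv0_cone f.
pose K := (L + L') * (`|x| + 1).
have K0 : 0 <= K by rewrite mulr_ge0// addr_ge0.
have Hf : compensates A K f x.
  apply: compensates_cone cone' _; have := normr_ge0 x; rewrite /K; nra.
have Hj : \forall j \near \oo, compensates A K (fs j) (xs j).
  have xj : \forall j \near \oo, `|xs j| < `|x| + 1.
    move/cvgrPdist_lt : xx => /(_ _ ltr01); apply: filterS => j xj.
    have := ler_normD (xs j - x) x; rewrite subrK distrC; lra.
  move: xj; apply: filterS2 cone => j cone xj; apply: compensates_cone cone _.
  have := normr_ge0 (xs j); rewrite /K; nra.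
pose q j s := maxe 0%E (diffq (fs j) (xs j) s + (K * `|s|^-1)%:E)%E.
have mq j : measurable_fun D (q j).
  by apply: measurable_maxe; [exact: measurable_cst|exact: measurable_compensated].
have q0 j s : D s -> (0 <= q j s)%E by rewrite le_max lexx.
have PleQ : (compensated nu A K f x <= \int[nu]_(s in D) limn_einf (q^~ s))%E.
  apply: ge0_le_integral => //.
  - exact: measurable_punctured.
  - exact: measurable_compensated.
  - apply: measurableT_comp => //; apply: measurable_fun_limn_esup => j.
    exact: measurableT_comp.
  move=> s Ds; have /puncturedP[s0 _] := Ds; apply: le_einf => a aq.
  have {}aq : ((a - K * `|s|^-1)%:E < diffq f x s)%E.
    by rewrite EFinB lteBlDr//.
  have [b [ab bq]] := ereal_dense (diffq_lt s0 aq).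
  rewrite lte_fin in ab.
  have sx : (fun j => s *: xs j) @ \oo --> s *: x by apply: cvgZr.
  have H1 := epi_cvg_gt ff sx bq.
  have d0 : 0 < b - (fine (f 0) + (a - K * `|s|^-1) * `|s| ^+ 2) by rewrite subr_gt0.
  move/cvgrPdist_lt : (epi_cvg_fine0 ff) => /(_ _ d0).
  apply: filterS2 H1 => j H1; rewrite ltr_norml => /andP[H2 _].
  rewrite lt_max; apply/orP; right; rewrite -lteBlDr// -EFinB.
  by apply: lt_diffq => //; apply: le_lt_trans H1; rewrite lee_fin; lra.
have liminf : (compensated nu A K f x <= limn_einf (fun j => \int[nu]_(s in D) q j s))%E.
  apply: le_trans PleQ _; apply: fatou => //; exact: measurable_punctured.
rewrite (formulaE c nuA nuI K0 Hf) in rF.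
have [p [rp pP]] : exists p : R, r - c * fine (f 0) + K * m1 < p /\ (p%:E < compensated nu A K f x)%E.
  have : ((r - c * fine (f 0) + K * m1)%:E < compensated nu A K f x)%E.
    move: rF; case: (compensated nu A K f x) => [P| |] // rF; last by rewrite ltry.
    by move: rF; rewrite -EFinB -EFinD !lte_fin => rF; lra.
  by move=> /ereal_dense[p [rp pP]]; exists p; rewrite -lte_fin.
have cv : (fun j => c * fine (fs j 0)) @ \oo --> c * fine (f 0).
  by apply: cvgMr; exact: epi_cvg_fine0.
have d0 : 0 < p - (r - c * fine (f 0) + K * m1) by rewrite subr_gt0.
have := einf_gt (lt_le_trans pP liminf); move/cvgrPdist_lt : cv => /(_ _ d0).
apply: filterS3 Hj => j Hj; rewrite ltr_norml => /andP[_ cj] pj.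
rewrite (formulaE c nuA nuI K0 Hj).
have -> : compensated nu A K (fs j) (xs j) = (\int[nu]_(s in D) q j s)%E.
  by apply: eq_integral => s /[!inE] Ds; rewrite /q max_r//; exact: Hj.
move: pj; case: (\int[nu]_(s in D) q j s)%E => [P| |] // pj; last by rewrite addye// addey// ltry.
by move: pj; rewrite -EFinB -EFinD !lte_fin => pj; lra.
Qed.

Lemma formula_lsc f : lower_semicontinuous (F f).
Proof.
move=> x a aF; apply: contrapT => H.
have /choice[xs Hxs] : forall k, exists y, `|x - y| < k.+1%:R^-1 /\ (F f y <= a%:E)%E.
  move=> k; apply: contrapT => K; apply: H; exists (ball x k.+1%:R^-1).
    by apply: nbhsx_ballx; rewrite invr_gt0.
  move=> y; rewrite -ball_normE /= => xy; rewrite ltNge; apply/negP => Fa.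
  by apply: K; exists y.
have xsx : xs @ \oo --> x.
  apply/cvgrPdist_lt => e e0; have [N _ HN] := near_infty_natSinv_lt (PosNum e0).
  by exists N => // k /HN /=; apply: lt_trans; exact: (Hxs k).1.
have [N _ /(_ N (leqnn _))] := formula_liminf (conv0_epi_cst f) xsx aF.
by rewrite /= ltNge (Hxs N).2.
Qed.

(** On a ray whose endpoint is interior to the domain of the limit, the
    integrands are bounded by a multiple of [1 / |s|], uniformly in the index. *)
Lemma diffq_upper fs f y (b : R) : epi_cvg fs f -> 0 < b ->
  (\forall z \near b *: y, f z \is a fin_num) ->
  exists2 K : R, 0 <= K & \forall j \near \oo, forall s, 0 < s <= b ->
    (fs j (s *: y) <= fs j 0%R + (K * s)%:E)%E.
Proof.
move=> ff b0 fin.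
have cg j : econvex (fs j) by exact: conv_convex.
have fb := epi_pointwise_cvg cg ff fin.
have /fineK bE := nbhs_singleton fin; set u := fine _ in bE.
have lo : (f (b *: y) < (u + 1)%:E)%E by rewrite -bE lte_fin; lra.
pose v := fine (f 0).
pose K := (`|u + 1 - (v - 1)|) / b.
exists K; first by rewrite divr_ge0// ltW.
have := ecvg_lt fb lo.
move/cvgrPdist_lt : (epi_cvg_fine0 ff) => /(_ _ ltr01).
apply: filterS2 => j; rewrite ltr_norml => /andP[v1 v2] uj s /andP[s0 sb].
have f0 : (fs j 0%R <= (fine (fs j 0))%:E)%E by rewrite fineK ?conv0_fin0.
have sb' : 0 <= s <= b by rewrite ltW.
have := econvex_segment_le (cg j) b0 (ltW uj) f0 sb'.
move/le_trans; apply; rewrite -(fineK (conv0_fin0 (fs j))) -EFinD lee_fin lerD2l.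
have sb0 : 0 <= s / b by rewrite divr_ge0// ltW.
have -> : K * s = s / b * `|u + 1 - (v - 1)| by rewrite /K; ring.
rewrite ler_wpM2l//.
have := ler_norm (u + 1 - (v - 1)); rewrite -/v in v1 v2; lra.
Qed.

(** Inside the domain the operator is continuous along rays: dominated
    convergence applies at [lam *: x] for [lam < 1], because the ray through
    [lam *: x] stays in the interior of the domain at almost every point. *)
Lemma formula_cvg fs f x (lam : R) : epi_cvg fs f -> 0 <= lam < 1 ->
  (F f x < +oo)%E -> (fun j => F (fs j) (lam *: x)) @ \oo --> F f (lam *: x).
Proof.
move=> ff lam01 Fx; have /andP[l0 l1] := lam01.
have [K0 K00 HK0] := compensates_ex A f x.
have mD := measurable_punctured A.
have mdq g y : measurable_fun D (diffq g y).
  by apply: measurable_fun_punctured; exact: measurable_diffq.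
pose G := [set s : R | D s /\ (f (s *: x) < +oo)%E].
have aeG : {ae nu, forall s, D s -> G s}.
  have : nu.-integrable D (fun s : R => diffq f x s + (K0 * `|s|^-1)%:E)%E.
    apply/integrableP; split; first exact: measurable_compensated.
    under eq_integral => s /[!inE] Ds do rewrite gee0_abs ?HK0//.
    move: Fx; rewrite (formulaE c nuA nuI K00 HK0).
    have := compensated_ge0 nu HK0; rewrite /compensated.
    by case: (\int[nu]_(s in D) _)%E => [P| |] //; rewrite ?ltry.
  move=> /(integrable_ae mD); apply: filterS => s H Ds; split=> //.
  have /puncturedP[s0 _] := Ds; have := H Ds.
  by have [[_ ->]|[b -> _]] := diffqP f x s0; rewrite ?addye// ltry.
have side (y : 'cV[R]_n) (e : R) : (forall s, e * s *: x = s *: y) -> `|e| = 1 -> e * e = 1 ->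
    exists2 K : R, 0 <= K & \forall j \near \oo, forall s, G s -> 0 < e * s ->
      (fs j (s *: (lam *: x)) <= fs j 0%R + (K * `|s|)%:E)%E.
  move=> ey e1 ee.
  have [|b b0 [Sb fin]] := @conv0_ray R n f y lam A [set s | G (e * s) /\ 0 < s] A0 lam01.
    move=> s [[/puncturedP[_ sA] fs'] s0]; split=> //.
      by move: sA; rewrite normrM e1 mul1r gtr0_norm.
    by rewrite -ey.
  rewrite -scalerA in fin.
  have [K KK H] := diffq_upper ff b0 fin; exists K => //.
  apply: filterS H => j H s Gs es.
  have esb : 0 < e * s <= b by rewrite es Sb//=; split=> //; rewrite mulrA ee mul1r.
  have := H _ esb.
  have -> : s *: (lam *: x) = (e * s) *: (lam *: y).
    rewrite !scalerA (_ : e * s * lam = lam * e * s); last by ring.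
    rewrite -[RHS]scalerA -ey scalerA; congr (_ *: _).
    by rewrite -mulrA [e * (e * s)]mulrA ee mul1r mulrC.
  by have -> : `|s| = e * s by rewrite -(gtr0_norm es) normrM e1 mul1r.
have [|||Kp Kp0 Hp] := side x 1; rewrite ?normr1 ?mulr1//.
  by move=> s; rewrite mul1r.
have [|||Km Km0 Hm] := side (- x) (-1); rewrite ?normrN1 ?mulrN1 ?opprK//.
  by move=> s; rewrite mulN1r scaleNr scalerN.
have [L L0 cone] := epi_cvg_cone ff.
pose K := Kp + Km + L * `|lam *: x|.
have K_ge0 : 0 <= K by rewrite !addr_ge0// mulr_ge0.
have [N _ HN] : \forall j \near \oo, forall s, G s ->
    (`|diffq (fs j) (lam *: x) s| <= (K * `|s|^-1)%:E)%E.
  apply: filterS3 Hp Hm cone => j Hp Hm cone s Gs.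
  have [/puncturedP[s0 _] _] := Gs; have w0 : 0 <= `|s|^-1 by [].
  apply: abse_le.
    apply: le_trans (diffq_ge s0 (cone (s *: (lam *: x)))).
    rewrite lee_fin -mulNr ler_wpM2r// lerN2 /K; lra.
  have up Q : Q <= K -> (fs j (s *: (lam *: x)) <= fs j 0%R + (Q * `|s|)%:E)%E ->
      (diffq (fs j) (lam *: x) s <= (K * `|s|^-1)%:E)%E.
    by move=> QK /(diffq_le s0)/le_trans; apply; rewrite lee_fin ler_wpM2r.
  have Lx : 0 <= L * `|lam *: x| by rewrite mulr_ge0.
  have [s_gt0|s_lt0] := ltP 0 s.
    by apply: (up Kp); [rewrite /K; lra|apply: Hp => //; rewrite mul1r].
  apply: (up Km); first by rewrite /K; lra.
  by apply: Hm => //; rewrite mulN1r oppr_gt0 lt_neqAle s0.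
have cvgI : (fun j => \int[nu]_(s in D) diffq (fs (j + N)%N) (lam *: x) s)%E @ \oo -->
    (\int[nu]_(s in D) diffq f (lam *: x) s)%E.
  have [] // := @dominated_convergence _ _ _ nu _ mD
    (fun j s => diffq (fs (j + N)%N) (lam *: x) s) (diffq f (lam *: x))
    (fun s : R => (K * `|s|^-1)%:E).
  - apply: (@filterS _ _ (ae_filter_ringOfSetsType nu) _ _ _ aeG) => s H Ds; have [_ fx] := H Ds.
    have fin : \forall z \near s *: (lam *: x), f z \is a fin_num.
      by rewrite scalerA mulrC -scalerA; exact: conv0_fin_scale.
    have cf j : econvex (fs j) by exact: conv_convex.
    rewrite (cvg_shiftn N (fun j => diffq (fs j) (lam *: x) s)).
    apply: cvgeM; last exact: cvg_cst.
      by rewrite mule_def_fin// fin_numB (nbhs_singleton fin) conv0_fin0.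
    apply: cvgeB.
    + by rewrite fin_num_adde_defl// fin_numN conv0_fin0.
    + exact: epi_pointwise_cvg cf ff fin.
    + exact: epi_cvg0.
  - exact: integrable_inv_norm.
  - apply: (@filterS _ _ (ae_filter_ringOfSetsType nu) _ _ _ aeG) => s H j Ds; apply: HN; last exact: H.
    exact: leq_addl.
rewrite -(cvg_shiftn N).
have E g y : F g y = (c%:E * g 0%R + \int[nu]_(s in D) diffq g y s)%E.
  by rewrite /formula (integral_punctured nuA)//; exact: measurable_diffq.
under eq_fun do rewrite E.
rewrite E; apply: cvgeD => //.
  by rewrite fin_num_adde_defr// fin_numM ?conv0_fin0.
apply: cvgeM; [by rewrite mule_def_fin ?conv0_fin0|exact: cvg_cst|].
by rewrite (cvg_shiftn N (fun j => fs j 0)); exact: epi_cvg0.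
Qed.

(** Recovery sequences are found on the ray through [x], slightly closer to the
    origin. *)
Lemma formula_recovery fs f x : epi_cvg fs f -> exists2 xs : nat -> 'cV[R]_n,
  xs @ \oo --> x & (fun j => F (fs j) (xs j)) @ \oo --> F f x.
Proof.
move=> ff; have [Fx|] := ltP (F f x) +oo%E; last first.
  rewrite leye_eq => /eqP Fx; exists (fun=> x); first exact: cvg_cst.
  apply: ecvg_sandwich => r; rewrite Fx// => _.
  by apply: formula_liminf ff _ _; [exact: cvg_cst|rewrite Fx ltry].
have FxE : F f x = (fine (F f x))%:E.
  by rewrite fineK// fin_numElt (formula_gtNy c nuA nuI).
set b := fine (F f x) in FxE.
pose lam (k : nat) : R := 1 - k.+1%:R^-1.
have lam01 k : 0 <= lam k < 1.
  rewrite /lam subr_ge0 invf_le1// ler1n/=.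
  by rewrite ltrBlDr ltrDl invr_gt0.
pose a := c * fine (f 0).
pose q k := lam k * b + (1 - lam k) * a.
have Fq k : (F f (lam k *: x) <= (q k)%:E)%E.
  have /andP[l0 l1] := lam01 k.
  have t01 : 0 <= lam k <= 1 by rewrite l0 ltW.
  have Fxb : (F f x <= b%:E)%E by rewrite FxE.
  have F0 : (F f 0%R <= a%:E)%E by rewrite formula0.
  have := econvex_le (formula_convex c nuA nuI f) t01 Fxb F0.
  by rewrite scaler0 addr0.
have [k|lev [levy Hlev]] := @eventually_diagonal
  (fun j k => (F (fs j) (lam k *: x) < (q k + k.+1%:R^-1)%:E)%E).
  apply: ecvg_lt; first exact: formula_cvg.
  by apply: le_lt_trans (Fq k) _; rewrite lte_fin ltrDl invr_gt0.
have lam1 : (fun j => lam (lev j)) @ \oo --> (1 : R).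
  rewrite -[X in _ --> X]subr0; apply: cvgB; first exact: cvg_cst.
  exact: (cvg_comp _ _ levy (@cvg_harmonic R)).
have lamx : (fun j => lam (lev j) *: x) @ \oo --> x.
  by rewrite -[X in _ --> X]scale1r; exact: cvgZl.
exists (fun j => lam (lev j) *: x) => //.
apply: ecvg_sandwich => r rF; first exact: formula_liminf rF.
have qb : (fun j => q (lev j) + (lev j).+1%:R^-1) @ \oo --> b.
  have -> : b = 1 * b + (1 - 1) * a + 0 by ring.
  apply: cvgD; last exact: (cvg_comp _ _ levy (@cvg_harmonic R)).
  apply: cvgD; first by apply: cvgMl.
  by apply: cvgMl; apply: cvgB => //; exact: cvg_cst.
rewrite FxE lte_fin in rF.
have Hq : \forall j \near \oo, q (lev j) + (lev j).+1%:R^-1 < r by exact: (cvgr_lt b).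
by apply: filterS2 Hlev Hq => j Fj qr; apply: lt_trans Fj _; rewrite lte_fin.
Qed.

Lemma formula_near0 f : \forall x \near (0 : 'cV[R]_n), F f x \is a fin_num.
Proof.
have [M [rho [rho0 fM]]] := conv0_locally_bounded f.
have e0 : 0 < rho / 2 / A by rewrite !divr_gt0.
apply/nbhs_ballP; exists (rho / 2 / A) => //= x.
rewrite -ball_normE /ball_/= sub0r normrN => xe.
rewrite fin_numElt (formula_gtNy c nuA nuI)//=.
have v0 := fineK (conv0_fin0 f); set v := fine (f 0) in v0.
have fM' y : `|y - 0| < rho -> (f y <= M%:E)%E by rewrite subr0; exact: fM.
have fv : (f 0%R <= v%:E)%E by rewrite v0.
have Mv : v <= M by rewrite -lee_fin v0; apply: fM; rewrite normr0.
pose K := 2 * (M - v) / rho * `|x|.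
have K0 : 0 <= K by rewrite !mulr_ge0// ?subr_ge0// invr_ge0 ltW.
have up s : D s -> (diffq f x s <= (K * `|s|^-1)%:E)%E.
  move=> /puncturedP[s0 sA]; apply: diffq_le => //.
  have sx : `|s *: x - 0| <= rho / 2.
    rewrite subr0 normrZ; apply: (@le_trans _ _ (A * `|x|)); first exact: ler_wpM2r.
    by move: xe; rewrite ltr_pdivlMr// mulrC => /ltW.
  have := econvex_cone_le (@conv_convex _ _ f) rho0 fM' fv sx.
  by rewrite -v0 -EFinD subr0 normrZ /K [`|s| * _]mulrC mulrA.
have [K' K'0 H] := compensates_ex A f x.
rewrite (formulaE c nuA nuI K'0 H).
have : (compensated nu A K' f x <= ((K + K') * m1)%:E)%E.
  rewrite -(integral_inv_norm nuA nuI) ?addr_ge0//.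
  apply: ge0_le_integral => //.
  - exact: measurable_punctured.
  - exact: measurable_compensated.
  - by have /integrableP[] := integrable_inv_norm nuA nuI (K + K').
  by move=> s Ds; rewrite mulrDl EFinD; apply: leeD2r; exact: up.
have := compensated_ge0 nu H; case: (compensated nu A K' f x) => [P| |] // _ _.
by rewrite -EFinB -EFinD ltry.
Qed.

Lemma formula_proper f : exists x, F f x != +oo%E.
Proof. by exists 0; rewrite formula0. Qed.

Definition formula_op f : Conv0 R n :=
  @MkConv0 R n (@MkConv R n (F f) (@formula_lsc f) (formula_convex c nuA nuI f)
    (formula_gtNy c nuA nuI f) (formula_proper f)) (formula_near0 f).

Lemma formula_op_epi fs f : epi_cvg fs f ->
  epi_cvg (fun j => formula_op (fs j)) (formula_op f).
Proof.
move=> ff; apply: epi_cvgI; last by move=> x; exact: formula_recovery.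
by move=> x xs r; exact: formula_liminf.
Qed.

Lemma formula_op_continuous : continuous formula_op.
Proof. by apply: epi_continuous => fs f; exact: formula_op_epi. Qed.

Lemma formula_op_additive : conv0_additive formula_op.
Proof. by move=> f g; apply: conv0_ext; apply/funext => x; exact: (formula_add c nuA nuI). Qed.

Lemma formula_op_equivariant : GL_equivariant formula_op.
Proof. by move=> eta f _; apply: conv0_ext; apply/funext => x; exact: formula_act. Qed.

End formula_limits.

(** * Ridge functions *)

Section ridge.
Variable R : realType.

Definition convexR (phi : R -> R) := forall x y t : R, 0 < t < 1 ->
  phi (t * x + (1 - t) * y) <= t * phi x + (1 - t) * phi y.

Record cvx := Cvx { cvx_fun :> R -> R; cvx_convex : convexR cvx_fun }.

Lemma affine_convex (a b : R) : convexR (fun s => a + b * s).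
Proof. by move=> x y t _; lra. Qed.
Definition affine a b := Cvx (affine_convex a b).

Lemma add_convex (phi psi : cvx) : convexR (fun s => phi s + psi s).
Proof.
move=> x y t t01; have := cvx_convex phi x y t01; have := cvx_convex psi x y t01; lra.
Qed.
Definition cvx_add phi psi := Cvx (add_convex phi psi).

Lemma max_convex (phi psi : cvx) : convexR (fun s => Num.max (phi s) (psi s)).
Proof.
move=> x y t t01; have := cvx_convex phi x y t01; have := cvx_convex psi x y t01.
move: t01 => /andP[t0 t1] hpsi hphi; rewrite ge_max.
have hx1 : phi x <= Num.max (phi x) (psi x) by rewrite le_max lexx.
have hx2 : psi x <= Num.max (phi x) (psi x) by rewrite le_max lexx orbT.
have hy1 : phi y <= Num.max (phi y) (psi y) by rewrite le_max lexx.
have hy2 : psi y <= Num.max (phi y) (psi y) by rewrite le_max lexx orbT.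
by apply/andP; split; nra.
Qed.
Definition cvx_max phi psi := Cvx (max_convex phi psi).

Lemma scale_convex (a : R) (phi : cvx) : convexR (fun s => `|a| * phi s).
Proof.
move=> x y t t01; have := ler_wpM2l (normr_ge0 a) (cvx_convex phi x y t01); lra.
Qed.
(** Scaling by [`|a|] rather than by [a] makes the operation total. *)
Definition cvx_scale a phi := Cvx (scale_convex a phi).

Lemma dilate_convex (a : R) (phi : cvx) : convexR (fun s => phi (a * s)).
Proof.
move=> x y t t01; have := cvx_convex phi (a * x) (a * y) t01.
by rewrite (_ : t * (a * x) + _ = a * (t * x + (1 - t) * y)); [|ring].
Qed.
Definition dilate a phi := Cvx (dilate_convex a phi).

Definition hinge (p q : R) := cvx_max (affine 0 0) (affine q p).

Lemma hingeE p q s : hinge p q s = Num.max 0 (p * s + q).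
Proof. by rewrite /hinge /= mul0r addr0 addrC. Qed.

Variable n : nat.
Implicit Types (i : 'I_n) (phi : cvx).

Lemma ridge_convex i phi : econvex (fun x : 'cV[R]_n => (phi (x i 0))%:E).
Proof.
move=> x y t t01; rewrite -!EFinM -EFinD lee_fin !mxE; exact: cvx_convex.
Qed.

Definition ridge i phi : Conv0 R n := finite_conv0 (ridge_convex i phi) (fun=> isT).

Lemma ridgeE i phi x : ridge i phi x = (phi (x i 0))%:E.
Proof. by []. Qed.

Definition basis i : 'cV[R]_n := delta_mx i 0.

Lemma basisE i (s : R) : (s *: basis i) i 0 = s.
Proof. by rewrite !mxE !eqxx mulr1. Qed.

Lemma diffq_ridge i phi (s : R) :
  diffq (ridge i phi) (basis i) s = ((phi s - phi 0) * `|s| ^- 2)%:E.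
Proof. by rewrite /diffq !ridgeE basisE mxE. Qed.

Definition coord i (x : 'cV[R]_n) : R := x i 0.

Lemma coord_linear i : linear_for *%R (coord i).
Proof. by move=> a x y; rewrite /coord !mxE. Qed.
HB.instance Definition _ i :=
  GRing.isLinear.Build R 'cV[R]_n R *%R (coord i) (coord_linear i).

End ridge.

(** * Monotonicity and dual translation invariance *)

Section monotone.
Variables (R : realType) (n : nat) (i : 'I_n).
Variables (nu : {finite_measure set (measurableTypeR R) -> \bar R}) (c A : R).
Hypotheses (nuA : nu [set s : R | A < `|s|] = 0%E).
Hypothesis nuI : (\int[nu]_(s in @Rtimes R) (`|s : R|^-1)%:E < +oo)%E.
Local Notation D := (punctured A).
Local Notation m1 := (inv_norm_mass nu A).
Local Notation F := (formula nu c).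

Let mD := measurable_punctured A.

Lemma measurable_inv_sqr : measurable_fun (@Rtimes R) (fun s : R => (`|s| ^- 2)%:E).
Proof.
apply/measurable_EFinP; rewrite (_ : (fun s : R => _) = (fun s : R => `|s|^-1 ^+ 2)).
  by apply: measurable_funX; exact: measurable_inv_norm.
by apply/funext => s; rewrite exprVn.
Qed.

Lemma formula_monotone (f g : Conv0 R n) :
  (\int[nu]_(s in @Rtimes R) (`|s : R| ^- 2)%:E <= c%:E)%E ->
  (forall x, (f x <= g x)%E) -> forall x, (F f x <= F g x)%E.
Proof.
rewrite (integral_punctured nuA measurable_inv_sqr) => Ic fg x.
have I0 : (0 <= \int[nu]_(s in D) (`|s : R| ^- 2)%:E)%E.
  by apply: integral_ge0 => s _; rewrite lee_fin.
have IE : (\int[nu]_(s in D) (`|s : R| ^- 2)%:E)%E \is a fin_num.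
  by rewrite ge0_fin_numE//; apply: le_lt_trans Ic _; rewrite ltry.
have [K1 K10 H1] := compensates_ex A f x; have [K2 K20 H2] := compensates_ex A g x.
have Hf : compensates A (K1 + K2) f x by apply: compensates_le H1; rewrite lerDl.
have Hg : compensates A (K1 + K2) g x by apply: compensates_le H2; rewrite lerDr.
have K0 : 0 <= K1 + K2 by exact: addr_ge0.
rewrite (formulaE c nuA nuI K0 Hf) (formulaE c nuA nuI K0 Hg).
set K := K1 + K2 in Hf Hg K0 *.
have ab : fine (f 0) <= fine (g 0) by rewrite fine_le// conv0_fin0.
set a := fine (f 0) in ab *; set b := fine (g 0) in ab *.
have ab0 : 0 <= b - a by rewrite subr_ge0.
have le : (compensated nu A K f x <=
    compensated nu A K g x + (b - a)%:E * \int[nu]_(s in D) (`|s : R| ^- 2)%:E)%E.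
  have mI : measurable_fun D (fun s : R => ((b - a)%:E * (`|s| ^- 2)%:E)%E).
    apply: emeasurable_funM; first exact: measurable_cst.
    by apply: measurable_fun_punctured; exact: measurable_inv_sqr.
  rewrite /compensated -ge0_integralZl_EFin//; last first.
    by apply: measurable_fun_punctured; exact: measurable_inv_sqr.
  rewrite -ge0_integralD//; last 2 first.
  - exact: measurable_compensated.
  - by move=> s _; rewrite -EFinM lee_fin mulr_ge0.
  apply: ge0_le_integral => //.
  - exact: measurable_compensated.
  - by apply: emeasurable_funD => //; exact: measurable_compensated.
  move=> s Ds; have /puncturedP[s0 _] := Ds.
  rewrite addeAC; apply: leeD2r; have q0 := sqr_norm_gt0 s0.
  have := fg (s *: x).
  have [[-> ->]|[d -> ->]] := diffqP g x s0.
    by move=> _; rewrite -EFinM addye// leey.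
  have [[-> _] //|[e -> ->]] := diffqP f x s0.
  by rewrite -EFinM -EFinD !lee_fin -/a -/b -mulrDl ler_pM2r// => ?; lra.
move: le (compensated_ge0 nu Hg).
rewrite -(fineK IE) in Ic *; rewrite lee_fin in Ic.
case: (compensated nu A K g x) => [p| |] //; last first.
  by move=> _ _; rewrite addye// addey// leey.
case: (compensated nu A K f x) => [q| |] //; last first.
  by move=> _ _; rewrite addNye addeNy leNye.
rewrite -?EFinM -?EFinD !lee_fin => pq _.
have := ler_wpM2l ab0 Ic; lra.
Qed.

(** The functions [k * |t| - 1] and their positive parts differ by a spike of
    height [1] at the origin; as [k] grows, the difference of their images at
    a basis vector decreases to [c - \int |s| ^- 2]. *)
Lemma formula_monotone_inv :
  (forall f g : Conv0 R n, (forall x, (f x <= g x)%E) -> forall x, (F f x <= F g x)%E) ->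
  (\int[nu]_(s in @Rtimes R) (`|s : R| ^- 2)%:E <= c%:E)%E.
Proof.
move=> mono; rewrite (integral_punctured nuA measurable_inv_sqr).
pose V (k : R) := cvx_max (affine (-1) k) (affine (-1) (- k)).
have VE (k s : R) : 0 <= k -> V k s = k * `|s| - 1.
  rewrite /V /= => k0; rewrite /Num.max.
  have [s0|s0] := ler0P s; case: ltP => H; nra.
pose W k := cvx_max (affine 0 0) (V k).
have WE (k s : R) : 0 <= k -> W k s = Num.max 0 (k * `|s| - 1).
  by move=> k0; rewrite -VE// /W /= mul0r addr0.
pose T (k : nat) (s : R) := (Num.min 1 (k%:R * `|s|) * `|s| ^- 2)%:E.
have T0 k s : (0 <= T k s)%E.
  by rewrite lee_fin mulr_ge0// le_min ler01/= mulr_ge0.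
have mn : measurable_fun (@Rtimes R) (fun s : R => `|s|).
  exact: normr_measurable.
have mq : measurable_fun (@Rtimes R) (fun s : R => `|s| ^- 2).
  by apply/measurable_EFinP; exact: measurable_inv_sqr.
have mT k : measurable_fun D (T k).
  apply: measurable_fun_punctured; apply/measurable_EFinP; apply: measurable_funM => //.
  apply: measurable_minr; first exact: measurable_cst.
  by apply: measurable_funM => //; exact: measurable_cst.
have bound k : (\int[nu]_(s in D) T k s <= c%:E)%E.
  have k0 : 0 <= k%:R :> R by [].
  have VW x : (ridge i (V k%:R) x <= ridge i (W k%:R) x)%E.
    by rewrite !ridgeE lee_fin /W /= le_max lexx orbT.
  have := mono _ _ VW (basis R i).
  pose G (s : R) : \bar R := (Num.max 0 (k%:R * `|s| - 1) * `|s| ^- 2)%:E.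
  have G0 s : (0 <= G s)%E by rewrite lee_fin mulr_ge0// le_max lexx.
  have mG : measurable_fun D G.
    apply: measurable_fun_punctured; apply/measurable_EFinP; apply: measurable_funM => //.
    apply: measurable_maxr; first exact: measurable_cst.
    apply: measurable_funB; last exact: measurable_cst.
    by apply: measurable_funM => //; exact: measurable_cst.
  have TG : (\int[nu]_(s in D) T k s + \int[nu]_(s in D) G s = (k%:R * m1)%:E)%E.
    rewrite -(integral_inv_norm nuA nuI k0) -ge0_integralD//.
    apply: eq_integral => s /[!inE] /puncturedP[s0 _].
    rewrite -EFinD -mulrDl -divr_sqr_norm//; congr (_ * _)%:E.
    by rewrite /Num.min /Num.max; case: ltP => ?; case: ltP => ?; lra.
  have FV : F (ridge i (V k%:R)) (basis R i) = (- c + k%:R * m1)%:E.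
    rewrite /formula (integral_punctured nuA); last exact: measurable_diffq.
    rewrite EFinD -(integral_inv_norm nuA nuI k0); congr (_ + _)%E.
      by rewrite ridgeE mxE VE// normr0 mulr0 sub0r -EFinM mulrN1.
    apply: eq_integral => s /[!inE] /puncturedP[s0 _].
    by rewrite diffq_ridge !VE// normr0 mulr0 -divr_sqr_norm//; congr (_ * _)%:E; ring.
  have FW : F (ridge i (W k%:R)) (basis R i) = (\int[nu]_(s in D) G s)%E.
    rewrite /formula (integral_punctured nuA); last exact: measurable_diffq.
    rewrite ridgeE mxE WE// normr0 mulr0 sub0r max_l ?lerN10// mule0 add0e.
    apply: eq_integral => s _.
    by rewrite diffq_ridge !WE// normr0 mulr0 sub0r [X in _ - X]max_l ?lerN10// subr0.
  rewrite FV FW; move: TG.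
  have IT : (0 <= \int[nu]_(s in D) T k s)%E by exact: integral_ge0.
  have IG : (0 <= \int[nu]_(s in D) G s)%E by exact: integral_ge0.
  case: (\int[nu]_(s in D) T k s)%E IT => [p| |] //; last first.
    by case: (\int[nu]_(s in D) G s)%E IG.
  case: (\int[nu]_(s in D) G s)%E IG => [q| |] // _ _.
  rewrite -EFinD => -[pq]; rewrite !lee_fin; lra.
apply: (@le_trans _ _ (\int[nu]_(s in D) limn_einf (T^~ s))%E).
  apply: ge0_le_integral => //.
  - by apply: measurable_fun_punctured; exact: measurable_inv_sqr.
  - apply: measurableT_comp => //; apply: measurable_fun_limn_esup => j.
    exact: measurableT_comp.
  move=> s /puncturedP[s0 _]; apply: le_einf => r rs.
  have [N _ HN] := nbhs_infty_ger (`|s|^-1).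
  exists N => // k /HN /= ks; rewrite /T min_l ?mul1r//.
  by rewrite -ler_pdivrMr ?normr_gt0// div1r.
apply: le_trans (fatou _ _ _ _) _ => //.
apply: ereal_le_lt => r /einf_gt[N _ /(_ N (leqnn _)) /= rN].
exact: le_trans (ltW rN) (bound N).
Qed.

End monotone.

Section dual_translation.
Variables (R : realType) (n : nat) (i : 'I_n).
Variables (nu : {finite_measure set (measurableTypeR R) -> \bar R}) (c A : R).
Hypotheses (nuA : nu [set s : R | A < `|s|] = 0%E).
Hypothesis nuI : (\int[nu]_(s in @Rtimes R) (`|s : R|^-1)%:E < +oo)%E.
Local Notation D := (punctured A).
Local Notation F := (formula nu c).

Lemma measurable_inv : measurable_fun (@Rtimes R) (fun s : R => (s^-1)%:E).
Proof.
apply/measurable_EFinP.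
have oR : open (@Rtimes R : set R).
  rewrite (_ : @Rtimes R = [set s : R | s != 0])//; exact: open_neq.
apply: (@open_continuous_measurable_fun R _ _ oR) => s; rewrite inE => s0.
exact: inv_continuous.
Qed.

Lemma integrable_inv : nu.-integrable D (fun s : R => (s^-1)%:E).
Proof.
have mD := measurable_punctured A.
have := integrable_inv_norm nuA nuI 1; apply: le_integrable => //.
  by apply: measurable_fun_punctured; exact: measurable_inv.
by move=> s _ /=; rewrite lee_fin mul1r normfV [leRHS]ger0_norm.
Qed.

Lemma formula_linear (l : {scalar 'cV[R]_n}) x :
  F (conv0_linear l) x = ((l x)%:E * \int[nu]_(s in @Rtimes R) (s^-1)%:E)%E.
Proof.
rewrite /formula !(integral_punctured nuA);
  [|exact: measurable_inv|exact: measurable_diffq].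
rewrite /= linear0 mule0 add0e -integralZl//; [|exact: measurable_punctured
  |exact: integrable_inv].
apply: eq_integral => s /[!inE] /puncturedP[s0 _].
rewrite /diffq /= linearZ linear0 /= sube0 -!EFinM; congr EFin.
by rewrite real_normK ?num_real// expr2 invfM mulrA [s * l x]mulrC mulfK.
Qed.

Lemma formula_dual_translation :
  (forall (f : Conv0 R n) (l : {scalar 'cV[R]_n}) x,
     F (conv0_add f (conv0_linear l)) x = F f x) <->
  (\int[nu]_(s in @Rtimes R) (s^-1)%:E = 0)%E.
Proof.
split=> [H|M0 f l x]; last first.
  by rewrite (formula_add c nuA nuI) formula_linear M0 mule0 adde0.
have := H (ridge i (affine 0 0)) (coord i) (basis R i).
rewrite (formula_add c nuA nuI) formula_linear.
have -> : (coord i : {scalar 'cV[R]_n}) (basis R i) = 1 by rewrite /= /coord mxE !eqxx.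
have -> : F (ridge i (affine 0 0)) (basis R i) = 0%E.
  rewrite /formula ridgeE /= !mul0r addr0 mule0 add0e integral0_eq// => s _.
  by rewrite diffq_ridge /= !mul0r subrr mul0r.
by rewrite add0e mul1e.
Qed.

End dual_translation.

(** * Functionals on convex functions of one variable *)

Section slopes.
Variable R : realType.
Implicit Types (phi : cvx R) (u v w s : R).

Definition slope phi u v := (phi v - phi u) / (v - u).

Lemma cvx_chord phi u v w : u < v < w ->
  (w - u) * phi v <= (w - v) * phi u + (v - u) * phi w.
Proof.
move=> /andP[uv vw]; have uw := lt_trans uv vw.
have d0 : 0 < w - u by rewrite subr_gt0.
pose t := (w - v) / (w - u).
have t01 : 0 < t < 1.
  by rewrite /t divr_gt0 ?subr_gt0//= ltr_pdivrMr// mul1r; lra.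
have := cvx_convex phi u w t01.
have -> : t * u + (1 - t) * w = v by rewrite /t; field; rewrite gt_eqF.
move=> /(ler_wpM2l (ltW d0)); congr (_ <= _).
by rewrite /t; field; rewrite gt_eqF.
Qed.

Lemma slope_le phi u v u' v' : u < v -> u' < v' -> u <= u' -> v <= v' ->
  slope phi u v <= slope phi u' v'.
Proof.
move=> uv uv' uu vv; have uv2 : u < v' := lt_le_trans uv vv.
apply: (@le_trans _ _ (slope phi u v')).
  move: vv; rewrite le_eqVlt => /predU1P[->//|vv].
  have := @cvx_chord phi u v v'; rewrite uv vv => /(_ isT) H.
  by rewrite /slope ler_pdivrMr ?subr_gt0// mulrAC ler_pdivlMr ?subr_gt0//; lra.
move: uu; rewrite le_eqVlt => /predU1P[<-//|uu].
have := @cvx_chord phi u u' v'; rewrite uu uv' => /(_ isT) H.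
by rewrite /slope ler_pdivrMr ?subr_gt0// mulrAC ler_pdivlMr ?subr_gt0//; lra.
Qed.

Lemma slopeE phi u v : phi v = phi u + slope phi u v * (v - u).
Proof.
rewrite /slope; have [->|uv] := eqVneq u v; first by rewrite !subrr mulr0 addr0.
by rewrite divfK ?subr_eq0 1?eq_sym// addrC subrK.
Qed.

End slopes.

Section functional.
Variable R : realType.
Implicit Types (phi psi : cvx R) (E : cvx R -> R) (a b p q s : R).

Definition cvx_cvg (phis : nat -> cvx R) phi :=
  forall s, (fun j => phis j s) @ \oo --> phi s.

(** The functionals obtained by evaluating an operator on ridge functions at a
    basis vector are of this kind. *)
Record functional E : Prop := Functional {
  functional_ext : forall phi psi, phi =1 psi -> E phi = E psi ;
  functional_add : forall phi psi, E (cvx_add phi psi) = E phi + E psi ;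
  functional_scale : forall a phi, E (cvx_scale a phi) = `|a| * E phi ;
  functional_cvg : forall phis phi, cvx_cvg phis phi ->
    (fun j => E (phis j)) @ \oo --> E phi }.

(** Piecewise affine interpolation of [phi] on the grid of step [h] starting
    at [a]: each node contributes a hinge with the jump of the slope. *)
Fixpoint interp phi a h (k : nat) : cvx R :=
  let node j := a + j%:R * h in
  let m j := slope phi (node j) (node j.+1) in
  if k is k'.+1 then cvx_add (interp phi a h k')
    (cvx_scale (m k - m k') (hinge 1 (- node k)))
  else affine (phi a - m 0%N * a) (m 0%N).

Section interpolation.
Variables (phi : cvx R) (a h : R).
Hypothesis h0 : 0 < h.
Let node (j : nat) := a + j%:R * h.
Let m j := slope phi (node j) (node j.+1).

Let nodeS j : node j.+1 = node j + h.
Proof. by rewrite /node -natr1; ring. Qed.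

Let m_le j : m j <= m j.+1.
Proof. by have h0' := h0; apply: slope_le; rewrite ?nodeS; lra. Qed.

Let node_le j k : (j <= k)%N -> node j <= node k.
Proof. by move=> jk; rewrite lerD2l; apply: ler_wpM2r; [exact: ltW|rewrite ler_nat]. Qed.

Let interpS k s : interp phi a h k.+1 s = interp phi a h k s +
  (m k.+1 - m k) * Num.max 0 (s - node k.+1).
Proof.
have -> : m k.+1 - m k = `|m k.+1 - m k| by rewrite ger0_norm// subr_ge0.
rewrite (_ : s - node k.+1 = 1 * s + - node k.+1); last by rewrite mul1r.
by rewrite -hingeE.
Qed.

Let interp_right k s : node k <= s -> interp phi a h k s = phi (node k) + m k * (s - node k).
Proof.
elim: k s => [s _|k IH s ks].
  by rewrite /= -/(node 1) -/(node 0) -/(m 0) /node mul0r addr0; ring.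
rewrite interpS IH; last by apply: le_trans ks; exact: node_le.
rewrite max_r ?subr_ge0// (slopeE phi (node k) (node k.+1)) -/(m k); ring.
Qed.

Let interp_left k j s : (k <= j)%N -> s <= node k.+1 -> interp phi a h j s = interp phi a h k s.
Proof.
move=> /subnKC <-; elim: (j - k)%N => [|l IH] sk; first by rewrite addn0.
rewrite addnS interpS IH// max_l ?mulr0 ?addr0//.
by rewrite subr_le0 (le_trans sk)// node_le// ltnS leq_addr.
Qed.

(** Between consecutive nodes, the error is at most the jump of the slope times
    the step, and slopes are controlled by those of chords further out. *)
Lemma interp_error k j s : (0 < k <= j)%N -> node k <= s <= node k.+1 ->
  h <= 1 ->
  0 <= interp phi a h j s - phi s <=
    h * (slope phi (s + 1) (s + 2) - slope phi (s - 2) (s - 1)).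
Proof.
have h0' := h0; case: k => // k /andP[_ kj] /andP[ks sk] h1.
rewrite (interp_left kj sk) interp_right//.
have nk := nodeS k; have nk1 := nodeS k.+1.
have up : m k.+1 <= slope phi (s + 1) (s + 2) by apply: slope_le; lra.
have lo : slope phi (s - 2) (s - 1) <= m k by apply: slope_le; lra.
have mm := m_le k.
set M1 := slope phi (s + 1) (s + 2) in up *; set M0 := slope phi (s - 2) (s - 1) in lo *.
have [->|sk'] := eqVneq s (node k.+1).
  by rewrite subrr mulr0 addr0 subrr lexx/=; apply: mulr_ge0; [exact: ltW|lra].
have ks' : node k.+1 < s by rewrite lt_neqAle eq_sym sk'.
rewrite (slopeE phi (node k.+1) s).
set q := slope phi (node k.+1) s.
have q1 : q <= m k.+1 by apply: slope_le; lra.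
have q2 : m k <= q by apply: slope_le; lra.
have d0 : 0 <= s - node k.+1 by lra.
have dh : s - node k.+1 <= h by lra.
by apply/andP; split; nra.
Qed.

End interpolation.

(** Interpolation on the grid of step [1 / (N + 1)] in [-(N + 1), N + 1]. *)
Definition interp_seq phi (N : nat) : cvx R :=
  interp phi (- N.+1%:R) N.+1%:R^-1 (2 * N.+1 ^ 2).

Lemma interp_seq_cvg phi : cvx_cvg (interp_seq phi) phi.
Proof.
move=> s; set C := slope phi (s + 1) (s + 2) - slope phi (s - 2) (s - 1).
have harm : (fun N : nat => phi s + N.+1%:R^-1 * C) @ \oo --> phi s.
  rewrite -[X in _ --> X]addr0 -[X in _ --> _ + X](mul0r C).
  apply: cvgD; first exact: cvg_cst.
  by apply: cvgMl; exact: cvg_harmonic.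
apply: squeeze_cvgr harm; last exact: cvg_cst.
have [N0 _ HN0] := nbhs_infty_ger (`|s| + 1).
exists N0 => // N N0N.
have sN : `|s| + 1 <= N%:R := HN0 N N0N.
have n0 : 0 < N.+1%:R :> R by rewrite ltr0n.
pose h : R := N.+1%:R^-1.
have h0 : 0 < h by rewrite invr_gt0.
have hN : h * N.+1%:R = 1 by rewrite mulVf// gt_eqF.
have h1 : h <= 1 by rewrite invf_le1// ler1n.
have N1 : N.+1%:R = N%:R + 1 :> R by rewrite -natr1.
(* [k] is the index of the grid interval that contains [s] *)
pose z := (s + N.+1%:R) * N.+1%:R.
have z0 : 0 <= z.
  rewrite mulr_ge0// N1; have := ler_norm (- s); rewrite normrN; lra.
pose k := Num.truncn z.
have /andP[kz zk] := truncn_itv z0.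
rewrite -/k in kz zk.
have zE : z * h = s + N.+1%:R by rewrite /z mulrAC -mulrA hN mulr1.
have k1 : (0 < k)%N.
  rewrite truncn_gt0 /z N1.
  have := ler_norm (- s); rewrite normrN => h2.
  have h3 : 1 <= s + (N%:R + 1) by lra.
  have h4 : 1 <= N%:R + 1 :> R by rewrite lerDr.
  by nra.
have k2 : (k <= 2 * N.+1 ^ 2)%N.
  rewrite -(ler_nat R) (le_trans kz)// natrM natrX expr2 mulrA ler_wpM2r//.
  by have := ler_norm s; rewrite N1; lra.
have k12 : (0 < k <= 2 * N.+1 ^ 2)%N by rewrite k1 k2.
have ks : - N.+1%:R + k%:R * h <= s <= - N.+1%:R + k.+1%:R * h.
  have := ler_wpM2r (ltW h0) kz; have := ler_wpM2r (ltW h0) (ltW zk).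
  rewrite zE => ? ?; apply/andP; split; lra.
have /andP[e0 e1] := @interp_error phi (- N.+1%:R) h h0 k _ s k12 ks h1.
rewrite /interp_seq -/h -/C in e0 e1 *.
by apply/andP; split; lra.
Qed.

Lemma hinge_cvg p : cvx_cvg (fun j => hinge p (- j.+1%:R^-1)) (hinge p 0).
Proof.
move=> s; have low : (fun j : nat => hinge p 0 s - j.+1%:R^-1) @ \oo --> hinge p 0 s.
  rewrite -[X in _ --> X]subr0; apply: cvgB; [exact: cvg_cst|exact: cvg_harmonic].
apply: squeeze_cvgr low (cvg_cst _); apply: nearW => j.
have : 0 < j.+1%:R^-1 :> R by rewrite invr_gt0.
set d := j.+1%:R^-1; rewrite !hingeE addr0 /Num.max => d0.
by case: ltP => ?; case: ltP => ?; apply/andP; split; lra.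
Qed.

(** ** Determination of a functional by its values on hinges *)

Variables (E1 E2 : cvx R -> R).
Hypotheses (f1 : functional E1) (f2 : functional E2).
Let agree phi := E1 phi = E2 phi.

Let agree_ext phi psi : phi =1 psi -> agree phi -> agree psi.
Proof. by move=> e; rewrite /agree (functional_ext f1 e) (functional_ext f2 e). Qed.

Let agree_add phi psi : agree phi -> agree psi -> agree (cvx_add phi psi).
Proof. by rewrite /agree (functional_add f1) (functional_add f2) => -> ->. Qed.

Let agree_cancel phi psi (chi : cvx R) : (forall s, phi s + psi s = chi s) ->
  agree psi -> agree chi -> agree phi.
Proof.
move=> e; have e' : cvx_add phi psi =1 chi by [].
rewrite /agree -(functional_ext f1 e') -(functional_ext f2 e').
by rewrite (functional_add f1) (functional_add f2) => -> /addIr.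
Qed.

Let agree_scale a phi : agree phi -> agree (cvx_scale a phi).
Proof. by rewrite /agree (functional_scale f1) (functional_scale f2) => ->. Qed.

Let agree_cvg phis phi : cvx_cvg phis phi -> (forall j, agree (phis j)) -> agree phi.
Proof.
move=> c H; have := functional_cvg f1 c; under eq_fun do rewrite H.
move=> H1; exact: (cvg_unique _ H1 (functional_cvg f2 c)).
Qed.

Hypothesis agree_const : E1 (affine 1 0) = E2 (affine 1 0).
Hypothesis agree_hinge : forall t, E1 (hinge t (-1)) = E2 (hinge t (-1)).

Let agree_affine0 b : agree (affine b 0).
Proof.
have pos b' : 0 <= b' -> agree (affine b' 0).
  move=> b0; apply: agree_ext (agree_scale b' agree_const) => s /=.
  by rewrite ger0_norm// !mul0r !addr0 mulr1.
have [/pos//|b0] := leP 0 b.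
have nb : 0 <= - b by rewrite oppr_ge0 ltW.
apply: agree_cancel (pos _ nb) (pos 0 (lexx _)) => s /=; lra.
Qed.

Let agree_hinge_neg p q : q < 0 -> agree (hinge p q).
Proof.
move=> q0; apply: agree_ext (agree_scale (- q) (agree_hinge (p / - q))) => s.
have nq : 0 < - q by rewrite oppr_gt0.
rewrite [LHS](_ : _ = `|- q| * hinge (p / - q) (-1) s)// !hingeE gtr0_norm//.
by rewrite maxr_pMr ?ltW// mulr0; congr Num.max; field; rewrite lt_eqF.
Qed.

Let agree_hinge0 p : agree (hinge p 0).
Proof.
apply: (agree_cvg (hinge_cvg (p := p))) => j; apply: agree_hinge_neg.
by rewrite oppr_lt0 invr_gt0.
Qed.

Let agree_linear p : agree (affine 0 p).
Proof.
apply: agree_cancel (agree_hinge0 (- p)) (agree_hinge0 p) => s.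
rewrite !hingeE /= add0r !addr0 mulNr.
by rewrite /Num.max; case: ltP => ?; case: ltP => ?; lra.
Qed.

Let agree_affine q p : agree (affine q p).
Proof.
by apply: agree_ext (agree_add (agree_affine0 q) (agree_linear p)) => s /=; ring.
Qed.

Let agree_hinges p q : agree (hinge p q).
Proof.
have [q0|] := ltP q 0; first exact: agree_hinge_neg.
rewrite le_eqVlt => /predU1P[<-|q0]; first exact: agree_hinge0.
have nq : - q < 0 by rewrite oppr_lt0.
apply: agree_ext (agree_add (agree_affine q p) (agree_hinge_neg (- p) nq)) => s.
rewrite [LHS](_ : _ = affine q p s + hinge (- p) (- q) s)// !hingeE /= mulNr.
by rewrite /Num.max; case: ltP => ?; case: ltP => ?; lra.
Qed.

Lemma functional_unique phi : E1 phi = E2 phi.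
Proof.
apply: (agree_cvg (interp_seq_cvg (phi := phi))) => N; rewrite /interp_seq.
elim: (2 * _)%N => [|k IH]; first exact: agree_affine.
by apply: agree_add => //; apply: agree_scale; exact: agree_hinges.
Qed.

End functional.

(** * The measure of a convex function *)

Section density.
Context d (T : measurableType d) (R : realType).
Variables (mu : {sigma_finite_measure set T -> \bar R}) (eta : {finite_measure set T -> \bar R}).
Variable w : T -> \bar R.
Hypotheses (mw : measurable_fun setT w) (w0 : forall x, (0 <= w x)%E).
Hypothesis etaE : forall A, measurable A -> eta A = (\int[mu]_(x in A) w x)%E.

(** Integration against a density: by uniqueness, it is the Radon-Nikodym
    derivative. *)
Lemma integral_density (f : T -> \bar R) D : (forall x, (0 <= f x)%E) ->
  measurable D -> measurable_fun D f ->
  (\int[eta]_(x in D) f x = \int[mu]_(x in D) (f x * w x))%E.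
Proof.
move=> f0 mD mf.
have dom : eta `<< mu.
  apply/null_content_dominatesP => A mA A0; rewrite etaE//.
  by apply: null_set_integral => //; exact: measurable_funTS.
rewrite -(Radon_Nikodym_SigmaFinite.change_of_variables dom)//.
have rn := Radon_Nikodym_SigmaFinite.f_integrable dom.
have ae : ae_eq mu setT (Radon_Nikodym_SigmaFinite.f eta mu) w.
  apply: integral_ae_eq => // A _ mA.
  by rewrite -etaE// -(Radon_Nikodym_SigmaFinite.f_integral dom).
have mrn : measurable_fun D (Radon_Nikodym_SigmaFinite.f eta mu).
  by apply: measurable_funTS; exact: measurable_int rn.
apply: ae_eq_integral => //.
- exact: emeasurable_funM.
- by apply: emeasurable_funM => //; exact: measurable_funTS.
by apply: (@filterS _ _ (ae_filter_ringOfSetsType mu)) ae => x /= H _; rewrite H.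
Qed.

End density.

Section right_slope.
Variables (R : realType) (k : cvx R) (B : R).
Hypothesis kB : forall u v, u < v -> `|slope k u v| <= B.

Let slopes t := [set r : R | exists u v, [/\ t < u, u < v & r = slope k u v]].

(** The right derivative of [k], as an infimum of slopes of chords lying
    strictly to the right: in this form right-continuity is immediate. *)
Definition right_slope t := inf (slopes t).

Let slopes_has_inf t : has_inf (slopes t).
Proof.
split; first by exists (slope k (t + 1) (t + 2)), (t + 1), (t + 2); split => //; lra.
exists (- B) => _ [u [v [_ uv ->]]]; have := kB uv; rewrite ler_norml => /andP[+ _].
by [].
Qed.

Lemma right_slope_le t u v : t < u -> u < v -> right_slope t <= slope k u v.
Proof.
by move=> tu uv; apply: ge_inf; [exact: (slopes_has_inf t).2|exists u, v].
Qed.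

Lemma le_right_slope t r : (forall u v, t < u -> u < v -> r <= slope k u v) ->
  r <= right_slope t.
Proof.
move=> H; apply: lb_le_inf; first exact: (slopes_has_inf t).1.
by move=> _ [u [v [tu uv ->]]]; exact: H.
Qed.

Lemma right_slope_nd : nondecreasing right_slope.
Proof.
move=> s t st; apply: le_right_slope => u v tu; apply: right_slope_le.
exact: le_lt_trans tu.
Qed.

Lemma right_slope_rc : right_continuous right_slope.
Proof.
move=> t; apply/cvgrPdist_lt => e e0.
have [_ [u [v [tu uv ->]]] H] := inf_adherent e0 (slopes_has_inf t).
near=> x.
have tx : t < x by near: x; exact: nbhs_right_gt.
have xu : x < u by near: x; exact: nbhs_right_lt.
have h1 := right_slope_nd (ltW tx); have h2 := right_slope_le xu uv.
by rewrite ltr_norml; apply/andP; rewrite -/(right_slope t) in H; split; lra.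
Unshelve. all: by end_near. Qed.

Lemma right_slope_bound t : `|right_slope t| <= B.
Proof.
have h : t < t + 1 by lra.
have h' : t + 1 < t + 2 by lra.
rewrite ler_norml; apply/andP; split.
  apply: le_right_slope => u v _ /kB; rewrite ler_norml => /andP[+ _]; by [].
apply: le_trans (right_slope_le h h') _.
by have := kB h'; rewrite ler_norml => /andP[_].
Qed.

Lemma right_slope_ge s t : s < t -> k t - k s <= (t - s) * right_slope t.
Proof.
move=> st; have d0 : 0 < t - s by rewrite subr_gt0.
have : slope k s t <= right_slope t.
  by apply: le_right_slope => u v tu uv; apply: slope_le => //; lra.
by rewrite /slope ler_pdivrMr// mulrC.
Qed.

Lemma right_slope_le_diff s t : s < t -> (t - s) * right_slope s <= k t - k s.
Proof.
move=> st; rewrite leNgt; apply/negP => H.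
have B0 : 0 <= B by apply: le_trans (right_slope_bound 0).
pose e := (t - s) * right_slope s - (k t - k s).
have e0 : 0 < e by rewrite subr_gt0.
pose eps := Num.min ((t - s) / 2) (e / (4 * (B + 1))).
have eps0 : 0 < eps by rewrite lt_min !divr_gt0 ?subr_gt0// ?mulr_gt0//; lra.
have eps1 : eps <= (t - s) / 2 by rewrite ge_min lexx.
have eps2 : eps * (4 * (B + 1)) <= e.
  by rewrite -ler_pdivlMr ?ge_min ?lexx ?orbT// mulr_gt0//; lra.
have su : s < s + eps by lra.
have ut : s + eps < t by lra.
have := right_slope_le su ut.
rewrite /slope ler_pdivlMr ?subr_gt0// => h1.
have := kB su; rewrite /slope ler_norml => /andP[h2 _].
rewrite ler_pdivlMr ?subr_gt0// in h2.
have := right_slope_bound s; rewrite ler_norml => /andP[h3 h4].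
rewrite /e in eps2; nra.
Qed.

Lemma right_slope_flat (a b t : R) : (forall s, a <= s <= b -> k s = 0) ->
  a <= t < b -> right_slope t = 0.
Proof.
move=> k0 /andP[at_ tb].
have flat u v : a <= u -> u < v -> v <= b -> slope k u v = 0.
  move=> au uv vb; rewrite /slope !k0 ?subrr ?mul0r//; apply/andP; split=> //; lra.
apply/eqP; rewrite eq_le; apply/andP; split.
  have h : t < (t + b) / 2 by lra.
  have h' : (t + b) / 2 < b by lra.
  by apply: le_trans (right_slope_le h h') _; rewrite flat//; lra.
apply: le_right_slope => u v tu uv.
have h : t < Num.min u b by rewrite lt_min tu.
rewrite -(@flat t (Num.min u b))// ?ge_min ?lexx ?orbT//.
apply: slope_le => //; first exact: ltW.
by rewrite ge_min ltW.
Qed.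

End right_slope.

(** Over a subdivision in [N] equal parts the bounds add up to
    [(b - a) / N * (m b - m a)], for every [N]. *)
Lemma constant_of_increments (R : realType) (D m : R -> R) (a b : R) : a <= b ->
  (forall s t, s < t -> `|D t - D s| <= (t - s) * (m t - m s)) -> D a = D b.
Proof.
rewrite le_eqVlt => /predU1P[->//|ab] H.
have sub N : `|D b - D a| * N.+1%:R <= (b - a) * (m b - m a).
  pose h := (b - a) / N.+1%:R.
  have n0 : 0 < N.+1%:R :> R by rewrite ltr0n.
  have h0 : 0 < h by rewrite divr_gt0// subr_gt0.
  pose x j := a + j%:R * h.
  have xS j : x j.+1 = x j + h by rewrite /x -natr1; ring.
  have step j : `|D (x j) - D a| <= h * (m (x j) - m a).
    elim: j => [|j IH]; first by rewrite /x mul0r addr0 !subrr normr0 mulr0.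
    have lt : x j < x j.+1 by rewrite xS ltrDl.
    have := H _ _ lt; rewrite {2}xS addrAC subrr add0r => Hj.
    have := ler_normD (D (x j.+1) - D (x j)) (D (x j) - D a).
    rewrite subrKA; lra.
  have xN : x N.+1 = b by rewrite /x /h mulrC divfK ?gt_eqF// addrC subrK.
  have := ler_wpM2r (ltW n0) (step N.+1); rewrite xN.
  by rewrite mulrAC /h divfK// gt_eqF.
apply/eqP; rewrite eq_sym -subr_eq0 -normr_le0 leNgt; apply/negP => d0.
set M := (b - a) * (m b - m a) in sub.
have := sub (Num.bound (M / `|D b - D a|)).
apply/negP; rewrite -ltNge mulrC -ltr_pdivrMr//.
apply: (@lt_le_trans _ _ (Num.bound (M / `|D b - D a|))%:R); last by rewrite ler_nat.
by apply: archi_boundP; rewrite divr_ge0//; apply: le_trans (sub 0%N); rewrite mulr_ge0.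
Qed.

Section measure_of_convex.
Variables (R : realType) (k : cvx R) (B delta : R).
Hypothesis kB : forall u v, u < v -> `|slope k u v| <= B.
Hypothesis delta0 : 0 < delta.
Hypothesis k0 : forall t, `|t| <= 2 * delta -> k t = 0.

Local Notation m := (right_slope k).

(** The second derivative of [k], as a Stieltjes measure. *)
Definition slope_cumulative : cumulative R R :=
  HB.pack m (isCumulative.Build R _ R m (right_slope_nd kB) (right_slope_rc kB)).

Definition kappa : {sigma_finite_measure set (measurableTypeR R) -> \bar R} :=
  lebesgue_stieltjes_measure slope_cumulative.

Lemma kappa_itv (a b : R) : a <= b -> kappa `]a, b]%classic = (m b - m a)%:E.
Proof.
move=> ab; rewrite /kappa /= /lebesgue_stieltjes_measure /measure_extension.
by rewrite measurable_mu_extE/=; [rewrite wlength_itv_bnd|exact: is_ocitv].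
Qed.

Let kappa_le (X Y : set (measurableTypeR R)) : measurable X -> measurable Y ->
  X `<=` Y -> (kappa X <= kappa Y)%E.
Proof. by move=> mX mY XY; apply: le_measure => //; rewrite inE. Qed.

Lemma kappa_finite : (kappa setT < +oo)%E.
Proof.
have B0 : 0 <= B by apply: le_trans (right_slope_bound kB 0).
apply: (@le_lt_trans _ _ (2 * B)%:E); last by rewrite ltry.
rewrite -(bigcup_itvT false false).
pose I n : set (measurableTypeR R) := `]- (n%:R), n%:R]%classic.
have : (kappa \o I) n @[n --> \oo] --> kappa (\bigcup_n I n).
  apply: nondecreasing_cvg_mu; rewrite /I//; first exact: bigcup_measurable.
  by move=> *; apply/subsetPset/subset_itv; rewrite leBSide/= ?lerN2 ler_nat.
move=> /cvg_lim <-//; apply: lime_le.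
  apply: ereal_nondecreasing_is_cvgn => a b ab; apply: kappa_le => [||x].
  - exact: measurable_itv.
  - exact: measurable_itv.
  have abR : a%:R <= b%:R :> R by rewrite ler_nat.
  by rewrite /I /= !in_itv/= => /andP[h1 h2]; apply/andP; split; lra.
apply: nearW => n; rewrite /= /I kappa_itv ?lee_fin ?ge0_cp//.
have := right_slope_bound kB n%:R; have := right_slope_bound kB (- n%:R).
by rewrite !ler_norml => /andP[? ?] /andP[? ?]; lra.
Qed.

Let bounded_integrable (f : R -> R) (M : R) : measurable_fun setT f ->
  (forall x, `|f x| <= M) -> kappa.-integrable setT (EFin \o f).
Proof.
move=> mf fM; apply: measurable_bounded_integrable => //; first exact: kappa_finite.
by exists M; split; [exact: num_real|move=> x Mx y _; exact: le_trans (fM y) (ltW Mx)].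
Qed.

(** The kernel of the second order Taylor formula at [0]. *)
Definition taylor (t x : R) : R := Num.max 0 (t - x) * (\1_(`]0, +oo[%classic : set R) x)
  + Num.max 0 (x - t) * (\1_(`]-oo, 0]%classic : set R) x).

Let ind (s x : R) : R := \1_(`]-oo, s]%classic : set R) x.

Let indE s x : ind s x = (x <= s)%R%:R.
Proof. by rewrite /ind indicE mem_setE in_itv. Qed.

Lemma taylorE t x : taylor t x = if 0 < x then Num.max 0 (t - x) else Num.max 0 (x - t).
Proof.
rewrite /taylor !indicE !mem_setE !in_itv/= andbT.
by case: ltP => _; rewrite ?mulr1 ?mulr0 ?addr0 ?add0r.
Qed.

Let m_ind s : measurable_fun setT (ind s).
Proof. exact: measurable_indic. Qed.

Lemma measurable_taylor t : measurable_fun setT (taylor t).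
Proof.
apply: measurable_funD; apply: measurable_funM; try exact: measurable_indic.
- by apply: measurable_maxr => //; apply: measurable_funB.
- by apply: measurable_maxr => //; apply: measurable_funB.
Qed.

Let int_ind s : kappa.-integrable setT (EFin \o ind s).
Proof. by apply: (@bounded_integrable _ 1) => // x; rewrite indE; case: (x <= s); rewrite ?normr1 ?normr0. Qed.

Let int_taylor t : kappa.-integrable setT (EFin \o taylor t).
Proof.
apply: (@bounded_integrable _ `|t|); first exact: measurable_taylor.
move=> x; rewrite taylorE; have := ler_norm t; have := ler_norm (- t); rewrite normrN.
case: ltP => x0 h1 h2; rewrite ger0_norm ?le_max ?lexx// ge_max normr_ge0/=; lra.
Qed.

Let Iind s t : s <= t -> \int[kappa]_x ind t x - \int[kappa]_x ind s x = m t - m s.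
Proof.
move=> st.
have E u : \int[kappa]_x ind u x = fine (kappa `]-oo, u]%classic).
  by rewrite /Rintegral integral_indic// setIT.
have fin u : kappa `]-oo, u]%classic \is a fin_num.
  rewrite ge0_fin_numE//; apply: le_lt_trans kappa_finite.
  by apply: kappa_le.
rewrite !E.
have -> : `]-oo, t]%classic = `]-oo, s]%classic `|` `]s, t]%classic :> set R.
  apply/seteqP; split => x /=; rewrite !in_itv/=.
    by move=> xt; case: (leP x s) => xs; [left|right].
  by case=> [xs|/andP[]//]; exact: le_trans st.
have -> : (kappa (`]-oo, s]%classic `|` `]s, t]%classic : set R) =
    kappa (`]-oo, s]%classic : set R) + (m t - m s)%:E)%E.
  rewrite -(kappa_itv st) -measureU//.
  apply/seteqP; split => x //=; rewrite !in_itv/= => -[xs /andP[sx _]].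
  by move: sx; rewrite ltNge xs.
rewrite fineD; [|exact: fin|by []].
by rewrite addrC addKr.
Qed.

Let flat s : - (2 * delta) <= s < 2 * delta -> m s = 0.
Proof.
move=> H; apply: (right_slope_flat kB _ H) => t /andP[t1 t2]; apply: k0.
by rewrite ler_norml t1 t2.
Qed.

Let K (t : R) : R := \int[kappa]_x taylor t x.

(** The increments of [K] lie between the same bounds as those of [k], so that
    [K - k] has increments to which [constant_of_increments] applies. *)
Let K_incr s t : s < t -> (t - s) * m s <= K t - K s <= (t - s) * m t.
Proof.
move=> st; have d0 : 0 < t - s by rewrite subr_gt0.
have m00 : m 0 = 0 by apply: flat; have := delta0; lra.
have Kst : K t - K s = \int[kappa]_x (taylor t x - taylor s x) by rewrite RintegralB.
(* integral of the indicator difference, whatever the sign of [u] *)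
have Im u : \int[kappa]_x (ind u x - ind 0 x) = m u.
  rewrite RintegralB//; have [u0|u0] := leP 0 u; first by rewrite Iind// m00 subr0.
  by have := Iind (ltW u0); rewrite m00; lra.
have intB u : kappa.-integrable setT (EFin \o (fun x => (t - s) * (ind u x - ind 0 x))).
  apply: (@bounded_integrable _ ((t - s) * 2)).
    by apply: measurable_funM => //; apply: measurable_funB.
  move=> x; rewrite normrM gtr0_norm// ler_pM2l// !indE.
  by case: (x <= u); case: (x <= 0); rewrite ?subrr ?subr0 ?sub0r ?normrN ?normr1 ?normr0//; lra.
have intD : kappa.-integrable setT (EFin \o (fun x => taylor t x - taylor s x)).
  apply: (@bounded_integrable _ (`|t| + `|s|)).
    by apply: measurable_funB; exact: measurable_taylor.
  move=> x; apply: le_trans (ler_normB _ _) _; rewrite !taylorE.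
  have := ler_norm t; have := ler_norm (- t); rewrite normrN.
  have := ler_norm s; have := ler_norm (- s); rewrite normrN.
  case: ltP => x0 h1 h2 h3 h4; apply: lerD; rewrite ger0_norm ?le_max ?lexx// ge_max normr_ge0/=; lra.
have mE u : (t - s) * m u = \int[kappa]_x ((t - s) * (ind u x - ind 0 x)).
  rewrite RintegralZl ?Im//.
  apply: (@bounded_integrable _ 2); first exact: measurable_funB.
  move=> x; rewrite !indE.
  by case: (x <= u); case: (x <= 0); rewrite ?subrr ?subr0 ?sub0r ?normrN ?normr1 ?normr0//; lra.
rewrite Kst !mE; apply/andP; split; apply: le_Rintegral => // x _;
  rewrite !taylorE !indE /Num.max.
- have [x0|x0] := ltP 0 x.
    by case: (ltP 0 (t - x)) => ?; case: (ltP 0 (s - x)) => ?; case: (leP x s) => ?; rewrite /= ?mulr1n ?mulr0n; lra.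
  by case: (ltP 0 (x - t)) => ?; case: (ltP 0 (x - s)) => ?; case: (leP x s) => ?; rewrite /= ?mulr1n ?mulr0n; lra.
- have [x0|x0] := ltP 0 x.
    by case: (ltP 0 (t - x)) => ?; case: (ltP 0 (s - x)) => ?; case: (leP x t) => ?; rewrite /= ?mulr1n ?mulr0n; lra.
  by case: (ltP 0 (x - t)) => ?; case: (ltP 0 (x - s)) => ?; case: (leP x t) => ?; rewrite /= ?mulr1n ?mulr0n; lra.
Qed.

Let KE t : K t = k t.
Proof.
have K00 : K 0 = 0.
  have t0 x : taylor 0 x = 0.
    rewrite taylorE sub0r subr0; have [x0|x0] := ltP 0 x; last by rewrite ?max_l.
    by rewrite max_l// oppr_le0 ltW.
  by rewrite /K (_ : taylor 0 = cst 0) ?Rintegral_cst ?mul0r//; apply/funext.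
have k00 : k 0 = 0 by apply: k0; rewrite normr0; have := delta0; lra.
have incr s u : s < u -> `|(K u - k u) - (K s - k s)| <= (u - s) * (m u - m s).
  move=> su; have /andP[h1 h2] := K_incr su.
  have h3 := right_slope_ge kB su; have h4 := right_slope_le_diff kB su.
  by rewrite ler_norml; apply/andP; split; lra.
have [t0|t0] := leP 0 t.
  by have := constant_of_increments t0 incr; rewrite K00 k00; lra.
by have := constant_of_increments (ltW t0) incr; rewrite K00 k00; lra.
Qed.

Lemma integral_taylor t : (\int[kappa]_x (taylor t x)%:E = (k t)%:E)%E.
Proof.
rewrite -KE /K /Rintegral fineK//.
exact: (integrable_fin_num measurableT (int_taylor t)).
Qed.

Lemma kappa_small : kappa [set x : R | `|x| < delta] = 0%E.
Proof.
have d0 := delta0.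
apply/eqP; rewrite eq_le measure_ge0 andbT.
have -> : 0%E = kappa `]- (2 * delta), delta]%classic.
  by rewrite kappa_itv ?flat ?subrr//; lra.
apply: kappa_le => //.
  by apply: open_measurable; exact: open_norm_lt.
by move=> x /=; rewrite in_itv/= ltr_norml => /andP[? ?]; apply/andP; split; lra.
Qed.

End measure_of_convex.

Section representing_measure.
Variables (R : realType) (k : cvx R) (B delta : R).
Hypothesis kB : forall u v, u < v -> `|slope k u v| <= B.
Hypothesis delta0 : 0 < delta.
Hypothesis k0 : forall t, `|t| <= 2 * delta -> k t = 0.
Local Notation kappa := (kappa kB).

(** The change of variables [s = 1 / tau], truncated near [0], where [kappa]
    has no mass, so as to remain bounded. *)
Definition weight (x : measurableTypeR R) : R := `|Num.max `|x| delta|^-1.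
Definition invert (x : measurableTypeR R) : measurableTypeR R := (x : R) * weight x ^+ 2.

Let max0 (x : R) : 0 < Num.max `|x| delta.
Proof. by rewrite lt_max delta0 orbT. Qed.

Let weight_ge0 x : 0 <= weight x. Proof. by rewrite /weight invr_ge0. Qed.

Let weight_le x : weight x <= delta^-1.
Proof. by rewrite /weight gtr0_norm// lef_pV2 ?posrE// le_max lexx orbT. Qed.

Let weightE (x : R) : delta <= `|x| -> weight x = `|x|^-1.
Proof. by move=> dx; rewrite /weight max_l// normr_id. Qed.

Let invertE (x : R) : delta <= `|x| -> invert x = x^-1.
Proof.
move=> dx; rewrite /invert weightE// exprVn real_normK ?num_real// expr2 invfM.
have x0 : x != 0 by rewrite -normr_gt0; apply: lt_le_trans dx.
by rewrite mulrA mulfV// mul1r.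
Qed.

Let mweight : measurable_fun setT weight.
Proof.
apply: (@measurable_comp _ _ _ _ _ _ (@Rtimes R) (fun y : R => `|y|^-1) _
  (fun x : R => Num.max `|x| delta)).
- exact: measurable_Rtimes.
- by move=> _ [x _ <-]; rewrite /Rtimes /= gt_eqF.
- exact: measurable_inv_norm.
- by apply: measurable_maxr; [exact: normr_measurable|exact: measurable_cst].
Qed.

Let minvert : measurable_fun setT invert.
Proof. by apply: measurable_funM => //; exact: measurable_funX. Qed.

Let int_weight : kappa.-integrable setT (EFin \o weight).
Proof.
apply: measurable_bounded_integrable => //; first exact: kappa_finite.
exists delta^-1; split; [exact: num_real|move=> M dM x _].
by rewrite /= ger0_norm//; apply: le_trans (weight_le x) (ltW dM).
Qed.

Definition weighted (A : set (measurableTypeR R)) : \bar R :=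
  (\int[kappa]_(x in A) (weight x)%:E)%E.

Let weighted0 : weighted set0 = 0%E. Proof. exact: integral_set0. Qed.

Let weighted_ge0 A : (0 <= weighted A)%E.
Proof. by apply: integral_ge0 => x _; rewrite lee_fin. Qed.

Let weighted_sigma : semi_sigma_additive weighted.
Proof.
move=> F mF tF mUF; rewrite /weighted integral_bigcup//=; last first.
  exact: (integrableS _ _ (@subsetT _ _) int_weight).
apply: is_cvg_ereal_nneg_natsum_cond => j _ _; exact: weighted_ge0.
Qed.

HB.instance Definition _ := isMeasure.Build _ _ _ weighted weighted0 weighted_ge0 weighted_sigma.

Let weighted_fin : fin_num_fun weighted.
Proof.
move=> A mA; apply: (integrable_fin_num mA).
exact: (integrableS _ _ (@subsetT _ _) int_weight).
Qed.

HB.instance Definition _ := Measure_isFinite.Build _ _ _ weighted weighted_fin.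

Definition inverted : set (measurableTypeR R) -> \bar R := pushforward weighted invert.

Let inverted0 : inverted set0 = 0%E.
Proof. by rewrite /inverted /pushforward preimage_set0 measure0. Qed.

Let inverted_ge0 A : (0 <= inverted A)%E. Proof. exact: weighted_ge0. Qed.

Let inverted_sigma : semi_sigma_additive inverted.
Proof.
exact: (@measure_semi_sigma_additive _ _ _
  (measure_function_pushforward__canonical__measure_function_Measure weighted minvert)).
Qed.

HB.instance Definition _ := isMeasure.Build _ _ _ inverted inverted0 inverted_ge0 inverted_sigma.

Let inverted_fin : fin_num_fun inverted.
Proof. by move=> A mA; apply: weighted_fin; rewrite -[X in measurable X]setTI; exact: minvert. Qed.

HB.instance Definition _ := Measure_isFinite.Build _ _ _ inverted inverted_fin.

Let small : set (measurableTypeR R) := [set x : R | `|x| < delta].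

Let msmall : measurable small.
Proof.
by apply: open_measurable; exact: open_norm_lt.
Qed.

Let kappa_null : kappa small = 0%E. Proof. exact: kappa_small kB delta0 k0. Qed.

Let invert_Rtimes : invert @^-1` (@Rtimes R) `\` small = ~` small.
Proof.
apply/seteqP; split => x /= => [[]//|dx]; split=> //.
have {}dx : delta <= `|x : R| by rewrite leNgt; apply/negP.
by rewrite invertE// /Rtimes /= invr_eq0 -normr_gt0; apply: lt_le_trans dx.
Qed.

Let integral_inverted (f : R -> R) (h : R -> R) : (forall s, 0 <= f s) ->
  measurable_fun (@Rtimes R) f -> measurable_fun setT h ->
  (forall x, delta <= `|x| -> f x^-1 * `|x|^-1 = h x) ->
  (\int[inverted]_(s in @Rtimes R) (f s)%:E = \int[kappa]_x (h x)%:E)%E.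
Proof.
move=> f0 mf mh fh.
have mR := @measurable_Rtimes R.
have mpre : measurable (invert @^-1` (@Rtimes R)).
  by rewrite -[X in measurable X]setTI; exact: minvert.
have mfE : measurable_fun (@Rtimes R) (EFin \o f) by apply/measurable_EFinP.
have mfi : measurable_fun (invert @^-1` (@Rtimes R)) ((EFin \o f) \o invert).
  apply: (measurable_comp mR) => //; first by move=> _ [x ? <-].
  exact: measurable_funTS.
rewrite (ge0_integral_pushforward minvert weighted mR mfE); last first.
  by move=> s _; rewrite lee_fin.
rewrite (@integral_density _ _ _ kappa weighted (EFin \o weight))//; last first.
- by move=> x; rewrite /= lee_fin.
- exact/measurable_EFinP.
rewrite (integral_null mpre msmall)//; last first.
  apply: emeasurable_funM => //; apply: measurable_funTS; exact/measurable_EFinP.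
rewrite invert_Rtimes [RHS](integral_null measurableT msmall)//; last first.
  exact/measurable_EFinP.
rewrite setTD; apply: eq_integral => x /[!inE] dx.
have {}dx : delta <= `|x : R| by rewrite leNgt; apply/negP.
by rewrite -EFinM invertE// weightE// fh.
Qed.

Lemma inverted_support : inverted [set s : R | delta^-1 < `|s|] = 0%E.
Proof.
have mS : measurable ([set s : R | delta^-1 < `|s|] : set (measurableTypeR R)).
  by apply: open_measurable; exact: open_norm_gt.
rewrite /inverted /pushforward /weighted; apply: null_set_integral => //.
- by rewrite -[X in measurable X]setTI; exact: minvert.
- by apply: measurable_funTS; exact/measurable_EFinP.
apply: (@subset_measure0 _ _ _ kappa _ small) => //.
- by rewrite -[X in measurable X]setTI; exact: minvert.
move=> x /=; rewrite ltNge => H; rewrite /small /= ltNge; apply: contra H => dx.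
rewrite invertE// normfV lef_pV2 ?posrE//; exact: lt_le_trans dx.
Qed.

Lemma inverted_inv_norm : (\int[inverted]_(s in @Rtimes R) (`|s : R|^-1)%:E < +oo)%E.
Proof.
rewrite (@integral_inverted (fun s => `|s|^-1) (cst 1)) //.
- have -> : (\int[kappa]_x (cst (1 : R) x)%:E = \int[kappa]_x cst 1 x)%E by [].
  by rewrite integral_cst// mul1e; exact: kappa_finite.
- exact: measurable_inv_norm.
- move=> x dx; rewrite normfV invrK mulfV// gt_eqF//; exact: lt_le_trans dx.
Qed.

Lemma inverted_hinge t :
  (\int[inverted]_(s in @Rtimes R) (hinge t (-1) s * `|s : R| ^- 2)%:E = (k t)%:E)%E.
Proof.
rewrite -(integral_taylor kB delta0 k0).
apply: integral_inverted.
- by move=> s; rewrite mulr_ge0// hingeE le_max lexx.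
- apply: measurable_funM; last by apply/measurable_EFinP; exact: measurable_inv_sqr.
  rewrite (_ : (hinge t (-1) : R -> R) = (fun s => Num.max 0 (t * s - 1))); last first.
    by apply/funext => s; rewrite hingeE.
  apply: measurable_maxr; first exact: measurable_cst.
  apply: measurable_funB; last exact: measurable_cst.
  by apply: measurable_funM => //; exact: measurable_cst.
- exact: measurable_taylor.
move=> x dx; have x0 : 0 < `|x| by exact: lt_le_trans dx.
have xn : x != 0 by rewrite -normr_gt0.
rewrite hingeE taylorE normfV exprVn invrK -mulrA.
have -> : `|x| ^+ 2 * `|x|^-1 = `|x| by rewrite expr2 mulfK ?gt_eqF.
rewrite mulrC maxr_pMr// mulr0; case: ltP => xs.
  by rewrite gtr0_norm//; congr Num.max; field.
have xs' : x < 0 by rewrite lt_neqAle xn.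
by rewrite ltr0_norm//; congr Num.max; field.
Qed.

(** The Taylor formula writes [k] as a superposition of the kernels
    [taylor t tau]; under [s = 1 / tau] these are hinges [(t * s - 1)_+] up to the
    factor [|s|], which the weights absorb. *)
Lemma representing_measure : exists nu : {finite_measure set (measurableTypeR R) -> \bar R},
  [/\ nu [set s : R | delta^-1 < `|s|] = 0%E,
      (\int[nu]_(s in @Rtimes R) (`|s : R|^-1)%:E < +oo)%E &
      forall t, (\int[nu]_(s in @Rtimes R) (hinge t (-1) s * `|s : R| ^- 2)%:E =
        (k t)%:E)%E].
Proof.
exists (inverted : {finite_measure set _ -> \bar R}).
by split; [exact: inverted_support|exact: inverted_inv_norm|exact: inverted_hinge].
Qed.

End representing_measure.

(** * From an operator to a functional *)

Section operator.
Variables (R : realType) (n : nat) (i : 'I_n) (Psi : Conv0 R n -> Conv0 R n).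
Hypotheses (cPsi : continuous Psi) (aPsi : conv0_additive Psi) (ePsi : GL_equivariant Psi).
Implicit Types (f g : Conv0 R n) (x y : 'cV[R]_n) (phi psi : cvx R) (a b s t : R).
Local Notation e := (basis R i).
Local Notation zero := (ridge i (affine 0 0)).

Lemma conv0_act_inv (A A' : 'M[R]_n) f x : A *m A' = 1%:M ->
  conv0_act A f x = f (A' *m x).
Proof.
move=> AA; have [uA _] := mulmx1_unit AA.
by rewrite /=; congr (f (_ *m x)); rewrite -[LHS]mulmx1 -AA mulKmx.
Qed.

Lemma operator_act (A A' : 'M[R]_n) f g x : A *m A' = 1%:M ->
  (forall x, g x = f (A' *m x)) -> Psi g x = Psi f (A' *m x).
Proof.
move=> AA gf; have [uA _] := mulmx1_unit AA.
have -> : g = conv0_act A f.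
  by apply: conv0_ext; apply/funext => y; rewrite (conv0_act_inv _ _ AA).
by rewrite ePsi// (conv0_act_inv _ _ AA).
Qed.

Lemma operator_scale f g t x : t != 0 -> (forall x, g x = f (t *: x)) ->
  Psi g x = Psi f (t *: x).
Proof.
move=> t0 gf; rewrite -mul_scalar_mx; apply: (@operator_act t^-1%:M).
  by rewrite -scalar_mxM mulVf.
by move=> y; rewrite mul_scalar_mx.
Qed.

Lemma ridge_ext phi psi : phi =1 psi -> ridge i phi = ridge i psi.
Proof. by move=> e'; apply: conv0_ext; apply/funext => x; rewrite !ridgeE e'. Qed.

Lemma ridge_add phi psi : ridge i (cvx_add phi psi) = conv0_add (ridge i phi) (ridge i psi).
Proof. by apply: conv0_ext; apply/funext => x; rewrite ridgeE /= EFinD. Qed.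

Lemma ridge_cvg phis phi : cvx_cvg phis phi -> epi_cvg (fun j => ridge i (phis j)) (ridge i phi).
Proof.
move=> c; apply: pointwise_epi_cvg => // [j|x]; first exact: conv_convex.
by apply/cvg_EFin; [exact: nearW|exact: c].
Qed.

(** [Psi 0] solves [u + u = u], and is finite near the origin; by homogeneity it
    vanishes. *)
Lemma operator0 x : Psi zero x = 0%E.
Proof.
have dbl y : (Psi zero y + Psi zero y = Psi zero y)%E.
  rewrite -[LHS]/(conv0_add (Psi zero) (Psi zero) y) -aPsi -ridge_add.
  by congr (Psi _ y); apply: ridge_ext => s /=; lra.
have fin0 y : Psi zero y \is a fin_num -> Psi zero y = 0%E.
  move=> fy; have := dbl y; rewrite -(fineK fy) -EFinD => -[H]; congr EFin; lra.
have [t t0 fx] : exists2 t, t != 0 & Psi zero (t *: x) \is a fin_num.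
  have H : \forall y \near (0 : R) *: x, Psi zero y \is a fin_num.
    by rewrite scale0r; exact: conv0_fin.
  have := @scalel_continuous _ _ x (0 : R) _ H => /nbhs_ballP[r /= r0 Hr].
  exists (r / 2); first by rewrite gt_eqF// divr_gt0.
  apply: Hr; rewrite -ball_normE /ball_/= sub0r normrN gtr0_norm ?divr_gt0//; lra.
have zt y : zero y = zero (t *: y) by rewrite !ridgeE /= !mul0r.
by rewrite (operator_scale x t0 zt); exact: fin0.
Qed.

Lemma operator_zero_cvg (fs : nat -> Conv0 R n) x : epi_cvg fs zero ->
  (fun j => Psi (fs j) x) @ \oo --> 0%E.
Proof.
move=> fz; rewrite -(operator0 x); apply: continuous_eval fz _ => //.
by apply: filterE => y; rewrite operator0.
Qed.

Lemma operator_nat phi (N : nat) x :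
  Psi (ridge i (cvx_scale N%:R phi)) x = (N%:R%:E * Psi (ridge i phi) x)%E.
Proof.
elim: N => [|N IH].
  rewrite mul0e -[RHS](operator0 x); congr (Psi _ x); apply: ridge_ext => s /=.
  by rewrite normr0 !mul0r addr0.
have -> : ridge i (cvx_scale N.+1%:R phi) =
    conv0_add (ridge i (cvx_scale N%:R phi)) (ridge i phi).
  rewrite -ridge_add; apply: ridge_ext => s /=.
  by rewrite !ger0_norm// -natr1; ring.
rewrite aPsi /= IH -natr1 EFinD ge0_muleDl ?lee_fin// mul1e.
by [].
Qed.

(** Finiteness: after division by suitable large integers, the dilates
    of [phi] by [j] tend to [0], so that their images are eventually finite; these
    are multiples of the values of [Psi] at far away points. *)
Lemma operator_fin phi x : Psi (ridge i phi) x \is a fin_num.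
Proof.
pose Bd a := `|phi a| + `|phi (- a)| + 2 * `|phi 0|.
have Bd0 a : 0 <= Bd a by rewrite !addr_ge0// mulr_ge0.
have bd a s : `|s| <= a -> `|phi s| <= Bd a.
  have upper s' : `|s'| <= a -> phi s' <= `|phi a| + `|phi (- a)|.
    rewrite ler_norml => /andP[s1 s2].
    have p1 := ler_norm (phi a); have p2 := ler_norm (phi (- a)).
    have q1 := normr_ge0 (phi a); have q2 := normr_ge0 (phi (- a)).
    have [->|sa] := eqVneq s' a; first lra.
    have [->|sa'] := eqVneq s' (- a); first lra.
    have h : - a < s' < a by rewrite !lt_neqAle sa eq_sym sa' s1 s2.
    have := cvx_chord phi h; have /andP[h1 h2] := h.
    move=> H; have aa : 0 < a - - a by lra.
    rewrite -(ler_pM2l aa); nra.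
  move=> sa; have u1 := upper s sa.
  have u2 : phi (- s) <= `|phi a| + `|phi (- a)| by apply: upper; rewrite normrN.
  have half : 0 < (1 / 2 : R) < 1 by apply/andP; split; lra.
  have := cvx_convex phi s (- s) half.
  have -> : 1 / 2 * s + (1 - 1 / 2) * - s = 0 by field.
  have := normr_ge0 (phi 0); have := ler_norm (- phi 0); rewrite normrN => n1 n2 mid.
  by rewrite ler_norml /Bd; apply/andP; split; lra.
pose N (j : nat) := (Num.bound (j%:R * Bd (j%:R * j%:R))).+1.
have NB (j : nat) : j%:R * Bd (j%:R * j%:R) <= (N j)%:R.
  apply: ltW; apply: lt_le_trans (archi_boundP _) _; first by rewrite mulr_ge0.
  by rewrite ler_nat.
have N0 j : 0 < (N j)%:R :> R by rewrite ltr0n.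
pose ps (j : nat) := cvx_scale (N j)%:R^-1 (dilate j%:R phi).
have psc : cvx_cvg ps (affine 0 0).
  move=> s; rewrite /= mul0r addr0; apply/cvgrPdist_le => eps eps0.
  have [j1 _ H1] := nbhs_infty_ger `|s|.
  have [j2 _ H2] := nbhs_infty_ger (eps^-1).
  exists (maxn 1 (maxn j1 j2)) => // j /=; rewrite !geq_max => /and3P[j0 j1j j2j].
  have sj : `|s| <= j%:R := H1 j j1j.
  have ej : eps^-1 <= j%:R := H2 j j2j.
  have jp : 0 < j%:R :> R by rewrite ltr0n.
  rewrite sub0r normrN normrM normr_id [`|(N j)%:R^-1|]gtr0_norm ?invr_gt0//.
  rewrite ler_pdivrMl//.
  have b1 : `|phi (j%:R * s)| <= Bd (j%:R * j%:R).
    by apply: bd; rewrite normrM gtr0_norm// ler_pM2l.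
  apply: le_trans b1 _.
  have := NB j; have b0 := Bd0 (j%:R * j%:R) => nb.
  have ej' : 1 <= eps * j%:R.
    by rewrite -ler_pdivrMl// mulr1.
  have := ler_wpM2l (ltW eps0) nb; rewrite mulrA => nb'.
  have := ler_wpM2r b0 ej'; lra.
have lim := operator_zero_cvg x (ridge_cvg psc).
have lt01 : (0%E < 1%:E :> \bar R)%E by rewrite lte_fin.
have [M _ /(_ M.+1 (leqnSn _)) /= HM] := ecvg_lt lim lt01.
set j := M.+1 in HM.
have jp : 0 < j%:R :> R by rewrite ltr0n.
have j0 : j%:R != 0 :> R by rewrite gt_eqF.
have far : (Psi (ridge i phi) (j%:R *: x) < +oo)%E.
  rewrite -(@operator_scale (ridge i phi) (ridge i (dilate j%:R phi)) j%:R)//; last first.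
    by move=> y; rewrite !ridgeE /= mxE.
  have -> : ridge i (dilate j%:R phi) = ridge i (cvx_scale (N j)%:R (ps j)).
    apply: ridge_ext => s /=; rewrite !gtr0_norm ?invr_gt0// mulrA mulfV ?mul1r//.
    by rewrite gt_eqF.
  rewrite operator_nat; have := conv_gtNy (Psi (ridge i (ps j))) x.
  by case: (Psi (ridge i (ps j)) x) HM => // r _ _; rewrite -EFinM ltry.
rewrite fin_numElt conv_gtNy/=.
have [b fb] : exists b : R, (Psi (ridge i phi) (j%:R *: x)%R <= b%:E)%E.
  move: far; have := conv_gtNy (Psi (ridge i phi)) (j%:R *: x).
  by case: (Psi (ridge i phi) (j%:R *: x)) => // b _ _; exists b.
have f0 : (Psi (ridge i phi) 0%R <= (fine (Psi (ridge i phi) 0%R))%:E)%E.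
  by rewrite fineK// conv0_fin0.
have t01 : 0 <= (j%:R^-1 : R) <= 1 by rewrite invr_ge0 ltW//= invf_le1// ler1n.
have := econvex_le (@conv_convex _ _ (Psi (ridge i phi))) t01 fb f0.
rewrite scalerA mulVf// scale1r scaler0 addr0 => /le_lt_trans; apply.
by rewrite ltry.
Qed.

Definition op_fun phi : R := fine (Psi (ridge i phi) e).

Lemma op_funE phi : Psi (ridge i phi) e = (op_fun phi)%:E.
Proof. by rewrite fineK// operator_fin. Qed.

Lemma operator_ridge phi t : t != 0 ->
  Psi (ridge i phi) (t *: e) = (op_fun (dilate t phi))%:E.
Proof.
move=> t0; rewrite -op_funE; apply/esym; apply: operator_scale => // y.
by rewrite !ridgeE /= mxE.
Qed.

Lemma op_fun_add phi psi : op_fun (cvx_add phi psi) = op_fun phi + op_fun psi.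
Proof.
apply: EFin_inj; rewrite EFinD -!op_funE ridge_add aPsi; by [].
Qed.

Lemma op_fun_cvg phis phi : cvx_cvg phis phi -> (fun j => op_fun (phis j)) @ \oo --> op_fun phi.
Proof.
move=> c; apply: fine_cvg; rewrite -op_funE.
apply: continuous_eval (ridge_cvg c) _ => //.
by apply: filterE => y; exact: operator_fin.
Qed.

Lemma op_fun_nat phi (N : nat) : op_fun (cvx_scale N%:R phi) = N%:R * op_fun phi.
Proof. by apply: EFin_inj; rewrite EFinM -!op_funE operator_nat. Qed.

(** Additivity gives homogeneity for integers, hence for rationals, and
    continuity extends it to all nonnegative factors. *)
Lemma op_fun_scale a phi : op_fun (cvx_scale a phi) = `|a| * op_fun phi.
Proof.
pose c (j : nat) : R := (Num.truncn (j.+1%:R * `|a|))%:R / j.+1%:R.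
have c0 j : 0 <= c j by rewrite divr_ge0.
have cE j : op_fun (cvx_scale (c j) phi) = c j * op_fun phi.
  have jp : 0 < j.+1%:R :> R by rewrite ltr0n.
  have : op_fun (cvx_scale j.+1%:R (cvx_scale (c j) phi)) =
      op_fun (cvx_scale (Num.truncn (j.+1%:R * `|a|))%:R phi).
    congr (fine (Psi _ e)); apply: ridge_ext => s /=.
    rewrite (ger0_norm (c0 j)) !normr_nat mulrA; congr (_ * _).
    by rewrite /c mulrC divfK ?gt_eqF.
  rewrite !op_fun_nat => H; apply: (mulfI (lt0r_neq0 jp)).
  by rewrite H /c; field; rewrite gt_eqF.
have ca : c @ \oo --> `|a|.
  have low : (fun j : nat => `|a| - j.+1%:R^-1) @ \oo --> `|a|.
    rewrite -[X in _ --> X]subr0; apply: cvgB; [exact: cvg_cst|exact: cvg_harmonic].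
  apply: squeeze_cvgr low (cvg_cst _); apply: nearW => j.
  have jp : 0 < j.+1%:R :> R by rewrite ltr0n.
  have z0 : 0 <= j.+1%:R * `|a| by rewrite mulr_ge0.
  have /andP[h1 h2] := truncn_itv z0.
  rewrite /c ler_pdivrMr// ler_pdivlMr// [`|a| * _]mulrC h1 andbT.
  rewrite mulrBl mulVf ?gt_eqF// mulrC lerBlDr natr1; exact: ltW.
have cc : cvx_cvg (fun j => cvx_scale (c j) phi) (cvx_scale a phi).
  move=> s /=; under eq_fun do rewrite ger0_norm//.
  exact: cvgMl.
have := op_fun_cvg cc; under eq_fun do rewrite cE.
have H2 : (fun j => c j * op_fun phi) @ \oo --> `|a| * op_fun phi by apply: cvgMl.
by move=> H; exact: (cvg_unique _ H H2).
Qed.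

Lemma op_fun_functional : functional op_fun.
Proof.
split; [|exact: op_fun_add|exact: op_fun_scale|exact: op_fun_cvg].
by move=> phi psi e'; rewrite /op_fun (ridge_ext e').
Qed.

End operator.

(** * An operator is determined by its functional *)

Section line.
Variables (R : realType) (n : nat) (i : 'I_n).
Implicit Types (f : Conv0 R n) (x : 'cV[R]_n).
Local Notation e := (basis R i).

Lemma line_convex f : (forall x, f x \is a fin_num) -> convexR (fun s => fine (f (s *: e))).
Proof.
move=> ff s s' t t01; rewrite -lee_fin EFinD !EFinM !fineK ?ff//.
by rewrite scalerDl -!scalerA; exact: conv_convex.
Qed.

Definition line f (ff : forall x, f x \is a fin_num) := Cvx (line_convex ff).

(** A nonzero column has rank one, hence is the image of one fixed column under
    an invertible matrix, its extended column basis up to a scalar. *)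
Lemma basis_transitive x : x != 0 ->
  exists A A' : 'M[R]_n, A *m A' = 1%:M /\ A' *m e = x.
Proof.
have column (y : 'cV[R]_n) : y != 0 -> exists2 C : 'M[R]_n, C \in unitmx & y = C *m pid_mx 1.
  move=> y0; have r1 : \rank y = 1%N.
    apply/eqP; rewrite eqn_leq; apply/andP; split; first exact: rank_leq_col.
    by rewrite lt0n mxrank_eq0.
  have := mulmx_ebase y; rewrite r1 (mx11_scalar (row_ebase y)).
  set a := row_ebase y 0 0; rewrite mul_mx_scalar scalemxAl => yE.
  exists (a *: col_ebase y); last by rewrite yE.
  rewrite unitmxZ ?col_ebase_unit//; have := row_ebase_unit y.
  by rewrite [row_ebase y]mx11_scalar unitmxE det_scalar expr1.
have e0 : e != 0.
  by apply/eqP => /matrixP/(_ i 0)/eqP; rewrite !mxE !eqxx oner_eq0.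
move=> /column[Cx ux xE]; have [Ce ue eE] := column _ e0.
exists (Ce *m invmx Cx), (Cx *m invmx Ce); split.
  by rewrite mulmxA mulmxKV// mulmxV.
by rewrite eE -mulmxA mulKmx.
Qed.

(** Functions in the domain are continuous at the origin, so that the values
    elsewhere determine the value there. *)
Lemma conv0_eq_off0 (u v : Conv0 R n) : (forall x, x != 0 -> u x = v x) -> forall x, u x = v x.
Proof.
move=> uv x; have [->|/uv//] := eqVneq x 0.
pose xs (j : nat) := j.+1%:R^-1 *: e.
have xs0 : xs @ \oo --> (0 : 'cV[R]_n).
  by rewrite -(scale0r e); apply: cvgZl; exact: cvg_harmonic.
have cont (w : Conv0 R n) : (fun j => w (xs j)) @ \oo --> w 0.
  have rec : has_recovery (fun=> w) w by exact: epi_has_recovery (conv0_epi_cst w).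
  apply: (recovery_continuous_cvg (fun=> @conv_convex _ _ w) rec) => //.
  - exact: conv0_fin.
  - exact: cvg_cst.
have E j : u (xs j) = v (xs j).
  apply: uv; rewrite scaler_eq0 invr_eq0 pnatr_eq0 /=.
  by apply/eqP => /matrixP/(_ i 0)/eqP; rewrite !mxE !eqxx oner_eq0.
have := cont u; under eq_fun do rewrite E.
by move=> H; apply: (cvg_unique _ H (cont v)).
Qed.

Variable Psi : Conv0 R n -> Conv0 R n.
Hypotheses (cPsi : continuous Psi) (aPsi : conv0_additive Psi) (ePsi : GL_equivariant Psi).

(** Contracting all directions but the [i]-th one leaves the value at the basis
    vector unchanged, while the function converges to its restriction to a
    line, extended as a ridge function. *)
Lemma operator_line f (ff : forall x, f x \is a fin_num) :
  Psi f e = (op_fun i Psi (line ff))%:E.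
Proof.
pose A' (j : nat) : 'M[R]_n := diag_mx (\row_k if k == i then 1 else j.+1%:R^-1).
pose A (j : nat) : 'M[R]_n := diag_mx (\row_k if k == i then 1 else j.+1%:R).
have AA j : A j *m A' j = 1%:M.
  rewrite mulmx_diag -diag_const_mx; congr diag_mx; apply/matrixP => a b.
  rewrite !mxE; case: ifP => _; first by rewrite mulr1.
  by rewrite mulfV.
pose g j := conv0_act (A j) f.
have gE j x : g j x = f (A' j *m x) by exact: conv0_act_inv.
have A'x j x k : (A' j *m x) k 0 = (if k == i then 1 else j.+1%:R^-1) * x k 0.
  by rewrite mul_diag_mx !mxE.
have A'e j : A' j *m e = e.
  apply/matrixP => k l; rewrite ord1 A'x !mxE eqxx andbT.
  by case: eqP => _; rewrite ?mulr1 ?mulr0.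
have Pg j : Psi (g j) e = Psi f e.
  by rewrite (operator_act ePsi e (AA j) (gE j)) A'e.
have gc : epi_cvg g (ridge i (line ff)).
  apply: pointwise_epi_cvg => [j|//|x]; first exact: conv_convex.
  have rec : has_recovery (fun=> f) f by exact: epi_has_recovery (conv0_epi_cst f).
  rewrite ridgeE /= fineK//.
  rewrite (_ : (fun j => _) = (fun j => f (A' j *m x))); last first.
    by apply/funext => j; exact: gE.
  apply: (recovery_continuous_cvg (fun=> @conv_convex _ _ f) rec).
  - by apply: filterE => y; exact: ff.
  - exact: cvg_cst.
  have harm : (fun j : nat => j.+1%:R^-1 * `|x|) @ \oo --> (0 : R).
    by rewrite -(mul0r `|x|); apply: cvgMl; exact: cvg_harmonic.
  apply/cvgrPdist_le => eps eps0; move/cvgrPdist_le : harm => /(_ _ eps0).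
  apply: filterS => j; rewrite sub0r normrN ger0_norm ?mulr_ge0// => jx.
  apply: norm_le_coord; first exact: ltW.
  move=> k.
  have -> : (x i 0 *: e - A' j *m x) k 0 =
      x i 0 * (k == i)%:R - (if k == i then 1 else j.+1%:R^-1) * x k 0.
    by rewrite -A'x mxE [X in X + _]mxE [X in _ + X]mxE mxE eqxx andbT.
  case: eqP => [->|_]; first by rewrite mulr1 mul1r subrr normr0 ltW.
  rewrite mulr0 sub0r normrN normrM ger0_norm//; apply: le_trans jx.
  by rewrite ler_wpM2l// ler_coord_norm.
have fin : \forall y \near e, Psi (ridge i (line ff)) y \is a fin_num.
  by apply: filterE => y; exact: (operator_fin i cPsi aPsi ePsi).
have := continuous_eval cPsi gc fin; under eq_fun do rewrite Pg.
rewrite (op_funE i cPsi aPsi ePsi) => H.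
exact: (cvg_unique _ (cvg_cst _) H).
Qed.

End line.

Section uniqueness.
Variables (R : realType) (n : nat) (i : 'I_n) (Psi Phi : Conv0 R n -> Conv0 R n).
Hypotheses (cPsi : continuous Psi) (aPsi : conv0_additive Psi) (ePsi : GL_equivariant Psi).
Hypotheses (aPhi : conv0_additive Phi) (ePhi : GL_equivariant Phi).
Hypothesis epiPhi : forall (fs : nat -> Conv0 R n) (f : Conv0 R n),
  epi_cvg fs f -> epi_cvg (fun j => Phi (fs j)) (Phi f).
Hypothesis same_const : op_fun i Psi (affine 1 0) = op_fun i Phi (affine 1 0).
Hypothesis same_hinge : forall t, op_fun i Psi (hinge t (-1)) = op_fun i Phi (hinge t (-1)).

Let cPhi : continuous Phi. Proof. exact: epi_continuous epiPhi. Qed.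

(** Equivariance moves any nonzero point to a basis vector, where only the
    restriction of the function to one line matters. *)
Lemma operator_unique_finite (f : Conv0 R n) : (forall x, f x \is a fin_num) -> Psi f = Phi f.
Proof.
move=> ff; apply: conv0_ext; apply/funext; apply: (conv0_eq_off0 i) => x x0.
have [A [A' [AA A'e]]] := basis_transitive i x0.
have gE y : conv0_act A f y = f (A' *m y) by exact: conv0_act_inv.
have gf y : conv0_act A f y \is a fin_num by rewrite gE.
rewrite -A'e -(operator_act ePsi _ AA gE) -(operator_act ePhi _ AA gE).
rewrite (operator_line i cPsi aPsi ePsi gf) (operator_line i cPhi aPhi ePhi gf).
congr EFin; apply: functional_unique => //.
- exact: op_fun_functional.
- exact: op_fun_functional.
Qed.

(** By density of finite functions: the common images of the approximating
    sequence epi-converge to [Phi f] and tend to [Psi f] in the epi-topology, whose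
    limits are unique on epi-convergent sequences. *)
Lemma operator_unique (f : Conv0 R n) : Psi f = Phi f.
Proof.
have [fs fin ff] := finite_dense f; apply/esym; apply: epi_cvg_unique (epiPhi ff) _.
have -> : (fun j => Phi (fs j)) = Psi \o fs.
  by apply/funext => j; rewrite /= operator_unique_finite.
by apply: continuous_cvg; [exact: cPsi|exact: epi_cvg_cvg].
Qed.

End uniqueness.

(** * Representation *)

Section profile.
Variables (R : realType) (n : nat) (i : 'I_n) (Psi : Conv0 R n -> Conv0 R n).
Hypotheses (cPsi : continuous Psi) (aPsi : conv0_additive Psi) (ePsi : GL_equivariant Psi).
Local Notation e := (basis R i).
Local Notation unit_hinge := (ridge i (hinge 1 (-1))).
Local Notation E := (op_fun i Psi).

Let fE : functional E. Proof. exact: op_fun_functional. Qed.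

(** Taking the image of a single ridge function along a line makes the convexity
    of the map [t |-> E (hinge t (-1))] apparent. *)
Definition profile : cvx R := line i (operator_fin i cPsi aPsi ePsi (hinge 1 (-1))).

Lemma profileE t : t != 0 -> profile t = E (hinge t (-1)).
Proof.
move=> t0; rewrite /profile /= (operator_ridge i cPsi aPsi ePsi)//=.
apply: (functional_ext fE) => s.
by rewrite [LHS](_ : _ = hinge 1 (-1) (t * s))// !hingeE mul1r.
Qed.

Lemma op_fun_zero : E (affine 0 0) = 0.
Proof. by rewrite /op_fun (operator0 i aPsi ePsi) fine0. Qed.

(** Arbitrarily large multiples of [hinge t (-1)] tend to [0] as [t] tends to
    [0], since they vanish on [-1 / |t|, 1 / |t|]; so must their images. *)
Lemma profile_flat : exists2 delta : R, 0 < delta &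
  forall t, `|t| <= 2 * delta -> profile t = 0.
Proof.
have [delta delta0 Hd] : exists2 delta : R, 0 < delta &
    forall t, t != 0 -> `|t| <= 2 * delta -> profile t = 0.
  apply: contrapT => H.
  have /choice[ts Hts] : forall j : nat, exists t, [/\ t != 0, `|t| <= 2 * j.+1%:R^-1 & profile t != 0].
    move=> j; apply: contrapT => K; apply: H; exists j.+1%:R^-1; first by rewrite invr_gt0.
    move=> t t0 tj; apply/eqP; apply: contrapT => /negP kt; apply: K; by exists t.
  pose N j := Num.bound (`|profile (ts j)|^-1).
  have NB j : 1 < (N j)%:R * `|profile (ts j)|.
    have [_ _ k0] := Hts j.
    by rewrite -ltr_pdivrMr ?normr_gt0// div1r; apply: archi_boundP; rewrite invr_ge0.
  pose hs j := cvx_scale (N j)%:R (hinge (ts j) (-1)).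
  have hsc : cvx_cvg hs (affine 0 0).
    move=> s; rewrite /= mul0r addr0.
    have [j0 _ Hj0] := nbhs_infty_ger (2 * `|s|).
    apply: cvg_near_cst; exists j0 => // j j0j.
    have [_ tj _] := Hts j.
    have sj : 2 * `|s| <= j%:R := Hj0 j j0j.
    have jp : 0 < j.+1%:R :> R by rewrite ltr0n.
    have ts1 : ts j * s <= 1.
      apply: le_trans (ler_norm _) _; rewrite normrM -(ler_pM2r jp) mul1r -natr1.
      have tj' : `|ts j| * j.+1%:R <= 2 by rewrite -ler_pdivlMr.
      have := ler_wpM2r (normr_ge0 s) tj'; rewrite -natr1; lra.
    by rewrite max_l ?mulr0//; lra.
  have := functional_cvg fE hsc; rewrite op_fun_zero => /cvgrPdist_lt/(_ _ ltr01)[M _].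
  move=> /(_ M (leqnn M)) /=; have [t0 _ _] := Hts M.
  rewrite sub0r normrN (functional_scale fE) -profileE// normrM normr_id normr_nat.
  by move=> H1; have := NB M; rewrite ltNge (ltW H1).
exists delta => // t td; have [->|t0] := eqVneq t 0; last exact: Hd.
have d1 : profile delta = 0 by apply: Hd; rewrite ?gt_eqF// gtr0_norm//; lra.
have d2 : profile (2 * delta) = 0.
  by apply: Hd; rewrite ?gt_eqF ?mulr_gt0// gtr0_norm ?mulr_gt0.
have d3 : profile (- delta) = 0.
  by apply: Hd; rewrite ?oppr_eq0 ?gt_eqF// normrN gtr0_norm//; lra.
have c1 : - delta < 0 < delta by apply/andP; split; lra.
have c2 : 0 < delta < 2 * delta by apply/andP; split; lra.
have := cvx_chord profile c1; have := cvx_chord profile c2.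
rewrite d1 d2 d3 => h1 h2; apply/eqP; rewrite eq_le; apply/andP; split.
  by rewrite -(ler_pM2l (_ : 0 < delta - - delta)); lra.
by rewrite -(ler_pM2l delta0); lra.
Qed.

(** The hinges [hinge a (- 1 / j)] tend to [hinge a 0], so by homogeneity
    [profile] grows at most linearly along the multiples of [a = 1] and [a = -1];
    the slopes of a convex function of linear growth are bounded. *)
Lemma profile_slopes : exists B : R, forall u v, u < v -> `|slope profile u v| <= B.
Proof.
have side a : a != 0 -> exists2 C : R, 0 <= C &
    \forall j \near \oo, `|profile (a * j.+1%:R)| <= C * j.+1%:R.
  move=> a0; exists (`|E (hinge a 0)| + 1); first exact: addr_ge0.
  have hc : cvx_cvg (fun j => hinge a (- j.+1%:R^-1)) (hinge a 0) by exact: hinge_cvg.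
  move: (functional_cvg fE hc) => /cvgrPdist_lt/(_ _ ltr01).
  apply: filterS => j Hj.
  have jp : 0 < j.+1%:R :> R by rewrite ltr0n.
  rewrite profileE; last by rewrite mulf_neq0// gt_eqF.
  have -> : E (hinge (a * j.+1%:R) (-1)) = E (cvx_scale j.+1%:R (hinge a (- j.+1%:R^-1))).
    apply: (functional_ext fE) => s.
    rewrite [RHS](_ : _ = `|j.+1%:R| * hinge a (- j.+1%:R^-1) s)// !hingeE gtr0_norm//.
    by rewrite maxr_pMr ?ltW// mulr0; congr Num.max; field; rewrite nat1r gt_eqF.
  rewrite (functional_scale fE) normrM normr_id normr_nat mulrC ler_pM2r//.
  have := ler_normB (E (hinge a 0)) (E (hinge a 0) - E (hinge a (- j.+1%:R^-1))).
  rewrite opprB addrC subrK; lra.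
have [C1 C10 [N1 _ H1]] := side 1 (oner_neq0 _).
have [C2 C20 [N2 _ H2]] : exists2 C : R, 0 <= C &
    \forall j \near \oo, `|profile (-1 * j.+1%:R)| <= C * j.+1%:R.
  by apply: side; rewrite oppr_eq0 oner_neq0.
exists (3 * (C1 + C2)) => u v uv.
have [N3 _ H3] := nbhs_infty_ger (`|u| + `|v|).
pose j := maxn N1 (maxn N2 N3).
have j1 : (N1 <= j)%N by rewrite leq_maxl.
have j2 : (N2 <= j)%N by rewrite /j maxnCA leq_maxl.
have j3 : (N3 <= j)%N by rewrite /j !leq_max leqnn !orbT.
have uvj : `|u| + `|v| <= j%:R := H3 j j3.
pose M : R := j.+1%:R.
have M0 : 0 < M by rewrite ltr0n.
have jM : j%:R + 1 = M by rewrite /M -natr1.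
pose j' := j + j.+1.
have jj' : (j <= j')%N by exact: leq_addr.
have M2 : j'.+1%:R = 2 * M :> R by rewrite /j' -addSn natrD /M; ring.
have := H1 j j1; have := H1 j' (leq_trans j1 jj').
have := H2 j j2; have := H2 j' (leq_trans j2 jj').
rewrite M2 -/M !mul1r !mulN1r !ler_norml => /andP[a1 a2] /andP[a3 a4] /andP[a5 a6] /andP[a7 a8].
have := ler_norm u; have := ler_norm v; have := ler_norm (- u); have := ler_norm (- v).
rewrite !normrN => n1 n2 n3 n4.
have nu := normr_ge0 u; have nv := normr_ge0 v.
have up : slope profile u v <= slope profile M (2 * M) by apply: slope_le; lra.
have lo : slope profile (- (2 * M)) (- M) <= slope profile u v by apply: slope_le; lra.
have e1 : slope profile M (2 * M) <= 3 * (C1 + C2).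
  rewrite /slope ler_pdivrMr; last lra.
  have c2M : 0 <= C2 * M by rewrite mulr_ge0// ltW.
  lra.
have e2 : - (3 * (C1 + C2)) <= slope profile (- (2 * M)) (- M).
  rewrite /slope ler_pdivlMr; last lra.
  have c1M : 0 <= C1 * M by rewrite mulr_ge0// ltW.
  lra.
by apply/andP; split; lra.
Qed.

End profile.

Section admissible.
Variable R : realType.

Lemma null_admissible (nu : {finite_measure set (measurableTypeR R) -> \bar R}) (A : R) :
  nu [set s : R | A < `|s|] = 0%E ->
  (\int[nu]_(s in @Rtimes R) (`|s : R|^-1)%:E < +oo)%E -> admissible_measure nu.
Proof.
move=> nuA nuI; split=> //.
have sub : msupport nu `<=` `[- A, A]%classic.
  move=> s Hs; rewrite /= in_itv/= -ler_norml leNgt; apply/negP => As.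
  have : (0 < nu [set s : R | (A < `|s|)%R])%E.
    by apply: Hs; split=> //; exact: open_norm_gt.
  by rewrite nuA ltxx.
by apply: (subclosed_compact (msupport_closed (nu := nu)) _ sub); exact: segment_compact.
Qed.

End admissible.

(** The measure is the one for which [profile] is the superposition of hinges;
    the operator that it defines agrees with [Psi] on constants and on the hinges
    with parameter [t], hence everywhere. *)
Lemma operator_representation (R : realType) (n : nat) (i : 'I_n)
    (Psi : Conv0 R n -> Conv0 R n) :
  continuous Psi -> conv0_additive Psi -> GL_equivariant Psi ->
  exists (nu : {finite_measure set (measurableTypeR R) -> \bar R}) (c : R),
    admissible_measure nu /\ represented_by nu c Psi.
Proof.
move=> cPsi aPsi ePsi.
have [delta delta0 k0] := profile_flat i cPsi aPsi ePsi.
have [B kB] := profile_slopes i cPsi aPsi ePsi.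
have [nu [nuA nuI nuk]] := representing_measure kB delta0 k0.
pose c := op_fun i Psi (affine 1 0).
exists nu, c; split; first exact: null_admissible nuA nuI.
have A0 : 0 < delta^-1 by rewrite invr_gt0.
pose Phi := @formula_op R n nu c _ A0 nuA nuI.
have PhiE phi : op_fun i Phi phi = fine (formula nu c (ridge i phi) (basis R i)) by [].
suff PsiPhi : forall f, Psi f = Phi f by move=> f x; rewrite PsiPhi.
apply: (operator_unique (i := i)) => //.
- exact: formula_op_additive.
- exact: formula_op_equivariant.
- by move=> fs f; exact: formula_op_epi.
- rewrite PhiE /formula ridgeE /= mul0r addr0 mule1.
  rewrite integral0_eq ?adde0// => s _.
  by rewrite /diffq !ridgeE /= !mul0r addr0 subee// mul0e.
- move=> t; have h0 : hinge t (-1) 0 = 0.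
    by rewrite hingeE mulr0 add0r max_l// lerN10.
  rewrite PhiE /formula ridgeE mxE h0 mule0 add0e.
  under eq_integral => s _ do rewrite diffq_ridge h0 subr0.
  rewrite nuk; have [->|t0] := eqVneq t 0; last by rewrite profileE.
  rewrite k0 ?normr0 ?mulr_ge0 ?ltW// -[RHS](op_fun_zero i aPsi ePsi).
  apply: (functional_ext (op_fun_functional i cPsi aPsi ePsi)) => s.
  by rewrite hingeE /= !mul0r !add0r max_l// lerN10.
Qed.

Theorem theorem1 (R : realType) (n : nat) (n_ge1 : (1 <= n)%N) :
  (forall Psi : Conv0 R n -> Conv0 R n,
     [/\ continuous Psi, conv0_additive Psi & GL_equivariant Psi] <->
     exists (nu : {finite_measure set (measurableTypeR R) -> \bar R}) (c : R),
       admissible_measure nu /\ represented_by nu c Psi) /\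
  (forall (nu : {finite_measure set (measurableTypeR R) -> \bar R}) (c : R),
     admissible_measure nu ->
     (exists Psi : Conv0 R n -> Conv0 R n, represented_by nu c Psi) /\
     (forall Psi : Conv0 R n -> Conv0 R n, represented_by nu c Psi ->
        (conv0_monotone Psi <->
           (\int[nu]_(s in @Rtimes R) (`|s : R| ^- 2)%:E <= c%:E < +oo)%E) /\
        (dually_translation_invariant Psi <->
           (\int[nu]_(s in @Rtimes R) ((s : R)^-1)%:E = 0)%E))).
Proof.
pose i := Ordinal n_ge1.
have reprE nu c A (A0 : 0 < A) nuA nuI (Psi : Conv0 R n -> Conv0 R n) :
    represented_by nu c Psi -> Psi = @formula_op R n nu c A A0 nuA nuI.
  by move=> PsiE; apply/funext => f; apply: conv0_ext; apply/funext => x; exact: PsiE.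
split=> [Psi|nu c [/compact_support_null[A A0 nuA] nuI]].
  split=> [[]|[nu [c [[/compact_support_null[A A0 nuA] nuI] /(reprE _ _ _ A0 nuA nuI) ->]]]].
    exact: operator_representation.
  split; [exact: formula_op_continuous|exact: formula_op_additive|].
  exact: formula_op_equivariant.
split=> [|Psi PsiE]; first by exists (formula_op c A0 nuA nuI).
split; split=> [H|].
- rewrite ltry andbT; apply: (formula_monotone_inv i nuA nuI) => f g fg x.
  by have := H f g fg x; rewrite !PsiE.
- by move=> /andP[H _] f g fg x; rewrite !PsiE; exact: (formula_monotone nuA nuI).
- by apply/(formula_dual_translation i c nuA nuI) => f l x; have := congr1 (fun h : Conv0 R n => h x) (H f l); rewrite /= !PsiE.
- move=> /(formula_dual_translation i c nuA nuI) H f l.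
  by apply: conv0_ext; apply/funext => x; rewrite !PsiE; exact: H.
Qed.
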